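(* Let $(E,C)$ be an adaptable separated graph. Then there is a canonical isomorphism of topological groupoids $$\phi\colon\mathcal G_{tight}(S(E,C))\to\mathcal H$$ between the tight groupoid $\mathcal G_{tight}(S(E,C))$ of the inverse semigroup $S(E,C)$ and the topological groupoid $\mathcal H$ of triples $(x,n,y)$ defined in the context.
   Context: **Adaptable separated graphs.** $\mathbb N=\{1,2,\dots\}$, $\mathbb Z^+=\{0,1,\dots\}$. For a directed graph $E=(E^0,E^1,s,r)$, paths are $e_1\cdots e_n$ with $r(e_i)=s(e_{i+1})$; vertices are paths of length $0$. A separated graph $(E,C)$ is a directed graph $E$ with $C=\bigsqcup_{v\in E^0}C_v$, where $C_v$ is a partition of $s^{-1}(v)$ into nonempty subsets ($C_v=\emptyset$ if $v$ is a sink). It is finitely separated if all sets in $C$ are finite. Put $v\le w$ if there is a path from $w$ to $v$; let $(I,\le)$ be the antisymmetrization of $(E^0,\le)$, whose elements are the transitive components. A finitely separated graph $(E,C)$ is adaptable if $I$ is finite and there are a partition $I=I_{free}\sqcup I_{reg}$ and subgraphs $(E_p)_{p\in I}$, with $E_p^0$ the vertex set of the component $p$, such that: (1) $E^0=\bigsqcup_p E_p^0$; $E_p$ is a transitive (any two vertices joined by a directed path) row-finite graph if $p\in I_{reg}$; $E_p^0=\{v^p\}$ if $p\in I_{free}$. (2) For $p\in I_{reg}$, $w\in E_p^0$: $|C_w|=1$, $|s_{E_p}^{-1}(w)|\ge 2$, and every edge with source $w$ lies in $E_p$ or has range in $E_q^0$ with $q<p$. (3) For $p\in I_{free}$: $s^{-1}(v^p)=\emptyset$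 iff $p$ is minimal in $I$ (then put $k(p)=0$). If $p$ is not minimal, $C_{v^p}=\{X_1^{(p)},\dots,X_{k(p)}^{(p)}\}$ is finite with $X_i^{(p)}=\{\alpha(p,i),\beta(p,i,1),\dots,\beta(p,i,g(p,i))\}$, $g(p,i)\ge1$, $\alpha(p,i)$ a loop at $v^p$, $r(\beta(p,i,t))\in E_q^0$ with $q<p$; and $E_p^1=\{\alpha(p,1),\dots,\alpha(p,k(p))\}$. Edges from $E_p^0$ to $E_q^0$ with $q<p$ are called connectors. **The inverse semigroup $S(E,C)$.** It is the $*$-semigroup with $0$ ($*$-semigroup: $s^{**}=s$, $(st)^*=t^*s^*$) generated by $E^0\cup E^1\cup\{(t_i^v)^{\pm1}: i\in\mathbb N,v\in E^0\}$ with relations: (R1) $vw=\delta_{v,w}v$, $v^*=v$ for $v,w\in E^0$; (R2) $e=s(e)e=er(e)$ for $e\in E^1$, and $e^*f=\delta_{e,f}r(e)$ for $e,f$ in the same set $X\in C$; (R3) for $p\in I_{free}$, $i\ne j$: $\alpha(p,i)\alpha(p,j)=\alpha(p,j)\alpha(p,i)$, $\alpha(p,i)\alpha(p,j)^*=\alpha(p,j)^*\alpha(p,i)$; (R4) for $p\in I_{free}$: $\beta(p,i,s)^*\beta(p,j,t)=0$ if $(i,s)\neq(j,t)$; (R5) for each $v$ the elements $(t_i^v)^{\pm1}$ commute mutually, $vt_i^v=t_i^v=t_i^vv$, $t_i^v(t_i^v)^{-1}=v=(t_i^v)^{-1}t_i^v$, $(t_i^v)^*=(t_i^v)^{-1}$;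 (R6) $t_i^{s(e)}e=e\,t_i^{r(e)}$ if $s(e)\in E_p^0$, $p\in I_{reg}$; (R7) for $p\in I_{free}$: $(t_i^{v^p})^{\pm1}\beta(p,j,s)=\beta(p,j,s)(t^{r(\beta(p,j,s))}_{i+k(p)-1})^{\pm1}$; (R8) for $p\in I_{free}$, $i\ne j$: $\alpha(p,i)\beta(p,j,s)=\beta(p,j,s)t^{r(\beta(p,j,s))}_{\sigma_j^p(i)}$ and $\alpha(p,i)^*\beta(p,j,s)=\beta(p,j,s)(t^{r(\beta(p,j,s))}_{\sigma_j^p(i)})^{-1}$, where $\sigma_j^p$ is the increasing bijection $\{1,\dots,k(p)\}\setminus\{j\}\to\{1,\dots,k(p)-1\}$; (R9) for $p\in I_{free}$: $t_i^{v^p}$ commutes with $\alpha(p,j)$ and $\alpha(p,j)^*$. $S(E,C)$ is an inverse semigroup; $\mathcal E$ is its semilattice of idempotents ($e\le f$ iff $ef=e$). **Tight groupoid.** A filter on $\mathcal E$ is a nonempty $\eta\subseteq\mathcal E$ with $0\notin\eta$, closed under products and upward closed. Filters are topologized as a subspace of $\{0,1\}^{\mathcal E}$. A finite cover of $\mathcal F_e=\{f\in\mathcal E:f\le e\}$ is a finite $Z\subseteq\mathcal F_e$ such that every $0\ne f\in\mathcal F_e$ has $fz\neq0$ for some $z\in Z$. A filter $\eta$ is tight if $e\in\eta$ implies $Z\cap\eta\ne\emptyset$ for every finite cover $Z$ of $\mathcal F_e$; $\widehat{\mathcal E}_{tight}$ is the space of tight filters (it coincides with the space $\widehat{\mathcal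 E}_\infty$ of maximal filters). For $e\in\mathcal E$ let $D_e=\{\eta\in\widehat{\mathcal E}_{tight}: e\in\eta\}$; $s\in S(E,C)$ acts by $\alpha_s\colon D_{s^*s}\to D_{ss^*}$, $\alpha_s(\eta)=\{f\in\mathcal E: s^*fs\in\eta\}$. $\mathcal G_{tight}(S(E,C))$ is the groupoid of germs $[s,x]$, $x\in D_{s^*s}$, where $[s,x]=[s',y]$ iff $x=y$ and $sf=s'f$ for some $f\in\mathcal E$ with $f\in x$; source $x$, range $\alpha_s(x)$, $[s,\alpha_t(x)][t,x]=[st,x]$, $[s,x]^{-1}=[s^*,\alpha_s(x)]$. Its topology is generated by $\Theta(s,U)=\{[s,x]:x\in U\}$, $U\subseteq D_{s^*s}$ open. **Normal form.** A step is a path $\alpha(p,i)^m\beta(p,i,t)$ ($p\in I_{free}$, $m\ge0$), or a path $\lambda\beta$ with $\lambda$ a finite path in $E_p$, $p\in I_{reg}$, and $\beta$ a connector with $s(\beta)=r(\lambda)$. A c-path is a concatenation of finitely many (possibly zero) steps; trivial c-paths are vertices. A monomial at $p$ is: for $p\in I_{free}$, $\mathbf m=\prod_i(t_i^{v^p})^{d_i}\prod_{j=1}^{k(p)}\alpha(p,j)^{k_j}(\alpha(p,j)^* )^{l_j}$ with $k_j,l_j\ge0$; for $p\in I_{reg}$, $\mathbf m=\prod_i(t_i^v)^{d_i}\lambda\eta^*$ with $\lambda,\eta$ finite paths in $E_p$, $s(\lambda)=v$, $r(\lambda)=r(\eta)$; here $d=(d_i)\in\mathbb Z^{(\infty)}$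 (finitely supported integer sequences). Every nonzero element of $S(E,C)$ is uniquely $\gamma\mathbf m\nu^*$ with $\gamma,\nu$ c-paths and $\mathbf m$ a monomial at some $p$, where $r(\gamma)=s(\lambda)$, $r(\nu)=s(\eta)$ if $p$ is regular, $r(\gamma)=r(\nu)=v^p$ if $p$ is free. **Translation exponents.** For $d\in\mathbb Z^{(\infty)}$ and a connector $\beta$: if $s(\beta)\in E_p^0$ with $p$ regular put $T_\beta(d)=d$; if $\beta=\beta(p,j,s)$, $p$ free, put $T_\beta(d)_{i+k(p)-1}=d_i$ for $i\ge1$ and $T_\beta(d)_i=0$ for $i<k(p)$. Let $\gamma'$ be a c-path starting in $E_p^0$ with connectors $\beta_1,\dots,\beta_n$ in order, and let $\mathbf m$ be a monomial at $p$, written $\mathbf m=\prod_i(t_i^{v^p})^{d_i}\prod_{j=1}^{k(p)}\alpha(p,j)^{k_j}(\alpha(p,j)^* )^{l_j}$ if $p$ is free and $\mathbf m=\prod_i(t_i^v)^{d_i}\lambda\eta^*$ if $p$ is regular, with $d=(d_i)\in\mathbb Z^{(\infty)}$. The exponent sequence $\phi_{\gamma'}(\mathbf m)\in\mathbb Z^{(\infty)}$ is: $d$ if $\gamma'$ is trivial; $T_{\beta_n}\cdots T_{\beta_1}(d)$ if $p$ is regular; $T_{\beta_n}\cdots T_{\beta_2}(T_{\beta_1}(d)+c)$ if $p$ is free and $\beta_1=\beta(p,i,t)$, where $c_{\sigma_i^p(j)}=k_j-l_j$ for $j\ne i$ and all other coordinates of $c$ are $0$. **Infinite paths.** An infinite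 path is either $\gamma\prod_{j=1}^{k(p)}\alpha(p,j)^\infty$ with $\gamma$ a c-path with $r(\gamma)=v^p$, $p\in I_{free}$, or $\gamma\lambda$ with $\gamma$ a c-path with $r(\gamma)\in E_p^0$, $p\in I_{reg}$, and $\lambda$ an infinite path in $E_p$ starting at $r(\gamma)$. In both cases the path is said to end at $p$. Infinite paths are in bijection with $\widehat{\mathcal E}_\infty$. **The groupoid $\mathcal H$.** By an initial segment ending in $E_p$ we mean $\gamma=\gamma'\prod_{j=1}^{k(p)}\alpha(p,j)^{l_j}$ ($l_j\in\mathbb Z^+$, $\gamma'$ a c-path ending at $v^p$) if $p$ is free, or $\gamma=\gamma'\lambda'$ ($\gamma'$ a c-path with range in $E_p^0$, $\lambda'$ a finite path in $E_p$) if $p$ is regular. Put $|\gamma|_\infty=(l_1+|\gamma'|,\dots,l_{k(p)}+|\gamma'|,0,0,\dots)\in\mathbb Z^{(\infty)}$ if $p$ is free, and $|\gamma|_\infty=(|\gamma|,0,0,\dots)$ if $p$ is regular, $|\cdot|$ being the usual length. $\mathcal H$ is the set of triples $(x,n,y)$ where $x=\gamma\lambda$, $y=\nu\lambda$ are infinite paths ending at the same $p\in I$, with $\gamma,\nu$ initial segments ending in $E_p$ and $\lambda$ an infinite path in $E_p$ ($\lambda=\prod_j\alpha(p,j)^\infty$ if $p$ is free), and $n=(n_1,|\gamma|_\infty-|\nu|_\infty)\in\mathbb Z^{(\infty)}\times\mathbb Z^{(\infty)}$ with $n_1\in\mathbb Z^{(\infty)}$ arbitrary. Product $(x,n,y)(y,m,z)=(x,n+m,z)$,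 inverse $(x,n,y)^{-1}=(y,-n,x)$. The topology has as basis the sets $\mathcal Z(s)$, $s\in S(E,C)$, where ($\mathcal Z(0)=\emptyset$ and) for $s=\gamma\mathbf m\nu^*$ in normal form: - $p$ regular, $\mathbf m=\prod(t_i^v)^{d_i}\lambda\eta^*$: $\mathcal Z(s)$ consists of all $(\gamma\lambda x_0,(n_1,n_2),\nu\eta x_0)$ with $x_0=\gamma'\lambda'$ an infinite path starting at $r(\lambda)$ ($\gamma'$ a c-path, $\lambda'$ an infinite path in the component of $r(\gamma')$), $n_1=\phi_{\gamma'}(\mathbf m)$, $n_2=|\gamma\lambda\gamma'|_\infty-|\nu\eta\gamma'|_\infty$. - $p$ free, $\mathbf m=\prod(t_i^{v^p})^{d_i}\prod_j\alpha(p,j)^{k_j}(\alpha(p,j)^* )^{l_j}$: $\mathcal Z(s)$ consists of $(\gamma\prod_j\alpha(p,j)^\infty,(n_1,n_2),\nu\prod_j\alpha(p,j)^\infty)$ with $n_1=d$, $n_2=(k_1+|\gamma|-l_1-|\nu|,\dots,k_{k(p)}+|\gamma|-l_{k(p)}-|\nu|,0,\dots)$, together with all $(\gamma\alpha(p,i)^{k_i}\gamma'\lambda',(n_1,n_2),\nu\alpha(p,i)^{l_i}\gamma'\lambda')$ where $\gamma'\lambda'$ is an infinite path, $\gamma'=\alpha(p,i)^m\beta(p,i,s)\cdots$ a nontrivial c-path ($1\le i\le k(p)$), $\lambda'$ an infinite path in the component of $r(\gamma')$, $n_1=\phi_{\gamma'}(\mathbf m)$, $n_2=|\gamma\alpha(p,i)^{k_i}\gamma'|_\infty-|\nu\alpha(p,i)^{l_i}\gamma'|_\infty$.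 *)

(* Defs.v *)
From HB Require Import structures.
From mathcomp Require Import all_boot all_order all_algebra.
From mathcomp Require Import generic_quotient all_classical topology.

Set Implicit Arguments.
Unset Strict Implicit.
Unset Printing Implicit Defensive.

Import Order.TTheory GRing.Theory Num.Theory.

Local Open Scope classical_set_scope.
Local Open Scope ring_scope.
Local Open Scope quotient_scope.

(* The partial product and the inversion are given by their graphs:
   [gmul g h k] means that g h is defined and equal to k. *)
Record groupoid_data := GroupoidData {
  gcarrier :> topologicalType;
  gmul : gcarrier -> gcarrier -> gcarrier -> Prop;
  ginv : gcarrier -> gcarrier -> Prop
}.

(* The axioms of Hahn and Renault, with G^(2) the set of pairs (g, h) having a
   product. *)
Record is_topological_groupoid (G : groupoid_data) : Prop := {
  gmul_fun : forall g h k k' : G, gmul g h k -> gmul g h k' -> k = k';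
  ginv_fun : forall g : G, exists! g', ginv g g';
  ginvK : forall g g' : G, ginv g g' -> ginv g' g;
  gmulA : forall g h k a b : G, gmul g h a -> gmul h k b ->
    exists c, gmul a k c /\ gmul g b c;
  gmulKl : forall g g' : G, ginv g g' ->
    (exists u, gmul g' g u) /\ (forall h k, gmul g h k -> gmul g' k h);
  gmulKr : forall g g' : G, ginv g g' ->
    (exists u, gmul g g' u) /\ (forall h k, gmul h g k -> gmul k g' h);
  gmul_cont : forall g h k : G, gmul g h k -> forall W, nbhs k W ->
    \forall gh \near (g, h), forall k', gmul gh.1 gh.2 k' -> W k';
  ginv_cont : forall g g' : G, ginv g g' -> forall W, nbhs g' W ->
    \forall h \near g, forall h', ginv h h' -> W h'
}.

Record is_groupoid_isomorphism (G H : groupoid_data) (phi : G -> H) : Prop := {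
  giso_bij : bijective phi;
  giso_cont : continuous phi;
  giso_open : forall U : set G, open U -> open (phi @` U);
  giso_mul : forall g h k : G,
    gmul g h k <-> gmul (phi g) (phi h) (phi k);
  giso_inv : forall g g' : G, ginv g g' <-> ginv (phi g) (phi g')
}.

HB.mixin Record Semigroup_isStar0 S of Semigroup S := {
  szero : S;
  star : S -> S;
  mul0s : forall x : S, (szero * x)%g = szero;
  muls0 : forall x : S, (x * szero)%g = szero;
  starK : involutive star;
  starM : forall x y : S, star (x * y)%g = (star y * star x)%g
}.

#[short(type="starSemigroup0Type")]
HB.structure Definition StarSemigroup0 := {S of Semigroup_isStar0 S & Semigroup S}.

Section TightGroupoid.
Variable S : starSemigroup0Type.
Implicit Types (s e f z : S) (eta : set S).

Definition idem e := (e * e)%g = e.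

Definition idem_le e f := (e * f)%g = e.

Definition is_filter eta :=
  [/\ eta !=set0,
      eta `<=` [set e | idem e],
      ~ eta szero,
      (forall e f, eta e -> eta f -> eta (e * f)%g) &
      (forall e f, eta e -> idem f -> idem_le e f -> eta f)].

Definition finite_cover (e : S) (Z : set S) :=
  [/\ finite_set Z,
      Z `<=` [set z | idem z /\ idem_le z e] &
      forall f, idem f -> idem_le f e -> f <> szero ->
        exists2 z, Z z & (f * z)%g <> szero].

Definition is_tight eta :=
  is_filter eta /\
  forall e Z, eta e -> finite_cover e Z -> Z `&` eta !=set0.

Definition tight_filter : Type := {eta : set S | is_tight eta}.

HB.instance Definition _ := gen_eqMixin tight_filter.
HB.instance Definition _ := gen_choiceMixin tight_filter.

Definition indicator (x : tight_filter) : {ptws {e | idem e} -> bool} :=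
  fun u => `[< sval x (sval u) >].

HB.instance Definition _ :=
  Topological.copy tight_filter (initial_topology indicator).

Definition act s eta : set S :=
  [set f | idem f /\ eta (star s * f * s)%g].

(* The pairs (s, x) with x in D_{s^* s}. *)
Definition pregerm : Type :=
  {sx : S * tight_filter | sval sx.2 (star sx.1 * sx.1)%g}.

(* An equivalence relation when the idempotents of S commute, as they do in an
   inverse semigroup; [germ] is then the quotient by it. *)
Definition germ_equiv (a b : pregerm) : Prop :=
  (sval a).2 = (sval b).2 /\
  exists f, sval (sval a).2 f /\ ((sval a).1 * f)%g = ((sval b).1 * f)%g.

Definition germ : Type :=
  {A : set pregerm | exists a, A = [set b | germ_equiv a b]}.

HB.instance Definition _ := gen_eqMixin germ.
HB.instance Definition _ := gen_choiceMixin germ.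

Definition germ_of (a : pregerm) : germ :=
  exist _ [set b | germ_equiv a b] (ex_intro _ a erefl).

Definition Theta s (U : set tight_filter) : set germ :=
  [set g | exists a, [/\ g = germ_of a, (sval a).1 = s & U (sval a).2]].

Definition Theta_family : set (set germ) :=
  [set A | exists s (U : set tight_filter), [/\ open U,
     U `<=` [set x | sval x (star s * s)%g] & A = Theta s U]].

HB.instance Definition _ :=
  isSubBaseTopological.Build germ Theta_family id.

Definition germ_mul (g h k : germ) : Prop :=
  exists a b c : pregerm,
    [/\ g = germ_of a, h = germ_of b, k = germ_of c,
        sval (sval a).2 = act (sval b).1 (sval (sval b).2) &
        sval c = (((sval a).1 * (sval b).1)%g, (sval b).2)].

Definition germ_inv (g h : germ) : Prop :=
  exists a b : pregerm,
    [/\ g = germ_of a, h = germ_of b, (sval b).1 = star (sval a).1 &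
        sval (sval b).2 = act (sval a).1 (sval (sval a).2)].

Definition tight_groupoid := GroupoidData germ_mul germ_inv.

End TightGroupoid.

Record sep_graph := SepGraph {
  vert : Type;
  edge : Type;
  src : edge -> vert;
  rng : edge -> vert;
  sep : vert -> set (set edge);
  sep_partition : forall v, partition (sep v) id [set e | src e = v]
}.

Section Graph.
Variable E : sep_graph.
Implicit Types (v w : vert E) (e : edge E) (l : seq (edge E)).

(* [l] is a path starting at [v] all of whose edges are in [F]. *)
Fixpoint is_path (F : set (edge E)) v l : Prop :=
  if l is e :: l' then [/\ F e, src e = v & is_path F (rng e) l'] else True.

(* The range of a path that starts at [v]. *)
Definition path_end v l : vert E := last v (map (@rng E) l).

Definition vert_le v w := exists l, is_path setT w l /\ path_end w l = v.

Definition tclass v : set (vert E) := [set w | vert_le v w /\ vert_le w v].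

(* The index set I, as the set of transitive components. *)
Definition tcomp : Type := {p : set (vert E) | exists v, p = tclass v}.

Definition comp v : tcomp := exist _ (tclass v) (ex_intro _ v erefl).

Definition tcomp_le (p q : tcomp) :=
  exists v w, [/\ sval p v, sval q w & vert_le v w].

Definition tcomp_lt (p q : tcomp) := tcomp_le p q /\ p <> q.

Definition tcomp_minimal (p : tcomp) := forall q, tcomp_le q p -> q = p.

Definition connector e : bool := `[< tcomp_lt (comp (rng e)) (comp (src e)) >].

End Graph.

(* The partition of I, the subgraphs E_p and an enumeration of the edges
   emitted by the free components. The indices i and t start at 0; the values
   of [vp] at regular components are irrelevant. As [ncyc p] = 0 for p regular,
   an index i : 'I_(ncyc p) only exists when p is free and not minimal. *)
Record adaptable (E : sep_graph) := Adaptable {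
  isfree : tcomp E -> bool;
  cedge : tcomp E -> set (edge E);
  vp : tcomp E -> vert E;
  ncyc : tcomp E -> nat;
  nbeta : forall p, 'I_(ncyc p) -> nat;
  alpha : forall p, 'I_(ncyc p) -> edge E;
  beta : forall p (i : 'I_(ncyc p)), 'I_(nbeta i) -> edge E;

  finitely_separated : forall v X, @sep E v X -> finite_set X;
  finitely_many_comp : finite_set [set: tcomp E];
  cedge_sub : forall p e, cedge p e ->
    comp (src e) = p /\ comp (rng e) = p;

  reg_transitive : forall p, ~~ isfree p -> forall v w,
    comp v = p -> comp w = p ->
    exists l, is_path (cedge p) v l /\ path_end v l = w;
  reg_row_finite : forall p, ~~ isfree p -> forall w, comp w = p ->
    finite_set [set e | cedge p e /\ src e = w];
  reg_sep : forall p, ~~ isfree p -> forall w, comp w = p ->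
    exists X, sep w = [set X];
  reg_two_edges : forall p, ~~ isfree p -> forall w, comp w = p ->
    exists e f, [/\ e <> f, cedge p e, cedge p f, src e = w & src f = w];
  reg_edges : forall p, ~~ isfree p -> forall e, comp (src e) = p ->
    cedge p e \/ tcomp_lt (comp (rng e)) p;
  reg_ncyc : forall p, ~~ isfree p -> ncyc p = 0%N;

  free_vert : forall p, isfree p -> sval p = [set vp p];
  free_minimal : forall p, isfree p ->
    ([set e : edge E | src e = vp p] = set0 <-> tcomp_minimal p);
  free_minimal_ncyc : forall p, isfree p -> tcomp_minimal p -> ncyc p = 0%N;
  free_sep : forall p, isfree p -> ~ tcomp_minimal p ->
    sep (vp p) = [set [set alpha i] `|` range (@beta p i) | i in setT];
  free_sep_inj : forall p, isfree p ->
    injective (fun i => [set alpha i] `|` range (@beta p i));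
  free_beta_inj : forall p (i : 'I_(ncyc p)), injective (@beta p i);
  free_nbeta : forall p (i : 'I_(ncyc p)), (1 <= nbeta i)%N;
  free_alpha : forall p (i : 'I_(ncyc p)),
    src (alpha i) = vp p /\ rng (alpha i) = vp p;
  free_beta : forall p (i : 'I_(ncyc p)) (t : 'I_(nbeta i)),
    tcomp_lt (comp (rng (beta t))) p;
  free_cedge : forall p, isfree p -> cedge p = range (@alpha p)
}.

Section Semigroup.
Variables (E : sep_graph) (A : adaptable E).

(* [STime v i b] is t_i^v if b is true and (t_i^v)^{-1} otherwise, the index
   i being counted from 0. *)
Inductive sterm : Type :=
| SZero
| SVert of vert E
| SEdge of edge E
| STime of vert E & nat & bool
| SMul of sterm & sterm
| SStar of sterm.

Local Notation "a ** b" := (SMul a b) (at level 40, left associativity).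
Local Notation "a ^st" := (SStar a) (at level 2, format "a ^st").
Local Notation V := SVert.
Local Notation Ed := SEdge.
Local Notation T := STime.
Local Notation al i := (Ed (alpha i)).
Local Notation be t := (Ed (beta t)).
Local Notation k p := (ncyc A p).

(* In 0-based indexing the increasing bijection sigma_j^p is [unbump j]; the
   shift of the indices of the t_i by k(p) - 1 is unchanged. The inductive type
   lists the defining relations only, [scong] is the congruence. *)
Inductive srel : sterm -> sterm -> Prop :=
| R1_idem v : srel (V v ** V v) (V v)
| R1_orth v w : v <> w -> srel (V v ** V w) SZero
| R1_star v : srel (V v)^st (V v)
| R2_src e : srel (V (src e) ** Ed e) (Ed e)
| R2_rng e : srel (Ed e ** V (rng e)) (Ed e)
| R2_eq v X e : sep v X -> X e -> srel ((Ed e)^st ** Ed e) (V (rng e))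
| R2_neq v X e f : sep v X -> X e -> X f -> e <> f ->
    srel ((Ed e)^st ** Ed f) SZero
| R3_al p (i j : 'I_(k p)) : isfree A p -> i != j ->
    srel (al i ** al j) (al j ** al i)
| R3_star p (i j : 'I_(k p)) : isfree A p -> i != j ->
    srel (al i ** (al j)^st) ((al j)^st ** al i)
| R4 p (i j : 'I_(k p)) (s : 'I_(nbeta i)) (t : 'I_(nbeta j)) :
    isfree A p -> Tagged (fun i => 'I_(nbeta i)) s <> Tagged _ t ->
    srel ((be s)^st ** be t) SZero
| R5_comm v i j b c : srel (T v i b ** T v j c) (T v j c ** T v i b)
| R5_l v i : srel (V v ** T v i true) (T v i true)
| R5_r v i : srel (T v i true ** V v) (T v i true)
| R5_tV v i : srel (T v i true ** T v i false) (V v)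
| R5_Vt v i : srel (T v i false ** T v i true) (V v)
| R5_star v i : srel (T v i true)^st (T v i false)
| R6 e i : ~~ isfree A (comp (src e)) ->
    srel (T (src e) i true ** Ed e) (Ed e ** T (rng e) i true)
| R7 p (j : 'I_(k p)) (s : 'I_(nbeta j)) i b : isfree A p ->
    srel (T (vp A p) i b ** be s)
         (be s ** T (rng (beta s)) (i + (k p).-1) b)
| R8_al p (i j : 'I_(k p)) (s : 'I_(nbeta j)) : isfree A p -> i != j ->
    srel (al i ** be s) (be s ** T (rng (beta s)) (unbump j i) true)
| R8_star p (i j : 'I_(k p)) (s : 'I_(nbeta j)) : isfree A p -> i != j ->
    srel ((al i)^st ** be s) (be s ** T (rng (beta s)) (unbump j i) false)
| R9_al p (j : 'I_(k p)) i : isfree A p ->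
    srel (T (vp A p) i true ** al j) (al j ** T (vp A p) i true)
| R9_star p (j : 'I_(k p)) i : isfree A p ->
    srel (T (vp A p) i true ** (al j)^st) ((al j)^st ** T (vp A p) i true).

(* The *-semigroup congruence with zero generated by [srel]. *)
Inductive scong : sterm -> sterm -> Prop :=
| scong_rel a b : srel a b -> scong a b
| scong_refl a : scong a a
| scong_sym a b : scong a b -> scong b a
| scong_trans b a c : scong a b -> scong b c -> scong a c
| scong_mul a a' b b' : scong a a' -> scong b b' -> scong (a ** b) (a' ** b')
| scong_star a a' : scong a a' -> scong a^st a'^st
| scong_assoc a b c : scong (a ** (b ** c)) (a ** b ** c)
| scong_0l a : scong (SZero ** a) SZero
| scong_0r a : scong (a ** SZero) SZero
| scong_starK a : scong a^st^st a
| scong_starM a b : scong (a ** b)^st (b^st ** a^st).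

HB.instance Definition _ := gen_eqMixin sterm.
HB.instance Definition _ := gen_choiceMixin sterm.

Definition scongb (a b : sterm) : bool := `[< scong a b >].

Lemma scongb_equiv : equiv_class_of scongb.
Proof.
split=> [a|a b|b a c].
- exact/asboolP/scong_refl.
- by apply/asboolP/asboolP; apply: scong_sym.
- by move=> /asboolP ab /asboolP bc; apply/asboolP/(scong_trans ab bc).
Qed.

Canonical scongb_equiv_rel := EquivRelPack scongb_equiv.

Definition SEC : Type := {eq_quot scongb_equiv_rel}.
HB.instance Definition _ := Choice.on SEC.

Definition SEC_pi (a : sterm) : SEC := \pi_({eq_quot scongb_equiv_rel}) a.

Lemma SEC_piP a b : SEC_pi a = SEC_pi b <-> scong a b.
Proof.
split=> [/eqP|ab]; last by apply/eqP; rewrite eqmodE; apply/asboolP.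
by rewrite eqmodE => /asboolP.
Qed.

Definition SEC_repr (x : SEC) : sterm := repr x.

Lemma SEC_reprK x : SEC_pi (SEC_repr x) = x.
Proof. exact: reprK. Qed.

Definition SEC_mul (x y : SEC) : SEC := SEC_pi (SEC_repr x ** SEC_repr y).
Definition SEC_star (x : SEC) : SEC := SEC_pi (SEC_repr x)^st.

Lemma SEC_mulE a b : SEC_mul (SEC_pi a) (SEC_pi b) = SEC_pi (a ** b).
Proof. by apply/SEC_piP/scong_mul; apply/SEC_piP/SEC_reprK. Qed.

Lemma SEC_starE a : SEC_star (SEC_pi a) = SEC_pi a^st.
Proof. by apply/SEC_piP/scong_star/SEC_piP/SEC_reprK. Qed.

Lemma SEC_mulA : associative SEC_mul.
Proof.
move=> x y z; rewrite -(SEC_reprK x) -(SEC_reprK y) -(SEC_reprK z).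
by rewrite !SEC_mulE; apply/SEC_piP/scong_assoc.
Qed.

HB.instance Definition _ := isSemigroup.Build SEC SEC_mulA.

Lemma SEC_mul0s (x : SEC) : (SEC_pi SZero * x)%g = SEC_pi SZero.
Proof.
by rewrite -(SEC_reprK x); apply: etrans (SEC_mulE _ _) _;
  apply/SEC_piP/scong_0l.
Qed.

Lemma SEC_muls0 (x : SEC) : (x * SEC_pi SZero)%g = SEC_pi SZero.
Proof.
by rewrite -(SEC_reprK x); apply: etrans (SEC_mulE _ _) _;
  apply/SEC_piP/scong_0r.
Qed.

Lemma SEC_starK : involutive SEC_star.
Proof.
by move=> x; rewrite -(SEC_reprK x) !SEC_starE; apply/SEC_piP/scong_starK.
Qed.

Lemma SEC_starM (x y : SEC) :
  SEC_star (x * y)%g = (SEC_star y * SEC_star x)%g.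
Proof.
rewrite -(SEC_reprK x) -(SEC_reprK y).
apply: etrans (congr1 SEC_star (SEC_mulE _ _)) _.
rewrite SEC_starE; apply: esym; rewrite !SEC_starE.
by apply: etrans (SEC_mulE _ _) _; apply/esym/SEC_piP/scong_starM.
Qed.

HB.instance Definition _ := Semigroup_isStar0.Build SEC
  SEC_mul0s SEC_muls0 SEC_starK SEC_starM.

Definition svert v : SEC := SEC_pi (V v).
Definition sedge e : SEC := SEC_pi (Ed e).
Definition stime v i b : SEC := SEC_pi (T v i b).

End Semigroup.

(* Z^(oo) as an additive group: the polynomial d is the finitely supported
   sequence i |-> d`_i (again counted from 0). *)
Notation Zoo := {poly int}.

Section NormalForm.
Variables (E : sep_graph) (A : adaptable E).
Implicit Types (v w : vert E) (gam nu lam : seq (edge E)) (d : Zoo).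

Local Notation k p := (ncyc A p).
Local Notation S := (SEC A).

(* A c-path is the sequence of its edges together with its source, which
   matters for trivial c-paths. *)
Inductive step v : seq (edge E) -> Prop :=
| step_free p (i : 'I_(k p)) (t : 'I_(nbeta i)) m :
    isfree A p -> v = vp A p ->
    step v (rcons (nseq m (alpha i)) (beta t))
| step_reg lam b :
    ~~ isfree A (comp v) -> is_path (cedge A (comp v)) v lam ->
    src b = path_end v lam -> connector b ->
    step v (rcons lam b).

Inductive cpath : vert E -> seq (edge E) -> Prop :=
| cpath_nil v : cpath v [::]
| cpath_step v l gam :
    step v l -> cpath (path_end v l) gam -> cpath v (l ++ gam).

(* [MFree d kk ll] is
     prod_i (t_i^{v^p})^{d_i} prod_j alpha(p,j)^{kk_j} (alpha(p,j)^* )^{ll_j}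
   and [MReg v lam w eta d] is prod_i (t_i^v)^{d_i} lam eta^*, where lam and
   eta start at v and w. *)
Inductive monomial : Type :=
| MFree (p : tcomp E) of Zoo & ('I_(k p) -> nat) & ('I_(k p) -> nat)
| MReg of vert E & seq (edge E) & vert E & seq (edge E) & Zoo.

Definition monomial_ok (m : monomial) : Prop :=
  match m with
  | MFree p _ _ _ => isfree A p
  | MReg v lam w eta _ =>
      [/\ ~~ isfree A (comp v) /\ comp w = comp v,
          is_path (cedge A (comp v)) v lam,
          is_path (cedge A (comp v)) w eta &
          path_end v lam = path_end w eta]
  end.

Definition mleft (m : monomial) : vert E :=
  match m with MFree p _ _ _ => vp A p | MReg v _ _ _ _ => v end.

Definition mright (m : monomial) : vert E :=
  match m with MFree p _ _ _ => vp A p | MReg _ _ w _ _ => w end.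

(* a x^n; there is no unit in S(E,C). *)
Definition mulX (a x : S) (n : nat) : S := iter n (fun b => (b * x)%g) a.

Definition path_el v l : S :=
  foldl (fun a e => (a * sedge A e)%g) (svert A v) l.

Definition time_el v d : S :=
  foldl (fun a i => mulX a (stime A v i (0 <= d`_i)) `|(d`_i)%R|%N)
    (svert A v) (iota 0 (size d)).

Definition monomial_el (m : monomial) : S :=
  match m with
  | MFree p d kk ll =>
      foldl (fun a j => mulX (mulX a (sedge A (alpha j)) (kk j))
                             (star (sedge A (alpha j))) (ll j))
        (time_el (vp A p) d) (enum 'I_(k p))
  | MReg v lam w eta d =>
      (time_el v d * path_el v lam * star (path_el w eta))%g
  end.

Definition is_normal_form v gam (m : monomial) w nu : Prop :=
  [/\ cpath v gam, cpath w nu, monomial_ok m,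
      path_end v gam = mleft m & path_end w nu = mright m].

Definition normal_form_el v gam (m : monomial) w nu : S :=
  (path_el v gam * monomial_el m * star (path_el w nu))%g.

(* The operator T_b: multiplication by 'X^m shifts a sequence by m places. *)
Definition translate (b : edge E) d : Zoo :=
  if isfree A (comp (src b)) then d * 'X^((k (comp (src b))).-1) else d.

Definition translate_path gam d : Zoo :=
  foldl (fun d b => translate b d) d [seq b <- gam | connector b].

Definition cvec p (i : 'I_(k p)) (kk ll : 'I_(k p) -> nat) : Zoo :=
  \sum_(j < k p | j != i) ((kk j)%:Z - (ll j)%:Z) *: 'X^(unbump i j).

(* [exponents gam m n] means that n is phi_gam(m). *)
Definition exponents gam (m : monomial) (n : Zoo) : Prop :=
  match m with
  | MFree p d kk ll =>
      (gam = [::] /\ n = d) \/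
      exists (i : 'I_(k p)) (t : 'I_(nbeta i)) r gam',
        gam = nseq r (alpha i) ++ beta t :: gam' /\
        n = translate_path gam' (translate (beta t) d + cvec i kk ll)
  | MReg _ _ _ _ d => n = translate_path gam d
  end.

(* What follows the c-path in an infinite path: prod_j alpha(p,j)^oo, or an
   infinite path in a regular E_p. *)
Inductive tail : Type :=
| TFree
| TReg of nat -> edge E.

Definition tail_ok v (t : tail) : Prop :=
  match t with
  | TFree => isfree A (comp v)
  | TReg lam =>
      [/\ ~~ isfree A (comp v), src (lam 0%N) = v &
          forall n, cedge A (comp v) (lam n) /\ rng (lam n) = src (lam n.+1)]
  end.

(* [PFree v gam] is gam prod_j alpha(p,j)^oo, gam being a c-path from v to
   v^p; an infinite path ending at a regular component is the sequence of its
   edges. *)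
Inductive infpath : Type :=
| PFree of vert E & seq (edge E)
| PReg of nat -> edge E.

Definition infcat v gam (t : tail) : infpath :=
  match t with
  | TFree => PFree v gam
  | TReg lam => PReg (fun n => nth (lam (n - size gam)%N) gam n)
  end.

Definition infpath_ends_at (p : tcomp E) (x : infpath) : Prop :=
  exists v gam t, [/\ cpath v gam, comp (path_end v gam) = p,
    tail_ok (path_end v gam) t & x = infcat v gam t].

(* Initial segments ending in the component of [path_end v gam]: in the free
   case gam is the c-path, and the exponents l_j of the alpha(p,j) are carried
   separately. *)
Definition init_segment v gam : Prop :=
  if isfree A (comp (path_end v gam)) then cpath v gam
  else exists gam' lam, [/\ gam = gam' ++ lam, cpath v gam' &
    is_path (cedge A (comp (path_end v gam'))) (path_end v gam') lam].

(* |gamma|_oo for an initial segment gamma ending in E_p; [l] is only used when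
   p is free. *)
Definition inf_length p gam (l : 'I_(k p) -> nat) : Zoo :=
  if isfree A p then \sum_(j < k p) (l j + size gam)%:Z *: 'X^j
  else (size gam)%:Z%:P.

Definition cpath_inf_length p gam : Zoo := inf_length gam (fun _ : 'I_(k p) => 0%N).

Definition segment_el v gam (l : 'I_(k (comp (path_end v gam))) -> nat) : S :=
  foldl (fun a j => mulX a (sedge A (alpha j)) (l j))
    (path_el v gam) (enum 'I_(k (comp (path_end v gam)))).

(* The filter corresponding to the infinite path x: it is generated by the
   idempotents g g^* with g an initial segment of x. *)
Definition infpath_filter (x : infpath) : set S :=
  [set e | idem e /\
    exists v gam l t, [/\ init_segment v gam, tail_ok (path_end v gam) t,
      x = infcat v gam t &
      let g := @segment_el v gam l in idem_le (g * star g)%g e]].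

Definition triple : Type := (infpath * (Zoo * Zoo) * infpath)%type.

Definition in_H (h : triple) : Prop :=
  let: (x, n, y) := h in
  exists p v gam (l : 'I_(k p) -> nat) w nu (l' : 'I_(k p) -> nat) t,
    [/\ infpath_ends_at p x /\ infpath_ends_at p y,
        init_segment v gam /\ init_segment w nu,
        comp (path_end v gam) = p /\ path_end w nu = path_end v gam,
        tail_ok (path_end v gam) t &
        [/\ x = infcat v gam t, y = infcat w nu t &
            n.2 = inf_length gam l - inf_length nu l']].

Definition Hcarrier : Type := {h : triple | in_H h}.

HB.instance Definition _ := gen_eqMixin Hcarrier.
HB.instance Definition _ := gen_choiceMixin Hcarrier.

Definition Hrng (h : Hcarrier) : infpath := (sval h).1.1.
Definition Hdeg (h : Hcarrier) : Zoo * Zoo := (sval h).1.2.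
Definition Hsrc (h : Hcarrier) : infpath := (sval h).2.

Definition Z_normal_form v gam (m : monomial) w nu (h : triple) : Prop :=
  match m with
  | MReg a lam b eta d =>
      exists gam' t n1,
        let z := path_end a lam in
        let q := comp (path_end z gam') in
        [/\ cpath z gam', tail_ok (path_end z gam') t, exponents gam' m n1 &
            h = (infcat v (gam ++ lam ++ gam') t,
                 (n1, cpath_inf_length q (gam ++ lam ++ gam')
                      - cpath_inf_length q (nu ++ eta ++ gam')),
                 infcat w (nu ++ eta ++ gam') t)]
  | MFree p d kk ll =>
      h = (infcat v gam TFree,
           (d, \sum_(j < k p) ((kk j)%:Z + (size gam)%:Z
                               - (ll j)%:Z - (size nu)%:Z) *: 'X^j),
           infcat w nu TFree)
      \/
      exists (i : 'I_(k p)) r (s : 'I_(nbeta i)) gam'' t n1,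
        let gam' := nseq r (alpha i) ++ beta s :: gam'' in
        let x := gam ++ nseq (kk i) (alpha i) ++ gam' in
        let y := nu ++ nseq (ll i) (alpha i) ++ gam' in
        let q := comp (path_end (vp A p) gam') in
        [/\ cpath (vp A p) gam', tail_ok (path_end (vp A p) gam') t,
            exponents gam' m n1 &
            h = (infcat v x t,
                 (n1, cpath_inf_length q x - cpath_inf_length q y),
                 infcat w y t)]
  end.

(* By existence and uniqueness of normal forms, every nonzero s has exactly one
   decomposition as below. *)
Definition Zset (s : S) : set Hcarrier :=
  [set h | s <> szero /\
    exists v gam m w nu, [/\ is_normal_form v gam m w nu,
      s = normal_form_el v gam m w nu &
      Z_normal_form v gam m w nu (sval h)]].

(* The sets Z(s) form a base; the topology is the one they generate. *)
HB.instance Definition _ :=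
  isSubBaseTopological.Build Hcarrier (range Zset) id.

Definition H_mul (g h k : Hcarrier) : Prop :=
  [/\ Hsrc g = Hrng h, Hrng k = Hrng g, Hdeg k = Hdeg g + Hdeg h &
      Hsrc k = Hsrc h].

Definition H_inv (g h : Hcarrier) : Prop :=
  [/\ Hrng h = Hsrc g, Hdeg h = - Hdeg g & Hsrc h = Hrng g].

Definition H_groupoid := GroupoidData H_mul H_inv.

(* phi is the canonical map: it sends [s, x] to the triple in Z(s) whose source
   is the infinite path corresponding to x. *)
Definition is_canonical (phi : tight_groupoid S -> H_groupoid) : Prop :=
  forall a : pregerm S,
    Zset (sval a).1 (phi (germ_of a)) /\
    infpath_filter (Hsrc (phi (germ_of a))) = sval (sval a).2.

End NormalForm.

(* Main.v *)
(* S(E,C) acts on the set of infinite paths by partial injections that carry a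
   degree in Z^(oo) x Z^(oo); the triples (x, n, y) such that s sends y to x with
   degree n form exactly Z(s). The action exists because the generators satisfy
   the defining relations, and the action of a normal form can be computed. Hence
   a nonzero element acts somewhere, and an element that acts only by identities
   of degree 0 is a projection g g^*; in particular the idempotents commute.

   Two facts make germs and triples correspond. First, if s sends y to x with
   degree n, then s h = g t^{n_1} for every sufficiently long initial segment h
   of y, where g is the initial segment of x whose length is prescribed by n_2;
   if s is not defined at y, then s h = 0 for such h. So two elements that agree
   at y, degrees included, have the same germ there, and the sets Z(s) form a
   base. Second, the tight filters are the sets of idempotents defined at an
   infinite path: given a tight filter, the path is read off by descending
   through the components, which are finite in number. *)

From HB Require Import structures.
From mathcomp Require Import all_boot all_order all_algebra.
From mathcomp Require Import zify generic_quotient finmap all_classical topology.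
Require Import Defs.

Set Implicit Arguments.
Unset Strict Implicit.
Unset Printing Implicit Defensive.

Import Order.TTheory GRing.Theory Num.Theory.

Local Open Scope classical_set_scope.
Local Open Scope ring_scope.

(** * Paths and components *)

(** On infinite paths alone the action is far from faithful: every $t_i$ fixes all paths in its
    domain, and $\alpha(p,i)$ fixes each path whose first block has another index, as well as
    $\prod_j\alpha(p,j)^\infty$. The degree records what the path forgets. Exponents of the $t_i$
    live at vertices, so to be comparable they are all carried to the end of the path by the
    translations.

    S(E,C) is given by generators and relations: the action is the only tool to tell elements apart,
    and equalities are obtained only by rewriting. Locality and existence of normal forms are the
    two rewriting results that link both sides.

    Paths are handled as a c-path with a tail. The recurring nuisance is that an edge of a regular
    $E_p$ placed before an empty c-path belongs to the tail; the same split appears in the action,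
    in lengths of segments and in normal forms.

    The groupoid axioms are checked on triples, where they are computations, and transported to
    germs. *)

HB.instance Definition _ (E : sep_graph) := gen_eqMixin (tcomp E).
HB.instance Definition _ (E : sep_graph) := gen_choiceMixin (tcomp E).

Section Paths.
Variable E : sep_graph.
Implicit Types (v w : vert E) (l : seq (edge E)) (p q : tcomp E).

Lemma is_path_cat F v l l' :
  is_path F v (l ++ l') <-> is_path F v l /\ is_path F (path_end v l) l'.
Proof.
elim: l v => [|e l IH] v /=; first by split=> [|[]].
rewrite -/(path_end (rng e) l); split=> [[? ? /IH[]]|[[? ? ?] ?]] //.
by split=> //; apply/IH.
Qed.

Lemma path_end_cat v l l' : path_end v (l ++ l') = path_end (path_end v l) l'.
Proof. by rewrite /path_end map_cat last_cat. Qed.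

Lemma path_end_rcons v l e : path_end v (rcons l e) = rng e.
Proof. by rewrite /path_end map_rcons last_rcons. Qed.

Lemma is_path_sub (F G : set (edge E)) v l :
  F `<=` G -> is_path F v l -> is_path G v l.
Proof. by move=> FG; elim: l v => //= e l IH v [/FG ? -> /IH]. Qed.

Lemma vert_le_refl v : vert_le v v.
Proof. by exists [::]. Qed.

Lemma vert_le_trans w v u : vert_le u v -> vert_le v w -> vert_le u w.
Proof.
move=> [l [pl <-]] [l' [pl' e']]; exists (l' ++ l).
by rewrite is_path_cat path_end_cat e'.
Qed.

Lemma comp_mem v : sval (comp v) v.
Proof. by split; apply: vert_le_refl. Qed.

Lemma comp_eq p v : sval p v -> comp v = p.
Proof.
case: p => X Xp /= Xv; apply: eq_exist => /=.
case: Xp Xv => w -> [vw wv]; apply/funext => u; apply/propext; split=> -[uv vu]; split;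
  by apply: vert_le_trans; eassumption.
Qed.

Lemma comp_surj p : exists v, p = comp v.
Proof. by case: p => X [v Xv]; exists v; apply: eq_exist. Qed.

Lemma tcomp_leP v w : tcomp_le (comp v) (comp w) <-> vert_le v w.
Proof.
split=> [[v' [w' [[vv _] [_ ww] l]]]|vw]; last first.
  by exists v, w; split=> //; apply: comp_mem.
exact: vert_le_trans (vert_le_trans vv l) ww.
Qed.

Lemma tcomp_le_trans q p r : tcomp_le p q -> tcomp_le q r -> tcomp_le p r.
Proof.
have [u ->] := comp_surj p; have [v ->] := comp_surj q.
have [w ->] := comp_surj r; rewrite !tcomp_leP; exact: vert_le_trans.
Qed.

Lemma tcomp_le_antisym p q : tcomp_le p q -> tcomp_le q p -> p = q.
Proof.
have [u ->] := comp_surj p; have [v ->] := comp_surj q.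
by rewrite !tcomp_leP => uv vu; apply: comp_eq.
Qed.

Lemma tcomp_lt_trans q p r : tcomp_lt p q -> tcomp_lt q r -> tcomp_lt p r.
Proof.
move=> [pq npq] [qr nqr]; split; first exact: tcomp_le_trans qr.
by move=> pr; apply: npq; apply: tcomp_le_antisym; rewrite // pr.
Qed.

End Paths.

(** * Edges at free and regular components; decompositions of c-paths *)

Section Adaptable.
Variables (E : sep_graph) (A : adaptable E).
Implicit Types (v w : vert E) (l gam : seq (edge E)) (p q : tcomp E).

Local Notation k p := (ncyc A p).

(** Strong induction on the number of components strictly below [p]; passing from [q] to [r] below
    it loses at least [r] itself. It drives the descent that reads a path off a tight filter. *)
Lemma tcomp_lt_wf (P : tcomp E -> Prop) :
  (forall p, (forall q, tcomp_lt q p -> P q) -> P p) -> forall p, P p.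
Proof.
move=> IH p; pose below p := [set q : tcomp E | tcomp_lt q p].
have fin q : finite_set (below q).
  exact: sub_finite_set (finitely_many_comp A).
suff H n q : (#|` fset_set (below q)| < n)%N -> P q by exact: H (ltnSn _).
elim: n q => // n IHn q; rewrite ltnS => le; apply: IH => r rq.
apply: IHn; apply: leq_trans le; apply: fproper_ltn_card.
rewrite fproperE; apply/andP; split.
  by apply/fsubsetP => s; rewrite !in_fset_set // !inE => sr; apply: tcomp_lt_trans rq.
apply/fsubsetP => /(_ r); rewrite !in_fset_set // !inE.
by move=> /(_ rq) [].
Qed.

Section Free.
Variable p : tcomp E.
Implicit Types i j : 'I_(k p).

Lemma comp_vp : isfree A p -> comp (vp A p) = p.
Proof. by move=> f; apply: comp_eq; rewrite (free_vert f). Qed.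

Lemma vp_eq v : isfree A p -> comp v = p -> v = vp A p.
Proof. by move=> f vp; have := comp_mem v; rewrite vp (free_vert f). Qed.

(** Since [ncyc] vanishes on regular components, the mere existence of an index certifies freeness;
    later on, freeness is often recovered from an index in this way. *)
Lemma ord_free i : isfree A p.
Proof. by apply: contraT => /reg_ncyc k0; case: i => n; rewrite k0. Qed.

Lemma ord_not_minimal i : ~ tcomp_minimal p.
Proof.
by move=> m; have := free_minimal_ncyc (ord_free i) m; case: i => n lt k0; rewrite k0 in lt.
Qed.

(** This is the block $X_i^{(p)}$ of the partition $C_{v^p}$. *)
Definition cyc i : set (edge E) := [set alpha i] `|` range (@beta _ A p i).

Lemma sep_cyc i : sep (vp A p) (cyc i).
Proof. by rewrite (free_sep (ord_free i) (@ord_not_minimal i)); exists i. Qed.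

Lemma src_cyc i e : cyc i e -> src e = vp A p.
Proof.
move=> ie; have [/seteqP[s _] _ _] := sep_partition (vp A p).
by apply: s; exists (cyc i) => //; apply: sep_cyc.
Qed.

Lemma cyc_inj i j e : cyc i e -> cyc j e -> i = j.
Proof.
move=> ie je; have [_ tr _] := sep_partition (vp A p).
apply: (free_sep_inj (ord_free i)).
by apply: (tr _ _ (sep_cyc i) (sep_cyc j)); exists e.
Qed.

Lemma cyc_alpha i : cyc i (alpha i).
Proof. by left. Qed.

Lemma cyc_beta i (t : 'I_(nbeta i)) : cyc i (beta t).
Proof. by right; exists t. Qed.

Lemma src_alpha i : src (alpha i) = vp A p. Proof. by case: (free_alpha i). Qed.
Lemma rng_alpha i : rng (alpha i) = vp A p. Proof. by case: (free_alpha i). Qed.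
Lemma src_beta i (t : 'I_(nbeta i)) : src (beta t) = vp A p.
Proof. exact/src_cyc/cyc_beta. Qed.

Lemma comp_src_cyc i e : cyc i e -> comp (src e) = p.
Proof. by move=> ie; rewrite (src_cyc ie) comp_vp // (ord_free i). Qed.

Lemma connector_alpha i : connector (alpha i) = false.
Proof. by apply/asboolP => -[_]; rewrite src_alpha rng_alpha. Qed.

Lemma connector_beta i (t : 'I_(nbeta i)) : connector (beta t).
Proof. by apply/asboolP; rewrite (comp_src_cyc (cyc_beta t)); apply: free_beta. Qed.

Lemma alpha_beta i j (t : 'I_(nbeta j)) : alpha i <> beta t.
Proof. by move=> e; have := connector_beta t; rewrite -e connector_alpha. Qed.

Lemma alpha_inj i j : alpha i = alpha j -> i = j.
Proof. by move=> e; apply: cyc_inj (cyc_alpha i) _; rewrite e; apply: cyc_alpha. Qed.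

(** The types of [s] and [t] depend on [i] and [j], hence the tagged pairs. Disjointness of the sets
    [cyc] gives [i = j], and [free_beta_inj] does the rest. *)
Lemma beta_inj i j (s : 'I_(nbeta i)) (t : 'I_(nbeta j)) : beta s = beta t ->
  Tagged (fun i => 'I_(nbeta i)) s = Tagged (fun i => 'I_(nbeta i)) t.
Proof.
move=> e; have ij : i = j.
  by apply: cyc_inj (cyc_beta s) _; rewrite e; apply: cyc_beta.
by subst j; rewrite (free_beta_inj e).
Qed.

Lemma free_edge e : isfree A p -> src e = vp A p -> exists i, cyc i e.
Proof.
move=> f se; have nm : ~ tcomp_minimal p.
  by move/(proj2 (free_minimal f)) => /seteqP[h _]; apply: (h e).
have [/seteqP[_ s] _ _] := sep_partition (vp A p).
by have [X] := s _ se; rewrite (free_sep f nm) => -[i _ <-]; exists i.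
Qed.

End Free.

(** Two blocks of a partition that share [e] coincide; the block [cyc i] containing [e] is supplied
    by [free_edge]. *)
Lemma sep_same v X e f : sep v X -> X e -> X f -> isfree A (comp v) ->
  exists i : 'I_(k (comp v)), cyc i e /\ cyc i f.
Proof.
move=> sX Xe Xf fv.
have se : src e = v by have [/seteqP[s _] _ _] := sep_partition v; apply: s; exists X.
have vE := vp_eq fv erefl.
have [|i ie] := free_edge (e := e) fv; first by rewrite se.
exists i; split=> //; have [_ tr _] := sep_partition v.
have -> : cyc i = X; last by [].
by apply: tr => //; [have := sep_cyc i; rewrite -vE | exists e].
Qed.

Lemma cyc_comp p q (i : 'I_(k p)) (j : 'I_(k q)) e : cyc i e -> cyc j e -> p = q.
Proof. by move=> /comp_src_cyc <- /comp_src_cyc <-. Qed.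

Lemma connector_cedge p e : cedge A p e -> connector e = false.
Proof. by move=> /cedge_sub[a b]; apply/asboolP => -[_]; rewrite a b. Qed.

Lemma reg_edge e : ~~ isfree A (comp (src e)) ->
  ~~ connector e -> cedge A (comp (src e)) e.
Proof. by move=> r /asboolP n; case: (reg_edges r erefl). Qed.

Lemma cpath_free_inv p gam : isfree A p -> cpath A (vp A p) gam -> gam = [::] \/
  exists (i : 'I_(k p)) (t : 'I_(nbeta i)) m gam',
    gam = nseq m (alpha i) ++ beta t :: gam' /\ cpath A (rng (beta t)) gam'.
Proof.
move=> f; move e: (vp A p) => v c; case: c e => {v gam} [v|v l gam st c] e; [by left|right].
move: c; case: st => {l} [q i t m fq vq|lam b nf _ _ _].
  have pq : p = q by rewrite -(comp_vp f) -(comp_vp fq) e vq.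
  move=> c; subst q; exists i, t, m, gam; rewrite cat_rcons; split=> //.
  by rewrite path_end_rcons in c.
by move: nf; rewrite -e comp_vp // f.
Qed.

Lemma cpath_block p (i : 'I_(k p)) (t : 'I_(nbeta i)) m gam :
  cpath A (rng (beta t)) gam -> cpath A (vp A p) (nseq m (alpha i) ++ beta t :: gam).
Proof.
move=> c; rewrite -cat_rcons; apply: cpath_step; last by rewrite path_end_rcons.
by apply: step_free => //; apply: ord_free i.
Qed.

(** Peels off one edge instead of one step. A nonempty c-path ends in a connector, so after an edge
    of $E_p$ something must remain; hence [gam' <> [::]]. *)
Lemma cpath_reg_inv v gam : ~~ isfree A (comp v) -> cpath A v gam -> gam = [::] \/
  exists e gam', [/\ gam = e :: gam', src e = v, cpath A (rng e) gam' &
    connector e \/ (cedge A (comp v) e /\ gam' <> [::])].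
Proof.
move=> r c; case: c r => {v gam} [v|v l gam st c] r; [by left|right].
move: c; case: st r => {l} [q i t m fq vq|lam b nf pl sb cb] r c.
  by move: r; rewrite vq comp_vp // fq.
case: lam pl sb c => [|e lam] /=.
  by move=> _ sb c; exists b, gam; split=> //; left.
move=> [ce se pl] sb c; exists e, (rcons lam b ++ gam); split=> //; last first.
  by right; split => //; case: (lam).
have [c1 c2] := cedge_sub ce.
apply: cpath_step; last exact: c.
by apply: step_reg => //; rewrite c2.
Qed.

Lemma cpath_connector e gam : connector e ->
  cpath A (rng e) gam -> cpath A (src e) (e :: gam).
Proof.
move=> ce c; case: (boolP (isfree A (comp (src e)))) => f.
  have vE := vp_eq f erefl.
  have [i [ea|[t _ et]]] := free_edge f vE.
    by move: ce; rewrite ea connector_alpha.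
  by have := @cpath_block _ i t 0 gam; rewrite et -vE /=; apply.
apply: (cpath_step (l := [:: e])); last exact: c.
exact: (@step_reg _ _ _ [::]).
Qed.

(** The edge is absorbed in the path [lam] of the first step. That step exists because [gam] is
    nonempty, and it is a regular one because [e] does not leave its component. *)
Lemma cpath_cedge e gam : ~~ isfree A (comp (src e)) -> cedge A (comp (src e)) e ->
  gam <> [::] -> cpath A (rng e) gam -> cpath A (src e) (e :: gam).
Proof.
move=> r ce; have [_ re] := cedge_sub ce.
move: (erefl (rng e)); move: {2 3}(rng e) => v ev n c; case: c ev n => [//|{}v l {}gam st c] ev _.
case: st r ce re ev c => {l} [q i t m fq vq|lam b nf pl sb cb] r ce re ev c.
  by move: r; rewrite -re ev vq comp_vp // fq.
rewrite -cat_cons -rcons_cons; apply: cpath_step; last first.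
  by move: c; rewrite !path_end_rcons.
apply: step_reg => //; last by rewrite sb -ev.
by split=> //; rewrite -re ev.
Qed.

Lemma cpath_cat v gam gam' : cpath A v gam -> cpath A (path_end v gam) gam' ->
  cpath A v (gam ++ gam').
Proof.
move=> c c'; elim: c c' => {v gam} [//|v l gam st c IH] c'.
by rewrite -catA; apply: cpath_step => //; apply: IH; rewrite path_end_cat in c'.
Qed.

Lemma cpath_reg_connector v gam lam b : cpath A v gam ->
  ~~ isfree A (comp (path_end v gam)) ->
  is_path (cedge A (comp (path_end v gam))) (path_end v gam) lam ->
  src b = path_end v (gam ++ lam) -> connector b -> cpath A v (gam ++ rcons lam b).
Proof.
move=> c r pl sb cb; apply: cpath_cat => //; rewrite -[rcons lam b]cats0.
apply: cpath_step; last exact: cpath_nil.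
by apply: step_reg => //; rewrite -path_end_cat.
Qed.

(** The final connector marks where the c-path stops, as a tail in a regular component contains
    none. This makes the decomposition of an infinite path unique. *)
Lemma cpath_last v gam : cpath A v gam ->
  gam = [::] \/ exists gam' b, gam = rcons gam' b /\ connector b.
Proof.
elim=> {v gam} [|v l gam st c [->|[g [b [-> cb]]]]]; [by left| |].
  case: st => [p i t m f _|lam b _ _ _ cb]; right; rewrite cats0; do 2 eexists;
    by split; [reflexivity | rewrite ?connector_beta].
by right; exists (l ++ g), b; rewrite rcons_cat.
Qed.

Lemma is_path_comp p v l : comp v = p -> is_path (cedge A p) v l ->
  comp (path_end v l) = p.
Proof. by elim: l v => //= e l IH v _ [/cedge_sub[_ ?] _ /IH]; apply. Qed.

Lemma is_path_connector p v l : is_path (cedge A p) v l -> ~~ has (@connector E) l.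
Proof. by elim: l v => //= e l IH v [/connector_cedge -> _ /IH]. Qed.

Lemma cpath_is_path v gam : cpath A v gam -> is_path setT v gam.
Proof.
elim=> {v gam} [//|v l gam st c IH]; apply/is_path_cat; split=> //.
case: st => {c IH} [p i t m f ->|lam b r pl sb cb]; rewrite -cats1; last first.
  by apply/is_path_cat; split=> //=; apply: is_path_sub pl.
elim: m => [|m IH] /=; first by rewrite src_beta.
by rewrite src_alpha rng_alpha.
Qed.

End Adaptable.

(** * The action on infinite paths *)

Section Action.
Variables (E : sep_graph) (A : adaptable E).
Implicit Types (v w : vert E) (l gam : seq (edge E)) (p q : tcomp E) (d : Zoo).

Local Notation k p := (ncyc A p).

(** Extended by the identity to non-connectors, the translation turns [translate_path], which is
    defined by filtering, into a fold over all edges. *)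
Definition trl (e : edge E) d : Zoo := if connector e then translate A e d else d.

Lemma translate_pathE gam d :
  translate_path A gam d = foldl (fun d b => trl b d) d gam.
Proof.
rewrite /translate_path; elim: gam d => //= e gam IH d.
by rewrite {2}/trl; case: ifP => _; rewrite -IH.
Qed.

Lemma translate_path_cons e gam d :
  translate_path A (e :: gam) d = translate_path A gam (trl e d).
Proof. by rewrite !translate_pathE. Qed.

Lemma translate_path_cat gam gam' d :
  translate_path A (gam ++ gam') d = translate_path A gam' (translate_path A gam d).
Proof. by rewrite !translate_pathE foldl_cat. Qed.

Lemma trlD e : {morph trl e : d d' / d + d'}.
Proof.
by move=> d d'; rewrite /trl /translate; do 2 case: ifP => // _; rewrite mulrDl.
Qed.

Lemma trlN e : {morph trl e : d / - d}.
Proof.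
by move=> d; rewrite /trl /translate; do 2 case: ifP => // _; rewrite mulNr.
Qed.

Lemma translate_pathD gam : {morph translate_path A gam : d d' / d + d'}.
Proof.
move=> d d'; rewrite !translate_pathE; elim: gam d d' => //= e gam IH d d'.
by rewrite trlD IH.
Qed.

Lemma translate_pathN gam : {morph translate_path A gam : d / - d}.
Proof.
move=> d; rewrite !translate_pathE; elim: gam d => //= e gam IH d.
by rewrite trlN IH.
Qed.

Lemma translate_path0 gam : translate_path A gam 0 = 0.
Proof. by apply: (addIr (translate_path A gam 0)); rewrite -translate_pathD !add0r. Qed.

Lemma translate_path_nc gam d : ~~ has (@connector E) gam -> translate_path A gam d = d.
Proof.
elim: gam d => //= e gam IH d; rewrite negb_or => /andP[ne /IH h].
by rewrite translate_path_cons h /trl (negPf ne).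
Qed.

Lemma trl_reg e d : ~~ isfree A (comp (src e)) -> trl e d = d.
Proof. by move=> r; rewrite /trl /translate (negPf r); case: ifP. Qed.

Lemma trl_alpha p (i : 'I_(k p)) d : trl (alpha i) d = d.
Proof. by rewrite /trl connector_alpha. Qed.

Lemma trl_beta p (i : 'I_(k p)) (t : 'I_(nbeta i)) d :
  trl (beta t) d = d * 'X^((k p).-1).
Proof.
by rewrite /trl connector_beta /translate (comp_src_cyc (cyc_beta t)) (ord_free i).
Qed.

Lemma translate_path_nseq p (i : 'I_(k p)) m gam d :
  translate_path A (nseq m (alpha i) ++ gam) d = translate_path A gam d.
Proof. by elim: m => //= m IH; rewrite translate_path_cons trl_alpha. Qed.

(* [DPath v g t] is the infinite path made of the c-path [g] from [v] and of the
   tail [t]. Every infinite path has only one such decomposition, see [toinf_inj]. *)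
Record dpath := DPath { dv : vert E; dg : seq (edge E); dt : tail E }.
Implicit Types x y z : dpath.

Definition dend x := path_end (dv x) (dg x).
Definition dcomp x := comp (dend x).
Definition dvalid x := cpath A (dv x) (dg x) /\ tail_ok A (dend x) (dt x).
(** Carries exponents of the $t_i$ from the source of [x] to its end, where degrees are recorded. *)
Definition dtr x d := translate_path A (dg x) d.

(** The number of coordinates used by $|\cdot|_\infty$ at [q]. It is 0 if [q] is free and minimal,
    and then [dunit q] is 0 as well. *)
Definition ndim q : nat := if isfree A q then k q else 1%N.
(* The degree of an edge acting at a path that ends at q. *)
Definition dunit q : Zoo := \sum_(j < ndim q) 'X^j.

(* An edge of a regular E_p put before an empty c-path has to join the tail. *)
Definition dcons (e : edge E) y : dpath :=
  match dg y, dt y with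
  | [::], TReg lam => if connector e then DPath (src e) [:: e] (TReg lam)
                      else DPath (src e) [::] (TReg (fun n => if n is n'.+1 then lam n' else e))
  | _, _ => DPath (src e) (e :: dg y) (dt y)
  end.

Definition dpure p := DPath (vp A p) [::] (@TFree E).

(** The source of [y] is dropped, so this is the path $\alpha^m\beta y$ only under the condition
    [dv y = rng (beta t)]. *)
Definition dblock p (i : 'I_(k p)) (m : nat) (t : 'I_(nbeta i)) y :=
  DPath (vp A p) (nseq m (alpha i) ++ beta t :: dg y) (dt y).

(** These are the edges that act by being put in front of a path. *)
Definition nonalpha (e : edge E) := forall p (i : 'I_(k p)), e <> alpha i.

Definition adeg p (i j : 'I_(k p)) y : Zoo * Zoo :=
  if j == i then (0, dunit (dcomp y)) else (dtr y 'X^(unbump j i), 0).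

(* By (R3) and (R8), alpha(p,i) commutes with the first block
   alpha(p,j)^m beta(p,j,t) of a path as long as j <> i, turning into a t_l: in
   this case it fixes the path and only contributes to the degree. *)
Inductive aedge (e : edge E) : dpath -> Zoo * Zoo -> dpath -> Prop :=
| ae_cons y : nonalpha e -> dvalid y -> dv y = rng e ->
    aedge e (dcons e y) (0, dunit (dcomp y)) y
| ae_pure p (i : 'I_(k p)) : e = alpha i -> aedge e (dpure p) (0, 'X^i) (dpure p)
| ae_block p (i j : 'I_(k p)) m (t : 'I_(nbeta j)) y :
    e = alpha i -> dvalid y -> dv y = rng (beta t) ->
    aedge e (dblock ((j == i) + m) t y) (adeg i j y) (dblock m t y).

Lemma nonalpha_beta p (i : 'I_(k p)) (t : 'I_(nbeta i)) : nonalpha (beta t).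
Proof.
move=> q j e; have cj := cyc_alpha j; rewrite -e in cj.
by have pq := cyc_comp (cyc_beta t) cj; subst q; apply: (alpha_beta (esym e)).
Qed.

Lemma nonalpha_reg e : ~~ isfree A (comp (src e)) -> nonalpha e.
Proof. by move=> r q j e'; move: r; rewrite e' (comp_src_cyc (cyc_alpha j)) (ord_free j). Qed.

Lemma edge_cases e : [\/ ~~ isfree A (comp (src e)),
   exists p (i : 'I_(k p)), e = alpha i |
   exists p (i : 'I_(k p)) (t : 'I_(nbeta i)), e = beta t].
Proof.
case: (boolP (isfree A (comp (src e)))) => [f|r]; last by constructor 1.
have [i [ea|[t _ et]]] := free_edge f (vp_eq f erefl).
  by constructor 2; exists (comp (src e)), i.
by constructor 3; exists (comp (src e)), i, t.
Qed.

Lemma nonalphaP e : nonalpha e -> ~~ isfree A (comp (src e)) \/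
  exists p (i : 'I_(k p)) (t : 'I_(nbeta i)), e = beta t.
Proof. by move=> na; case: (edge_cases e) => [|[p [i /na]]|]; [left| |right]. Qed.

Lemma nonalpha_cedge e : nonalpha e -> ~~ connector e ->
  [/\ ~~ isfree A (comp (src e)), cedge A (comp (src e)) e & comp (rng e) = comp (src e)].
Proof.
move=> /nonalphaP[r ce|[p [i [t ->]]]]; last by rewrite connector_beta.
by have ed := reg_edge r ce; have [_ re] := cedge_sub ed.
Qed.

Lemma tail_free p t : isfree A p -> tail_ok A (vp A p) t -> t = @TFree E.
Proof. by case: t => // lam f [+ _ _]; rewrite comp_vp // f. Qed.

Lemma tail_reg v t : ~~ isfree A (comp v) -> tail_ok A v t -> exists lam, t = TReg lam.
Proof. by case: t => [|lam] r; [rewrite /= (negPf r)|exists lam]. Qed.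

Lemma dvalid_pure p : isfree A p -> dvalid (dpure p).
Proof. by move=> f; split; [apply: cpath_nil | rewrite /= comp_vp]. Qed.

Lemma dend_block p (i : 'I_(k p)) m (t : 'I_(nbeta i)) y : dv y = rng (beta t) ->
  dend (dblock m t y) = dend y.
Proof. by rewrite /dend /= path_end_cat /path_end /= => ->. Qed.

Lemma dcomp_block p (i : 'I_(k p)) m (t : 'I_(nbeta i)) y : dv y = rng (beta t) ->
  dcomp (dblock m t y) = dcomp y.
Proof. by rewrite /dcomp => /(dend_block m) ->. Qed.

Lemma dvalid_block p (i : 'I_(k p)) m (t : 'I_(nbeta i)) y : dv y = rng (beta t) ->
  dvalid y -> dvalid (dblock m t y).
Proof.
move=> vy [c tk]; split; last by rewrite dend_block.
by apply: cpath_block; rewrite -vy.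
Qed.

Lemma dtr_block p (i : 'I_(k p)) m (t : 'I_(nbeta i)) y d :
  dtr (dblock m t y) d = dtr y (d * 'X^((k p).-1)).
Proof. by rewrite /dtr /= translate_path_nseq translate_path_cons trl_beta. Qed.

Lemma dtr_pure p d : dtr (dpure p) d = d. Proof. by []. Qed.

Lemma dfree_inv p x : isfree A p -> dv x = vp A p -> dvalid x ->
  x = dpure p \/ exists (i : 'I_(k p)) (t : 'I_(nbeta i)) m y,
    [/\ dvalid y, dv y = rng (beta t) & x = dblock m t y].
Proof.
case: x => v gam t f /= -> {v} [/= c tk].
have [g0|[i [s [m [gam' [ge c']]]]]] := cpath_free_inv f c.
  by left; move: tk; rewrite g0 /dend /= => /tail_free ->.
right; exists i, s, m, (DPath (rng (beta s)) gam' t); rewrite /dblock -ge.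
split=> //; split => //; move: tk.
by rewrite /dend /= ge path_end_cat.
Qed.

Lemma block_inj p (i i' : 'I_(k p)) m m' (t : 'I_(nbeta i)) (t' : 'I_(nbeta i')) y y' :
  dv y = rng (beta t) -> dv y' = rng (beta t') -> dblock m t y = dblock m' t' y' ->
  [/\ m = m', Tagged (fun i => 'I_(nbeta i)) t = Tagged (fun i => 'I_(nbeta i)) t'
    & y = y'].
Proof.
case: y => v g u; case: y' => v' g' u' /= vE vE' [e eu]; subst v v' u'.
(* No [alpha] is a [beta], so the first [beta] of the list fixes the exponent. *)
have [em et eg] : [/\ m = m', beta t = beta t' & g = g'].
  elim: m m' e => [|m IH] [|m'] //= [].
  - by [].
  - by move=> e; case: (alpha_beta (esym e)).
  - by move=> e; case: (alpha_beta e).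
  - by move=> _ /IH[-> ->].
by split=> //; [apply: beta_inj | rewrite et eg].
Qed.

Lemma block_pure p (i : 'I_(k p)) m (t : 'I_(nbeta i)) y : dpure p <> dblock m t y.
Proof. by case: m. Qed.

Lemma dcons_nonreg e y : (dg y <> [::] \/ connector e \/ dt y = @TFree E) ->
  dcons e y = DPath (src e) (e :: dg y) (dt y).
Proof.
by case: y => v [|? ?] [|lam] //= [//|[ce|//]]; rewrite /dcons /= ce.
Qed.

Lemma dcons_reg e y lam : dg y = [::] -> ~~ connector e -> dt y = TReg lam ->
  dcons e y = DPath (src e) [::] (TReg (fun n => if n is n'.+1 then lam n' else e)).
Proof. by case: y => v g t /= -> /negPf ce ->; rewrite /dcons /= ce. Qed.

Lemma dcons_beta p (i : 'I_(k p)) (t : 'I_(nbeta i)) y :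
  dcons (beta t) y = dblock 0 t y.
Proof.
by rewrite dcons_nonreg; [rewrite (src_cyc (cyc_beta t)) | right; left; apply: connector_beta].
Qed.

Lemma dv_dcons e y : dv (dcons e y) = src e.
Proof. by case: y => v [|? ?] [|lam] //=; rewrite /dcons /=; case: ifP. Qed.

(** A non-connector that is not an [alpha] lies in a regular $E_p$, so an empty c-path at its range
    is followed by a regular tail. *)
Lemma nonalpha_tail e y : nonalpha e -> dvalid y -> dv y = rng e ->
  dg y = [::] -> ~~ connector e ->
  exists lam, dt y = TReg lam.
Proof.
move=> na [_ tk] vy gy ce; apply: (@tail_reg (rng e)).
  by have [r _ ->] := nonalpha_cedge na ce.
by move: tk; rewrite /dend gy vy.
Qed.

Lemma dcomp_dcons e y : nonalpha e -> dvalid y -> dv y = rng e ->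
  dcomp (dcons e y) = dcomp y.
Proof.
move=> na vy ey.
have [|] := pselect (dg y <> [::] \/ connector e \/ dt y = @TFree E).
  by move=> h; rewrite dcons_nonreg // /dcomp /dend /path_end /= -ey.
move=> /not_orP[/contrapT gy /not_orP[/negP ce _]].
have [lam ly] := nonalpha_tail na vy ey gy ce.
rewrite (dcons_reg gy ce ly) /dcomp /dend gy /path_end /= ey.
by have [_ _ ->] := nonalpha_cedge na ce.
Qed.

Lemma dvalid_dcons e y : nonalpha e -> dvalid y -> dv y = rng e -> dvalid (dcons e y).
Proof.
move=> na vy ey.
have [|] := pselect (dg y <> [::] \/ connector e \/ dt y = @TFree E).
  move=> h; rewrite dcons_nonreg //; case: vy => c tk; split; last first.
    by move: tk; rewrite /dend /path_end /= -ey.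
  rewrite /= ; case: (boolP (connector e)) => ce.
    by apply: cpath_connector => //; rewrite -ey.
  have [r ed re] := nonalpha_cedge na ce; apply: cpath_cedge => //; last by rewrite -ey.
  case: h => [//|[ch|ft] gy]; first by rewrite ch in ce.
  by move: tk; rewrite ft /dend gy /path_end /= ey re (negPf r).
move=> /not_orP[/contrapT gy /not_orP[/negP ce _]].
have [lam ly] := nonalpha_tail na vy ey gy ce.
rewrite (dcons_reg gy ce ly); split; first exact: cpath_nil.
have [r ed re] := nonalpha_cedge na ce; case: vy => _; rewrite ly /dend gy /path_end /= ey re => -[_ l0 h].
by split=> // -[|n]; [rewrite l0 | exact: h].
Qed.

(** Whether [e] joined the tail is visible in the result: exactly then its c-path is empty. So [e]
    is the head of the tail or of the c-path, and what remains is [y], whose source is [rng e]. *)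
Lemma dcons_inj e e' y y' : nonalpha e -> nonalpha e' -> dvalid y -> dvalid y' ->
  dv y = rng e -> dv y' = rng e' -> dcons e y = dcons e' y' -> e = e' /\ y = y'.
Proof.
move=> na na' vy vy' ey ey'.
have := nonalpha_tail na vy ey; have := nonalpha_tail na' vy' ey'.
case: y {vy} ey => v g t /= ->; case: y' {vy'} ey' => v' g' t' /= ->.
case: g => [|f g]; case: g' => [|f' g'].
- case: t => [|lam]; case: t' => [|lam']; rewrite /dcons /=.
  + by move=> _ _ [_ ->].
  + by case: ifP => // _.
  + by case: ifP => // _.
  case: ifP => _; case: ifP => // _ _ _ [].
    by move=> _ -> ->.
  move=> _ h; have e0 : e = e' by have := congr1 (fun f => f 0%N) h.
  split=> //; rewrite e0; congr DPath; congr TReg.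
  by apply/funext => n; have := congr1 (fun f => f n.+1) h.
- by move=> _ _; rewrite /dcons /=; case: t => [|lam]; [|case: ifP].
- by move=> _ _; rewrite /dcons /=; case: t' => [|lam]; [|case: ifP].
- by move=> _ _; rewrite /dcons /= => -[_ -> -> -> ->].
Qed.

Lemma dtr_dcons e y d : dtr (dcons e y) d = dtr y (trl e d).
Proof.
rewrite /dtr; case: y => v [|f g] [|lam]; rewrite /dcons /=;
  rewrite ?translate_path_cons //.
by case: ifP => ce /=; rewrite ?translate_path_cons //= /trl ce.
Qed.

Lemma dtrD x : {morph dtr x : d d' / d + d'}. Proof. exact: translate_pathD. Qed.
Lemma dtrN x : {morph dtr x : d / - d}. Proof. exact: translate_pathN. Qed.
Lemma dtr0 x : dtr x 0 = 0. Proof. exact: translate_path0. Qed.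

Lemma aedge_na e x n y : nonalpha e -> aedge e x n y ->
  [/\ dvalid y, dv y = rng e, x = dcons e y & n = (0, dunit (dcomp y))].
Proof. by move=> na [] // p i; [move=> /na | move=> j m t ? /na]. Qed.

Lemma aedge_alpha p (i : 'I_(k p)) x n z : aedge (alpha i) x n z ->
  [/\ x = dpure p, z = dpure p & n = (0, 'X^i)] \/
  exists (j : 'I_(k p)) (t : 'I_(nbeta j)) m y, [/\ dvalid y, dv y = rng (beta t),
    z = dblock m t y, x = dblock ((j == i) + m) t y & n = adeg i j y].
Proof.
case=> {x n z} [y /(_ p i)//|q i' e|q i' j m t y e vy ey].
  have pq : p = q by apply: cyc_comp (cyc_alpha i) _; rewrite e; apply: cyc_alpha.
  by subst q; left; rewrite (alpha_inj e).
have pq : p = q by apply: cyc_comp (cyc_alpha i) _; rewrite e; apply: cyc_alpha.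
by subst q; right; rewrite (alpha_inj e); exists j, t, m, y.
Qed.

Lemma aedge_fun e x n y x' n' : aedge e x n y -> aedge e x' n' y -> x = x' /\ n = n'.
Proof.
case: (pselect (nonalpha e)) => [na /(aedge_na na)[_ _ -> ->] /(aedge_na na)[_ _ -> ->]//|].
move=> /existsNP[p /existsNP[i /contrapT ->]].
move=> /aedge_alpha[[-> -> ->]|[j [t [m [u [_ vu -> -> ->]]]]]] /aedge_alpha.
  by case=> [[-> _ ->]//|[j' [t' [m' [u' [_ _ /block_pure]]]]]].
case=> [[_ /esym/block_pure//]|[j' [t' [m' [u' [_ vu' h -> ->]]]]]].
have [-> e2 ->] := block_inj vu vu' h.
have jj : j = j' by exact: (congr1 (@tag _ _) e2).
by subst j'; rewrite -(eq_from_Tagged e2).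
Qed.

Lemma aedge_inj e x n y n' y' : aedge e x n y -> aedge e x n' y' -> y = y' /\ n = n'.
Proof.
case: (pselect (nonalpha e)) => [na /(aedge_na na)[vy ey -> ->] /(aedge_na na)[vy' ey' h ->]|].
  by have [_ ->] := dcons_inj na na vy vy' ey ey' h.
move=> /existsNP[p /existsNP[i /contrapT ->]].
move=> /aedge_alpha[[-> -> ->]|[j [t [m [u [_ vu -> -> ->]]]]]] /aedge_alpha.
  by case=> [[_ -> ->]//|[j' [t' [m' [u' [_ _ _ /block_pure]]]]]].
case=> [[/esym/block_pure//]|[j' [t' [m' [u' [_ vu' -> h ->]]]]]].
have [em e2 ->] := block_inj vu vu' h.
have jj : j = j' by exact: (congr1 (@tag _ _) e2).
by subst j'; rewrite -(eq_from_Tagged e2) (addnI em).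
Qed.

Lemma aedge_src e x n y : aedge e x n y -> dv x = src e.
Proof.
case=> [z _ _ _|p i ->|p i j m t z -> _ _]; first exact: dv_dcons.
- by rewrite src_alpha.
- by rewrite src_alpha.
Qed.

Lemma aedge_rng e x n y : aedge e x n y -> dv y = rng e.
Proof. by case=> [//|p i ->|p i j m t z -> _ _]; rewrite rng_alpha. Qed.

Lemma aedge_valid e x n y : aedge e x n y -> dvalid x /\ dvalid y.
Proof.
case=> [z na vz ez|p i _|p i j m t z _ vz ez].
- by split=> //; apply: dvalid_dcons.
- by split; apply/dvalid_pure/(ord_free i).
- by split; apply: dvalid_block.
Qed.

(** This is the relation $e^*e=r(e)$ at the level of paths. *)
Lemma aedge_total e y : dvalid y -> dv y = rng e -> exists x n, aedge e x n y.
Proof.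
move=> vy ey; case: (pselect (nonalpha e)) => [na|].
  by do 2 eexists; apply: ae_cons.
move=> /existsNP[p /existsNP[i /contrapT ea]]; subst e.
rewrite rng_alpha in ey.
have [->|[j [t [m [z [vz ez ->]]]]]] := dfree_inv (ord_free i) ey vy.
  by do 2 eexists; apply: ae_pure.
by do 2 eexists; apply: ae_block.
Qed.

(* [term_act a x n y]: the partial injection defined by [a] sends y to x with
   degree n. *)
Fixpoint term_act (a : sterm E) (x : dpath) (n : Zoo * Zoo) (y : dpath) : Prop :=
  match a with
  | SZero => False
  | SVert v => [/\ x = y, n = 0, dvalid y & dv y = v]
  | SEdge e => aedge e x n y
  | STime v i b => [/\ x = y, n = (dtr y (if b then 'X^i else - 'X^i), 0),
                      dvalid y & dv y = v]
  | SMul a b => exists z n1 n2, [/\ term_act a x n1 z, term_act b z n2 y & n = n1 + n2]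
  | SStar a => term_act a y (- n) x
  end.

Lemma term_act_valid a x n y : term_act a x n y -> dvalid x /\ dvalid y.
Proof.
elim: a x n y => //= [v|e|v i b|a IHa b IHb|a IHa] x n y.
- by move=> [-> _].
- exact: aedge_valid.
- by move=> [-> _].
- by move=> [z [n1 [n2 [/IHa[? _] /IHb[_ ?] _]]]].
- by move=> /IHa[].
Qed.

(** Both halves go through one induction because [SStar] exchanges them. *)
Lemma term_act_bij a x n y :
  term_act a x n y -> (forall x' n', term_act a x' n' y -> x = x' /\ n = n') /\
    (forall n' y', term_act a x n' y' -> y = y' /\ n = n').
Proof.
elim: a x n y => //= [v|e|v i b|a IHa b IHb|a IHa] x n y.
- by move=> [-> -> _ ev]; split => [x' n'|n' y'] [-> ->].
- move=> h; split=> [x' n'|n' y']; [exact: aedge_fun|exact: aedge_inj].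
- by move=> [-> -> _ ev]; split => [x' n'|n' y'] [-> ->].
- move=> [z [n1 [n2 [/IHa[a1 a2] /IHb[b1 b2] ->]]]].
  split=> [x' n'|n' y'] [z' [n1' [n2' [h1 h2 ->]]]].
    by have [zz ->] := b1 _ _ h2; subst z'; have [-> ->] := a1 _ _ h1.
  by have [zz ->] := a2 _ _ h1; subst z'; have [-> ->] := b2 _ _ h2.
- move=> /IHa[h1 h2]; split=> [x' n'|n' y'] => [/h2|/h1] [-> /oppr_inj] //.
Qed.

End Action.

(** * The action respects the relations *)

Section Congruence.
Variables (E : sep_graph) (A : adaptable E).
Implicit Types (v w : vert E) (p q : tcomp E) (d : Zoo) (x y z : dpath E).

Local Notation k p := (ncyc A p).
Local Notation term_act := (term_act A).
Local Notation aedge := (aedge A).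

Lemma pairD d d' e e' : (d, e) + (d', e') = (d + d', e + e') :> Zoo * Zoo.
Proof. by []. Qed.

Lemma pairN d e : - (d, e) = (- d, - e) :> Zoo * Zoo.
Proof. by []. Qed.

Lemma aedge_pureE p (i : 'I_(k p)) n y : aedge (alpha i) (dpure A p) n y <->
  y = dpure A p /\ n = (0, 'X^i).
Proof.
split=> [/aedge_alpha[[_ -> ->]//|]|[-> ->]]; last exact: ae_pure.
by case=> j [t [m [z [_ _ _ /block_pure]]]].
Qed.

Lemma aedge_pureEr p (i : 'I_(k p)) n x : aedge (alpha i) x n (dpure A p) <->
  x = dpure A p /\ n = (0, 'X^i).
Proof.
split=> [/aedge_alpha[[-> _ ->]//|]|[-> ->]]; last exact: ae_pure.
by case=> j [t [m [z [_ _ /block_pure]]]].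
Qed.

Lemma aedge_alpha_dtr p (i : 'I_(k p)) x n y d : aedge (alpha i) x n y ->
  dtr A x d = dtr A y d.
Proof.
by move=> /aedge_alpha[[-> -> _]|[j [t [m [z [_ _ -> -> _]]]]]] //; rewrite !dtr_block.
Qed.

Lemma aedge_blockEr p (i j : 'I_(k p)) m (t : 'I_(nbeta j)) x n y :
  dvalid A y -> dv y = rng (beta t) ->
  aedge (alpha i) x n (dblock m t y) <->
    x = dblock ((j == i) + m) t y /\ n = adeg i j y.
Proof.
move=> vy ey; split=> [h|[-> ->]]; last exact: ae_block.
have h' : aedge (alpha i) (dblock ((j == i) + m) t y) (adeg i j y) (dblock m t y).
  exact: ae_block.
by have [-> ->] := aedge_fun h h'.
Qed.

Lemma aedge_blockE p (i j : 'I_(k p)) m (t : 'I_(nbeta j)) x n y :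
  dvalid A y -> dv y = rng (beta t) ->
  aedge (alpha i) (dblock m t y) n x <->
    exists m', [/\ m = ((j == i) + m')%N, x = dblock m' t y & n = adeg i j y].
Proof.
move=> vy ey; split=> [/aedge_alpha[[/esym/block_pure//]|]|[m' [-> -> ->]]]; last exact: ae_block.
case=> j' [t' [m' [y' [vy' ey' -> h ->]]]].
have [em et eqy] := block_inj ey ey' h; subst y'.
have jj : j = j' by exact: (congr1 (@tag _ _) et).
subst j'; rewrite -(eq_from_Tagged et) in em *; by exists m'.
Qed.

Lemma aedge_na_range e f x n n' y y' : nonalpha A e -> nonalpha A f ->
  aedge e x n y -> aedge f x n' y' -> e = f.
Proof.
move=> na nf /(aedge_na na)[vy ey xE _] /(aedge_na nf)[vy' ey']; rewrite xE => h _.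
by have [] := dcons_inj na nf vy vy' ey ey' h.
Qed.

(** Among paths with a first block of index [i], those in the range of [alpha i] have a positive
    exponent and those in the range of some [beta] have exponent 0. Two different [beta] are
    separated by the first edge. *)
Lemma cyc_range p (i : 'I_(k p)) e f x n n' y y' : cyc i e -> cyc i f ->
  aedge e x n y -> aedge f x n' y' -> e = f.
Proof.
have ab (t : 'I_(nbeta i)) m z m' z' : aedge (alpha i) x m z -> ~ aedge (beta t) x m' z'.
  move=> h /(aedge_na (nonalpha_beta (t := t)))[vy ey xE _].
  rewrite dcons_beta in xE; subst x.
  by move: h => /(aedge_blockE _ _ _ _ vy ey); rewrite eqxx => -[? [/esym]].
move=> [->|[s _ <-]] [->|[t _ <-]] //; first by move=> h /(ab _ _ _ _ _ h).
  by move=> + h => /(ab _ _ _ _ _ h).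
exact: aedge_na_range (nonalpha_beta (t := s)) (nonalpha_beta (t := t)).
Qed.

Lemma alpha_comm p (i j : 'I_(k p)) x n y : i != j ->
  (exists z n1 n2, [/\ aedge (alpha i) x n1 z, aedge (alpha j) z n2 y & n = n1 + n2]) ->
  exists z n1 n2, [/\ aedge (alpha j) x n1 z, aedge (alpha i) z n2 y & n = n1 + n2].
Proof.
move=> ij [z [n1 [n2 [h1 h2 ->]]]].
case: (aedge_alpha h2) => [[ez ey en]|[l [t [m [u [vu eu ey ez en]]]]]]; subst.
  move: h1 => /aedge_pureEr[-> ->]; exists (dpure A p), (0, 'X^j), (0, 'X^i).
  by split; [exact: ae_pure|exact: ae_pure|exact: addrC].
move: h1 => /(aedge_blockEr _ _ _ _ vu eu)[-> ->].
exists (dblock ((l == i) + m) t u), (adeg j l u), (adeg i l u).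
by rewrite addnCA; split; [exact: ae_block|exact: ae_block|exact: addrC].
Qed.

Lemma alpha_star_comm p (i j : 'I_(k p)) x n y : i != j ->
  (exists z n1 n2, [/\ aedge (alpha i) x n1 z, aedge (alpha j) y (- n2) z & n = n1 + n2]) <->
  exists z n1 n2, [/\ aedge (alpha j) z (- n1) x, aedge (alpha i) z n2 y & n = n1 + n2].
Proof.
move=> ij; split=> -[z [n1 [n2 [h1 h2 ->]]]].
  move: h1 => /aedge_alpha[[ex ez en]|[l [t [m [u [vu eu ez ex en]]]]]]; subst.
    move: h2 => /aedge_pureEr[-> en2]; exists (dpure A p), n2, (0, 'X^i).
    by rewrite en2; split; [exact: ae_pure|exact: ae_pure|exact: addrC].
  move: h2 => /(aedge_blockEr _ _ _ _ vu eu)[-> en2].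
  exists (dblock ((l == j) + ((l == i) + m)) t u), n2, (adeg i l u).
  split; [rewrite en2; exact: ae_block| |by rewrite addrC].
  by rewrite addnCA; apply: ae_block.
move: h1 => /aedge_alpha[[ex ez en]|[l [t [m [u [vu eu ez ex en]]]]]]; subst.
  move: h2 => /aedge_pureE[-> en2]; exists (dpure A p), (0, 'X^i), n1.
  by rewrite en en2; split; [exact: ae_pure|exact: ae_pure|exact: addrC].
move: h2 => /(aedge_blockE _ _ _ _ vu eu)[m' [em -> en2]].
(* As [i != j], at most one of the two loops changes the block, so the smaller exponent is the one
   from which both loops start. *)
have [e1 e2] : m = ((l == i) + minn m m')%N /\ m' = ((l == j) + minn m m')%N.
  case: (eqVneq l i) em => [->|_]; rewrite ?(negPf ij) /=; first by lia.
  by case: (l == j); lia.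
exists (dblock (minn m m') t u), n2, n1; split; last by rewrite addrC.
  by rewrite en2 {1}e1; apply: ae_block.
by rewrite en {1}e2; apply: ae_block.
Qed.

(** The common pattern of (R6), (R7) and (R8): on the range of [e] the factor [g] fixes the path and
    adds the same degree that [t] adds before [e] is applied. *)
Lemma term_act_na e g t c x n y : nonalpha A e ->
  (forall y, dvalid A y -> dv y = rng e -> forall x n,
    term_act g x n (dcons e y) <-> x = dcons e y /\ n = (dtr A y c, 0)) ->
  (forall x n y, term_act t x n y <-> [/\ x = y, n = (dtr A y c, 0), dvalid A y & dv y = rng e]) ->
  term_act (SMul g (SEdge e)) x n y <-> term_act (SMul (SEdge e) t) x n y.
Proof.
move=> na hg ht; split=> /= -[z [n1 [n2 [h1 h2 ->]]]].
  have [vy ey zE ->] := aedge_na na h2; subst z; have [-> ->] := proj1 (hg y vy ey _ _) h1.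
  exists y, (0, dunit A (dcomp y)), (dtr A y c, 0); split; [exact: ae_cons|exact/ht|].
  by rewrite !pairD !add0r !addr0.
have [zy -> vy ey] := proj1 (ht _ _ _) h2; subst z; have [_ _ -> ->] := aedge_na na h1.
exists (dcons e y), (dtr A y c, 0), (0, dunit A (dcomp y)); split; [exact/hg|exact: ae_cons|].
by rewrite !pairD !add0r !addr0.
Qed.

Lemma term_act_vertl v a x n y : term_act (SMul (SVert v) a) x n y <->
  term_act a x n y /\ dv x = v.
Proof.
split=> [/= [z [n1 [n2 [[-> -> _ <-] h ->]]]]|[h <-]]; first by rewrite add0r.
by have [vx _] := term_act_valid h; exists x, 0, n; rewrite add0r.
Qed.

Lemma term_act_vertr v a x n y : term_act (SMul a (SVert v)) x n y <->
  term_act a x n y /\ dv y = v.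
Proof.
split=> [/= [z [n1 [n2 [h [<- -> _ <-] ->]]]]|[h <-]]; first by rewrite addr0.
by have [_ vy] := term_act_valid h; exists y, n, 0; rewrite addr0.
Qed.

Lemma term_act_timeV v i b x n y :
  term_act (SMul (STime v i b) (STime v i (~~ b))) x n y <-> term_act (SVert v) x n y.
Proof.
have c z : dtr A z (if b then 'X^i else - 'X^i) + dtr A z (if ~~ b then 'X^i else - 'X^i) = 0.
  by rewrite -dtrD; case: (b); rewrite ?addrN ?addNr dtr0.
split=> [/= [z [n1 [n2 [[-> -> _ _] [-> -> ? ?] ->]]]]|/= [-> -> vy ev]].
  by rewrite pairD c addr0.
by do 3 eexists; split; [by split|by split|rewrite pairD c addr0].
Qed.

Lemma srel_act a b x n y : srel A a b -> term_act a x n y <-> term_act b x n y.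
Proof.
case=> {a b}.
- by move=> v; rewrite term_act_vertl /=; split=> [[]|[-> -> ? ?]].
- move=> v w vw; split=> [/= [z [n1 [n2 [[_ _ _ ev] [ez _ _ ew] _]]]]|//].
  by subst z; apply: vw; rewrite -ev -ew.
- move=> v; split=> [/= [-> /(canRL opprK) -> vx ev]|/= [-> -> vy ev]]; by rewrite oppr0.
- by move=> e; rewrite term_act_vertl /=; split=> [[]|h] //; split=> //; apply: aedge_src h.
- by move=> e; rewrite term_act_vertr /=; split=> [[]|h] //; split=> //; apply: aedge_rng h.
- move=> v X e sX Xe; split=> [/= [z [n1 [n2 [h1 h2 ->]]]]|/= [-> -> vy ev]].
    have [yz en] := aedge_inj h1 h2; rewrite yz -en addrN; split=> //.
      by case: (aedge_valid h2).
    exact: aedge_rng h2.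
  have [z [m h]] := aedge_total vy ev.
  by exists z, (- m), m; rewrite opprK addNr.
- move=> v X e f sX Xe Xf ef; split=> [/= [z [n1 [n2 [h1 h2 _]]]]|//]; case: ef.
  (* At a free vertex both edges lie in one [cyc i]. At a regular one both act by prepending, so a
     common image has a common first edge. *)
  case: (boolP (isfree A (comp v))) => fv.
    have [i [ie jf]] := sep_same sX Xe Xf fv.
    exact: cyc_range ie jf h1 h2.
  have [/seteqP[s _] _ _] := sep_partition v.
  have se : src e = v by apply: s; exists X.
  have sf : src f = v by apply: s; exists X.
  have nae : nonalpha A e by apply: nonalpha_reg; rewrite se.
  have naf : nonalpha A f by apply: nonalpha_reg; rewrite sf.
  exact: aedge_na_range nae naf h1 h2.
- by move=> p i j f ij /=; split; apply: alpha_comm; rewrite // eq_sym.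
- by move=> p i j f ij /=; apply: alpha_star_comm.
- move=> p i j s t f st; split=> [/= [z [n1 [n2 [h1 h2 _]]]]|//]; case: st.
  exact/beta_inj/(aedge_na_range (nonalpha_beta (t := s)) (nonalpha_beta (t := t)) h1 h2).
- move=> v i j b c; split=> /= -[z [n1 [n2 [[-> -> vz ez] [ey -> vy' ev] ->]]]]; subst z;
  by do 3 eexists; split; [by split|by split|exact: addrC].
- by move=> v i; rewrite term_act_vertl /=; split=> [[]|[-> -> ? ?]].
- by move=> v i; rewrite term_act_vertr /=; split=> [[]|[-> -> ? ?]].
- by move=> v i; apply: (@term_act_timeV v i true).
- by move=> v i; apply: (@term_act_timeV v i false).
- move=> v i; split=> [/= [-> /(canRL (@opprK _)) -> vx ev]|/= [-> -> vy ev]].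
    by rewrite pairN dtrN oppr0.
  by rewrite pairN dtrN opprK oppr0.
- move=> e i r; apply: (term_act_na (c := 'X^i)) => // [|y' vy ey x' n']; first exact: nonalpha_reg.
  rewrite /= dtr_dcons trl_reg // dv_dcons; split=> [[-> ->]|[-> ->]] //.
  by split=> //; apply: dvalid_dcons => //; apply: nonalpha_reg.
- move=> p j s i b f; have na := nonalpha_beta (t := s).
  apply: (term_act_na (c := if b then 'X^(i + (k p).-1) else - 'X^(i + (k p).-1))) => //.
  move=> y' vy ey x' n' /=.
  have -> : dtr A (dcons (beta s) y') (if b then 'X^i else - 'X^i)
      = dtr A y' (if b then 'X^(i + (k p).-1) else - 'X^(i + (k p).-1)).
    by rewrite dtr_dcons trl_beta exprD; case: b; rewrite ?mulNr.
  rewrite dv_dcons (src_cyc (cyc_beta s)); split=> [[-> ->]|[-> ->]] //.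
  by split=> //; apply: dvalid_dcons.
- move=> p i j s f ij; have ji : (j == i) = false by rewrite eq_sym (negPf ij).
  apply: (term_act_na (c := 'X^(unbump j i))) => // [|y' vy ey x' n' /=].
    exact: nonalpha_beta.
  by rewrite dcons_beta (aedge_blockEr _ _ _ _ vy ey) /adeg ji.
- move=> p i j s f ij; have ji : (j == i) = false by rewrite eq_sym (negPf ij).
  apply: (term_act_na (c := - 'X^(unbump j i))) => // [|y' vy ey x' n' /=].
    exact: nonalpha_beta.
  rewrite dcons_beta (aedge_blockE _ _ _ _ vy ey) /adeg ji dtrN; split.
    move=> [m' []]; rewrite add0n => <- -> e; split=> //; by rewrite -[n']opprK e pairN oppr0.
  by move=> [-> ->]; exists 0%N; rewrite pairN oppr0 opprK.
- move=> p j i f; split=> /= -[z [n1 [n2 [h1 h2 ->]]]].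
    case: h1 h2 => [-> -> _ _] h; have [_ vy] := aedge_valid h; have ey := aedge_rng h.
    exists y, n2, (dtr A y 'X^i, 0); rewrite (aedge_alpha_dtr _ h) addrC.
    by split=> //; split=> //; rewrite ey rng_alpha.
  case: h2 h1 => [<- -> _ _] h; have [vx _] := aedge_valid h; have ex := aedge_src h.
  exists x, (dtr A x 'X^i, 0), n1; rewrite (aedge_alpha_dtr _ h) addrC.
  by split=> //; split=> //; rewrite ?(aedge_alpha_dtr _ h) // ex src_alpha.
- move=> p j i f; split=> /= -[z [n1 [n2 [h1 h2 ->]]]].
    case: h1 h2 => [-> -> _ _] h; have [vy _] := aedge_valid h; have ey := aedge_src h.
    exists y, n2, (dtr A y 'X^i, 0); rewrite -(aedge_alpha_dtr _ h) addrC.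
    by split=> //; split=> //; rewrite ey src_alpha.
  case: h2 h1 => [<- -> _ _] h; have [_ vx] := aedge_valid h; have ex := aedge_rng h.
  exists x, (dtr A x 'X^i, 0), n1; rewrite -(aedge_alpha_dtr _ h) addrC.
  by split=> //; split=> //; rewrite ?(aedge_alpha_dtr _ h) // ex rng_alpha.
Qed.

Lemma scong_act a b : scong A a b -> forall x n y, term_act a x n y <-> term_act b x n y.
Proof.
elim=> {a b} [a b r x n y|a x n y|a b _ IH x n y|b a c _ IH1 _ IH2 x n y
  |a a' b b' _ IHa _ IHb x n y|a a' _ IH x n y|a b c x n y|a x n y|a x n y|a x n y
  |a b x n y].
- exact: srel_act.
- by [].
- by split=> /IH.
- by rewrite IH1 IH2.
- by split=> /= -[z [n1 [n2 [/IHa ? /IHb ? ->]]]]; exists z, n1, n2.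
- exact: IH.
- split=> /=.
    move=> [z [n1 [n2 [h1 [u [n3 [n4 [h2 h3 ->]]]] ->]]]].
    by exists u, (n1 + n3), n4; rewrite addrA; split=> //; exists z, n1, n3.
  move=> [u [n1 [n2 [[z [n3 [n4 [h2 h3 ->]]]] h ->]]]].
  by exists z, n3, (n4 + n2); rewrite addrA; split=> //; exists u, n4, n2.
- by split=> //= -[z [n1 [n2 []]]].
- by split=> //= -[z [n1 [n2 []]]].
- by rewrite /= opprK.
- split=> /= -[z [n1 [n2 [h1 h2 e]]]].
    by exists z, (- n2), (- n1); rewrite !opprK -opprD addrC -e opprK.
  by exists z, (- n2), (- n1); split=> //; rewrite e opprD addrC.
Qed.

End Congruence.

(** * Calculus in S(E,C) *)

Section Algebra.
Variables (E : sep_graph) (A : adaptable E).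
Implicit Types (v w : vert E) (e f : edge E) (l gam : seq (edge E)) (p q : tcomp E) (d : Zoo).
Local Open Scope group_scope.

Local Notation k p := (ncyc A p).
Local Notation S := (SEC A).
Implicit Types a : S.
Local Notation V := (svert A).
Local Notation Ed := (sedge A).
Local Notation T := (stime A).
Local Notation PE := (path_el A).
Local Notation TT := (time_el A).

Lemma SEC_piM (a b : sterm E) : SEC_pi A (SMul a b) = SEC_pi A a * SEC_pi A b.
Proof. by rewrite -SEC_mulE. Qed.

Lemma SEC_piS (a : sterm E) : SEC_pi A (SStar a) = star (SEC_pi A a).
Proof. by rewrite -SEC_starE. Qed.

Lemma SEC_pi_srel (a b : sterm E) : srel A a b -> SEC_pi A a = SEC_pi A b.
Proof. by move=> r; apply/SEC_piP/scong_rel. Qed.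

Lemma sec_ind (P : S -> Prop) : P szero -> (forall v, P (V v)) -> (forall e, P (Ed e)) ->
  (forall v i b, P (T v i b)) -> (forall a b, P a -> P b -> P (a * b)) ->
  (forall a, P a -> P (star a)) -> forall a, P a.
Proof.
move=> P0 Pv Pe Pt PM PS a; rewrite -(SEC_reprK a); elim: (SEC_repr a) => //.
- by move=> b Pb c Pc; rewrite SEC_piM; apply: PM.
- by move=> b Pb; rewrite SEC_piS; apply: PS.
Qed.

Lemma star0 : star szero = szero :> S.
Proof. by rewrite -{1}(muls0 (star szero)) starM starK muls0. Qed.

Lemma vertM v : V v * V v = V v.
Proof. by rewrite -SEC_piM; apply/SEC_pi_srel/R1_idem. Qed.
Lemma vert_orth v w : v <> w -> V v * V w = szero.
Proof. by move=> vw; rewrite -SEC_piM; apply/SEC_pi_srel/R1_orth. Qed.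
Lemma vert_star v : star (V v) = V v.
Proof. by rewrite -SEC_piS; apply/SEC_pi_srel/R1_star. Qed.
Lemma vert_edge e : V (src e) * Ed e = Ed e.
Proof. by rewrite -SEC_piM; apply/SEC_pi_srel/R2_src. Qed.
Lemma edge_vert e : Ed e * V (rng e) = Ed e.
Proof. by rewrite -SEC_piM; apply/SEC_pi_srel/R2_rng. Qed.
Lemma edge_starl e : star (Ed e) * Ed e = V (rng e).
Proof.
have [/seteqP[_ h] _ _] := sep_partition (src e); have [X sX Xe] := h e erefl.
by rewrite -SEC_piS -SEC_piM; apply/SEC_pi_srel/(R2_eq A sX Xe).
Qed.
Lemma edge_orth v X e f : sep v X -> X e -> X f -> e <> f -> star (Ed e) * Ed f = szero.
Proof. by move=> *; rewrite -SEC_piS -SEC_piM; apply/SEC_pi_srel/R2_neq; eassumption. Qed.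
(** At a regular vertex $C_w$ has a single element, so (R2) applies to any two distinct edges
    starting there. *)
Lemma edge_orth_reg e f : ~~ isfree A (comp (src e)) -> src f = src e -> e <> f ->
  star (Ed e) * Ed f = szero.
Proof.
move=> r sf ef; have [X sX] := reg_sep r erefl.
have [/seteqP[_ hs] _ _] := sep_partition (src e).
have [X1 sX1 X1e] := hs e erefl; have [X2 sX2 X2f] := hs f sf.
move: (sX1) (sX2); rewrite sX => e1' e2'; rewrite e2' -e1' in X2f.
exact: (edge_orth sX1 X1e X2f).
Qed.
Lemma alphaC p (i j : 'I_(k p)) : Ed (alpha i) * Ed (alpha j) = Ed (alpha j) * Ed (alpha i).
Proof.
have [->//|ij] := eqVneq i j.
by rewrite -!SEC_piM; apply/SEC_pi_srel/R3_al => //; apply: ord_free i.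
Qed.
Lemma alpha_starC p (i j : 'I_(k p)) : i != j ->
  Ed (alpha i) * star (Ed (alpha j)) = star (Ed (alpha j)) * Ed (alpha i).
Proof.
by move=> ij; rewrite -!SEC_piS -!SEC_piM; apply/SEC_pi_srel/R3_star => //; apply: ord_free i.
Qed.
Lemma alpha_star_starC p (i j : 'I_(k p)) :
  star (Ed (alpha i)) * star (Ed (alpha j)) = star (Ed (alpha j)) * star (Ed (alpha i)).
Proof. by rewrite -!starM alphaC. Qed.
Lemma beta_orth p (i j : 'I_(k p)) (s : 'I_(nbeta i)) (t : 'I_(nbeta j)) :
  beta s <> beta t -> star (Ed (beta s)) * Ed (beta t) = szero.
Proof.
move=> st; rewrite -!SEC_piS -!SEC_piM; apply/SEC_pi_srel/R4; first exact: ord_free i.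
move=> e; apply: st; have ij : i = j by exact: (congr1 (@tag _ _) e).
by subst j; rewrite (eq_from_Tagged e).
Qed.
Lemma timeC v i j b c : T v i b * T v j c = T v j c * T v i b.
Proof. by rewrite -!SEC_piM; apply/SEC_pi_srel/R5_comm. Qed.
Lemma time_star v i b : star (T v i b) = T v i (~~ b).
Proof.
have h : star (T v i true) = T v i false by rewrite -SEC_piS; apply/SEC_pi_srel/R5_star.
by case: b => //=; rewrite -h starK.
Qed.
Lemma vert_time v i b : V v * T v i b = T v i b.
Proof.
case: b; first by rewrite -!SEC_piM; apply/SEC_pi_srel/R5_l.
rewrite -[T _ _ _]starK -[V v]starK -starM time_star vert_star /=; congr star.
by rewrite -!SEC_piM; apply/SEC_pi_srel/R5_r.
Qed.
Lemma time_vert v i b : T v i b * V v = T v i b.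
Proof. by rewrite -[T _ _ _]starK -{1}[V v]vert_star -starM time_star vert_time. Qed.
Lemma timeV v i b : T v i b * T v i (~~ b) = V v.
Proof.
by case: b => /=; rewrite -!SEC_piM; apply/SEC_pi_srel; [apply: R5_tV|apply: R5_Vt].
Qed.

Lemma mulX_mull a (b x : S) n : mulX (b * a) x n = b * mulX a x n.
Proof. by elim: n => //= n ->; rewrite mulgA. Qed.

Lemma mulXS a (x : S) n : mulX a x n.+1 = mulX (a * x) x n.
Proof. by rewrite /mulX iterSr. Qed.

Lemma mulX_comm a (c x : S) n : x * c = c * x -> mulX a x n * c = mulX (a * c) x n.
Proof. by move=> xc; elim: n => //= n <-; rewrite -!mulgA xc. Qed.

Definition stimez v i (z : int) : S := mulX (V v) (T v i (0 <= z)%R) (absz z).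

Lemma stimez_vert v i z : stimez v i z * V v = stimez v i z.
Proof. by rewrite mulX_comm ?vertM // time_vert vert_time. Qed.

Lemma vert_stimez v i z : V v * stimez v i z = stimez v i z.
Proof. by rewrite -mulX_mull vertM. Qed.

Lemma mulX_vert a v (x : S) n : a * V v = a -> mulX a x n = a * mulX (V v) x n.
Proof. by move=> e; rewrite -mulX_mull e. Qed.

Lemma stimez_succ v i z : stimez v i (z + 1)%R = stimez v i z * T v i true.
Proof.
case: z => [n|[|n]].
- by rewrite -[1%R]/(1%:Z)%R -PoszD addn1.
- by rewrite /stimez /= -mulgA (timeV v i false) vertM.
have -> : (Negz n.+1 + 1)%R = Negz n by rewrite !NegzE; lia.
by rewrite /stimez /= -!mulgA (timeV v i false) time_vert.
Qed.

Lemma stimez_pred v i z : stimez v i (z - 1)%R = stimez v i z * T v i false.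
Proof.
rewrite -[in RHS](subrK 1%R z) stimez_succ -mulgA (timeV v i true).
by rewrite stimez_vert.
Qed.

Lemma stimezD v i z z' : stimez v i (z + z')%R = stimez v i z * stimez v i z'.
Proof.
elim/int_rect: z' => [|n IH|n IH].
- by rewrite addr0 /stimez /= stimez_vert.
- have -> : (z + n.+1%:Z = z + n%:Z + 1)%R by lia.
  have -> : (n.+1%:Z = n%:Z + 1)%R by lia.
  by rewrite !stimez_succ IH mulgA.
- have -> : (z - n.+1%:Z = z - n%:Z - 1)%R by lia.
  have -> : (- n.+1%:Z = - n%:Z - 1)%R by lia.
  by rewrite !stimez_pred IH mulgA.
Qed.

Lemma stimez1 v i : stimez v i 1%R = T v i true.
Proof. exact: vert_time. Qed.

Lemma stimezN1 v i : stimez v i (-1)%R = T v i false.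
Proof. exact: vert_time. Qed.

Lemma stimezC v i j z z' : stimez v i z * stimez v j z' = stimez v j z' * stimez v i z.
Proof.
have h b n : T v i b * stimez v j n = stimez v j n * T v i b.
  by rewrite /stimez mulX_comm ?(timeC v j) // vert_time -mulX_mull time_vert.
elim/int_rect: z => [|n IH|n IH].
- by rewrite /stimez /= vert_stimez stimez_vert.
- have -> : (n.+1%:Z = n%:Z + 1)%R by lia.
  by rewrite stimez_succ -mulgA h !mulgA IH.
- have -> : (- n.+1%:Z = - n%:Z - 1)%R by lia.
  by rewrite stimez_pred -mulgA h !mulgA IH.
Qed.

(** [time_el] stops at [size d], which is not stable under addition. With a fixed number of factors
    two sequences can be compared factor by factor; the extra factors are [V v]. *)
Definition ftime v d n : S :=
  foldl (fun a i => mulX a (T v i (0 <= d`_i)%R) (absz (d`_i)%R)) (V v) (iota 0 n).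

Lemma ftimeS v d n : ftime v d n.+1 = ftime v d n * stimez v n (d`_n)%R /\
  ftime v d n * V v = ftime v d n.
Proof.
elim: n => [|n [IH1 IH2]].
  by rewrite /ftime /= vertM; split=> //; apply: mulX_vert; rewrite vertM.
have h : ftime v d n.+1 * V v = ftime v d n.+1 by rewrite IH1 -mulgA stimez_vert.
split=> //; rewrite {1}/ftime -[n.+2]addn1 iotaD foldl_cat /= add0n.
exact: mulX_vert h.
Qed.

Lemma time_elE v d n : (size d <= n)%N -> TT v d = ftime v d n.
Proof.
move=> /subnK <-; elim: (n - size d)%N => // m ->.
by rewrite addSn (ftimeS _ _ _).1 nth_default ?leq_addl // /stimez /= (ftimeS _ _ _).2.
Qed.

Lemma ftime_stimezC v d n m z : ftime v d n * stimez v m z = stimez v m z * ftime v d n.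
Proof.
elim: n => [|n IH]; first by rewrite /ftime /= vert_stimez stimez_vert.
by rewrite (ftimeS _ _ _).1 -mulgA (stimezC v n) !mulgA IH.
Qed.

Lemma ftimeD v d d' n : ftime v (d + d')%R n = ftime v d n * ftime v d' n.
Proof.
elim: n => [|n IH]; first by rewrite /ftime /= vertM.
rewrite !(ftimeS _ _ _).1 coefD IH stimezD -!mulgA; congr (_ * _).
by rewrite !mulgA ftime_stimezC.
Qed.

Lemma time_elD v d d' : TT v (d + d')%R = TT v d * TT v d'.
Proof.
have [n [h1 h2 h3]] : exists n, [/\ size d <= n, size d' <= n & size (d + d')%R <= n]%N.
  exists (maxn (size d) (size d')).
  by rewrite leq_maxl leq_maxr size_polyD.
by rewrite !(time_elE v (n := n)) // ftimeD.
Qed.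

Lemma time_el0 v : TT v 0%R = V v.
Proof. by rewrite /time_el size_poly0. Qed.

Lemma time_elX v i (b : bool) : TT v (if b then 'X^i else - 'X^i)%R = T v i b.
Proof.
rewrite (time_elE v (n := i.+1)); last by case: b; rewrite ?size_polyN size_polyXn.
rewrite (ftimeS _ _ _).1.
have -> : ftime v (if b then 'X^i else - 'X^i)%R i = V v.
  suff h m : (m <= i)%N -> ftime v (if b then 'X^i else - 'X^i)%R m = V v by exact: h.
  elim: m => // m IH mi; rewrite (ftimeS _ _ _).1 IH 1?ltnW //.
  have -> : ((if b then 'X^i else - 'X^i)%R`_m = 0 :> int)%R.
    by case: (b); rewrite ?coefN coefXn (ltn_eqF mi).
  by rewrite /stimez /= vertM.
rewrite vert_stimez.
have -> : ((if b then 'X^i else - 'X^i)%R`_i = if b then 1 else -1 :> int)%R.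
  by case: b; rewrite ?coefN coefXn eqxx.
by case: b; rewrite ?stimez1 ?stimezN1.
Qed.

(** As a monoid $\mathbb Z^{(\infty)}$ is generated by the $\pm X^i$, so additive statements about
    [time_el] reduce to a single $t_i^{\pm1}$. *)
Lemma Zoo_ind (P : Zoo -> Prop) : P 0%R -> (forall i (b : bool), P (if b then 'X^i else - 'X^i)%R) ->
  (forall d d', P d -> P d' -> P (d + d')%R) -> forall d, P d.
Proof.
move=> P0 PX PD d; rewrite -[d]coefK poly_def; elim/big_ind: _ => // i _.
have h (b : bool) n : P ((if b then 'X^i else - 'X^i) *+ n)%R.
  by elim: n => [|n IH]; rewrite ?mulr0n // mulrS; apply: PD.
rewrite -[X in (X *: _)%R]intz scaler_int; case: (d`_i)%R => n.
  by rewrite -pmulrn; apply: (h true).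
by rewrite NegzE mulrNz -mulNrz -pmulrn; apply: (h false).
Qed.

Lemma vert_time_el v d : V v * TT v d = TT v d.
Proof. by rewrite -{1}time_el0 -time_elD add0r. Qed.

Lemma time_el_vert v d : TT v d * V v = TT v d.
Proof. by rewrite -{1}time_el0 -time_elD addr0. Qed.

Lemma time_el_star v d : star (TT v d) = TT v (- d)%R.
Proof.
elim/Zoo_ind: d => [|i b|d d' IH IH'].
- by rewrite oppr0 time_el0 vert_star.
- rewrite time_elX time_star -time_elX; congr (TT v _).
  by case: b; rewrite //= opprK.
- by rewrite opprD addrC !time_elD starM IH IH'.
Qed.

(** Unites (R6), (R7) and (R9): the three kinds of edges differ only in the translation. *)
Lemma time_el_edge e d : TT (src e) d * Ed e = Ed e * TT (rng e) (trl A e d).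
Proof.
have trl0 : trl A e 0%R = 0%R.
  by apply: (addIr (trl A e 0%R)); rewrite -trlD !add0r.
elim/Zoo_ind: d => [|i b|d d' IH IH'].
- by rewrite trl0 !time_el0 vert_edge edge_vert.
- rewrite time_elX; have [r|[p [j ea]]|[p [j [t et]]]] := edge_cases A e.
  + rewrite trl_reg // time_elX.
    have h : T (src e) i true * Ed e = Ed e * T (rng e) i true.
      by rewrite -!SEC_piM; apply/SEC_pi_srel/R6.
    (* (R6) speaks of $t_i$ only. For its inverse, insert $t_it_i^{-1}$ to the right of $e$ and move
       the $t_i$ across $e$ to the left. *)
    case: b => //; rewrite -[in LHS]edge_vert -(timeV _ i true) 2!mulgA.
    by rewrite -[X in X * _]mulgA -h mulgA (timeV _ i false) vert_edge.
  + subst e; rewrite trl_alpha src_alpha rng_alpha time_elX.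
    have f := ord_free j.
    case: b; first by rewrite -!SEC_piM; apply/SEC_pi_srel/R9_al.
    (* The adjoint of this instance of (R9) is the commutation of $\alpha$ with $t_i^{-1}$. *)
    have h : T (vp A p) i true * star (Ed (alpha j)) = star (Ed (alpha j)) * T (vp A p) i true.
      by rewrite -!SEC_piS -!SEC_piM; apply/SEC_pi_srel/R9_star.
    by have := congr1 star h; rewrite !starM !starK time_star => ->.
  + subst e; rewrite trl_beta (src_cyc (cyc_beta t)).
    have -> : ((if b then 'X^i else - 'X^i) * 'X^((k p).-1) =
      if b then 'X^(i + (k p).-1) else - 'X^(i + (k p).-1) :> Zoo)%R.
      by case: b; rewrite exprD ?mulNr.
    rewrite time_elX -!SEC_piM; apply/SEC_pi_srel/R7; exact: ord_free j.
- by rewrite trlD !time_elD -!mulgA IH' !mulgA IH.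
Qed.

Lemma edge_star_time e d :
  star (Ed e) * TT (src e) d = TT (rng e) (trl A e d) * star (Ed e).
Proof.
have := congr1 star (time_el_edge e (- d)%R).
by rewrite !starM !time_el_star trlN !opprK.
Qed.

Lemma alpha_beta_comm p (i j : 'I_(k p)) (s : 'I_(nbeta j)) : i != j ->
  Ed (alpha i) * Ed (beta s) = Ed (beta s) * TT (rng (beta s)) 'X^(unbump j i)%R /\
  star (Ed (alpha i)) * Ed (beta s) = Ed (beta s) * TT (rng (beta s)) (- 'X^(unbump j i))%R.
Proof.
move=> ij; have f := ord_free i; rewrite (time_elX _ _ true) (time_elX _ _ false) -!SEC_piS -!SEC_piM.
by split; apply/SEC_pi_srel; [apply: R8_al|apply: R8_star].
Qed.

Lemma beta_star_alpha p (i j : 'I_(k p)) (s : 'I_(nbeta j)) : i != j ->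
  star (Ed (beta s)) * Ed (alpha i) = TT (rng (beta s)) 'X^(unbump j i)%R * star (Ed (beta s)) /\
  star (Ed (beta s)) * star (Ed (alpha i)) = TT (rng (beta s)) (- 'X^(unbump j i))%R * star (Ed (beta s)).
Proof.
move=> ij; have [h1 h2] := alpha_beta_comm s ij; split.
  by have := congr1 star h2; rewrite !starM starK time_el_star opprK.
by have := congr1 star h1; rewrite !starM time_el_star.
Qed.

Lemma foldl_edges a v l : foldl (fun a e => a * Ed e) (a * V v) l = a * PE v l.
Proof.
by rewrite /path_el; elim/last_ind: l => //= l e IH; rewrite !foldl_rcons IH mulgA.
Qed.

Lemma path_el_end v l : PE v l * V (path_end v l) = PE v l.
Proof.
case/lastP: l => [|l e]; first exact: vertM.
by rewrite path_end_rcons /path_el foldl_rcons -mulgA edge_vert.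
Qed.

Lemma vert_path_el v l : V v * PE v l = PE v l.
Proof. by rewrite -foldl_edges vertM. Qed.

Lemma path_el_cat v l l' : PE v (l ++ l') = PE v l * PE (path_end v l) l'.
Proof. by rewrite {1}/path_el foldl_cat -/(PE v l) -{1}path_el_end foldl_edges. Qed.

Lemma path_el1 e : PE (src e) [:: e] = Ed e.
Proof. exact: vert_edge. Qed.

Lemma path_el_cons e l : PE (src e) (e :: l) = Ed e * PE (rng e) l.
Proof. by rewrite -cat1s path_el_cat path_el1. Qed.

Lemma path_el_rcons v l e : PE v (rcons l e) = PE v l * Ed e.
Proof. by rewrite /path_el foldl_rcons. Qed.

Lemma path_el_starl F v l : is_path F v l -> star (PE v l) * PE v l = V (path_end v l).
Proof.
elim: l v => [|e l IH] v /=; first by rewrite /path_el /= vert_star vertM.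
move=> [_ <- /IH h]; rewrite path_el_cons starM -mulgA (mulgA (star (Ed e))) edge_starl.
by rewrite vert_path_el h.
Qed.

Lemma path_el_time F v l d : is_path F v l ->
  TT v d * PE v l = PE v l * TT (path_end v l) (translate_path A l d).
Proof.
elim: l v d => [|e l IH] v d /=; first by rewrite /path_el /= vert_time_el time_el_vert.
move=> [_ <- /IH h]; rewrite path_el_cons mulgA time_el_edge -mulgA h mulgA.
by rewrite translate_path_cons.
Qed.

(** * Monomials at a free component *)

Section Monomials.
Variable p : tcomp E.
Implicit Types (i j : 'I_(k p)) (kk ll : 'I_(k p) -> nat) (s : seq 'I_(k p)).
Local Notation al i := (Ed (alpha i)).

Lemma vp_alpha j : V (vp A p) * al j = al j.
Proof. by have := vert_edge (alpha j); rewrite src_alpha. Qed.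
Lemma alpha_vp j : al j * V (vp A p) = al j.
Proof. by have := edge_vert (alpha j); rewrite rng_alpha. Qed.
Lemma vp_alpha_star j : V (vp A p) * star (al j) = star (al j).
Proof. by rewrite -[V _]vert_star -starM alpha_vp. Qed.
Lemma alpha_star_vp j : star (al j) * V (vp A p) = star (al j).
Proof. by rewrite -[V _]vert_star -starM vp_alpha. Qed.

Definition mfac kk ll a j : S := mulX (mulX a (al j) (kk j)) (star (al j)) (ll j).

Definition mono d kk ll : S := monomial_el (MFree d kk ll).

Lemma monoE d kk ll : mono d kk ll = foldl (mfac kk ll) (TT (vp A p) d) (enum 'I_(k p)).
Proof. by []. Qed.

Lemma mfac_mull a (b : S) kk ll j : mfac kk ll (b * a) j = b * mfac kk ll a j.
Proof. by rewrite /mfac !mulX_mull. Qed.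

Lemma mfacs_mull a (b : S) kk ll s : foldl (mfac kk ll) (b * a) s = b * foldl (mfac kk ll) a s.
Proof. by elim: s a => //= j s IH a; rewrite mfac_mull IH. Qed.

Lemma mfacs_ext kk ll kk' ll' s a : {in s, kk =1 kk'} -> {in s, ll =1 ll'} ->
  foldl (mfac kk ll) a s = foldl (mfac kk' ll') a s.
Proof.
elim: s a => //= j s IH a h1 h2; rewrite IH.
- by rewrite /mfac h1 ?h2 // mem_head.
- by move=> x xs; apply: h1; rewrite in_cons xs orbT.
- by move=> x xs; apply: h2; rewrite in_cons xs orbT.
Qed.

Lemma mfacs_comm kk ll s a (c : S) : {in s, forall j, al j * c = c * al j} ->
  {in s, forall j, star (al j) * c = c * star (al j)} ->
  foldl (mfac kk ll) (a * c) s = foldl (mfac kk ll) a s * c.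
Proof.
elim: s a => //= j s IH a h1 h2.
rewrite {2}/mfac -(mulX_comm _ _ (h1 j _)) ?mem_head // -(mulX_comm _ _ (h2 j _)) ?mem_head //.
rewrite -/(mfac kk ll a j) IH //.
- by move=> x xs; apply: h1; rewrite in_cons xs orbT.
- by move=> x xs; apply: h2; rewrite in_cons xs orbT.
Qed.

Lemma mfacs_vert kk ll s a : a * V (vp A p) = a ->
  foldl (mfac kk ll) a s * V (vp A p) = foldl (mfac kk ll) a s.
Proof.
move=> h; rewrite -mfacs_comm ?h // => j _.
  by rewrite alpha_vp vp_alpha.
by rewrite alpha_star_vp vp_alpha_star.
Qed.

(** Isolates the factor of index [i] in the ordered product; the factors on either side have other
    indices, so the relations for distinct indices apply to them. *)
Lemma ord_split i : exists s1 s2, [/\ enum 'I_(k p) = s1 ++ i :: s2, i \notin s1 & i \notin s2].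
Proof.
have := enum_uniq 'I_(k p); case/splitPr: (mem_enum 'I_(k p) i) => s1 s2.
rewrite cat_uniq /= negb_or => /and3P[_ /andP[h1 _] /andP[h2 _]].
by exists s1, s2.
Qed.

Lemma mono_vert d kk ll : mono d kk ll * V (vp A p) = mono d kk ll.
Proof. by apply: mfacs_vert; apply: time_el_vert. Qed.

Lemma mono00 d : mono d (fun=> 0%N) (fun=> 0%N) = TT (vp A p) d.
Proof. by rewrite monoE; elim: (enum _) (TT _ _) => //= j s IH a; exact: IH. Qed.

Lemma time_mono d' d kk ll : TT (vp A p) d' * mono d kk ll = mono (d' + d)%R kk ll.
Proof. by rewrite !monoE -mfacs_mull -time_elD. Qed.

Lemma time_alpha d j : TT (vp A p) d * al j = al j * TT (vp A p) d.
Proof. by have := time_el_edge (alpha j) d; rewrite src_alpha rng_alpha trl_alpha. Qed.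

Lemma time_alpha_star d j : TT (vp A p) d * star (al j) = star (al j) * TT (vp A p) d.
Proof. by have := edge_star_time (alpha j) d; rewrite src_alpha rng_alpha trl_alpha => ->. Qed.

Lemma alpha_mono i d kk ll :
  al i * mono d kk ll = mono d (fun j => kk j + (j == i))%N ll.
Proof.
have [s1 [s2 [es i1 i2]]] := ord_split i.
rewrite !monoE es !foldl_cat /= -mfacs_mull -mfac_mull -mfacs_mull -time_alpha.
rewrite mfacs_comm; last first.
- move=> j js; rewrite alpha_starC //; by apply: contraNneq i1 => ->.
- by move=> j js; rewrite alphaC.
have -> : forall a, mfac kk ll (a * al i) i = mfac (fun j => kk j + (j == i))%N ll a i.
  by move=> a; rewrite /mfac eqxx addn1 mulXS.
rewrite (mfacs_ext (s := s1) (kk' := (fun j => kk j + (j == i))%N) (ll' := ll)) //; last first.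
  move=> j js /=; rewrite (_ : (j == i) = false) ?addn0 //.
  by apply/negbTE; apply: contraNneq i1 => <-.
apply: mfacs_ext => // j js; rewrite (_ : (j == i) = false) ?addn0 //.
by apply/negbTE; apply: contraNneq i2 => <-.
Qed.

(** Truncated subtraction covers both cases at once: if [kk i > 0], then $\alpha_i^*\alpha_i=v^p$
    cancels one loop; if [kk i = 0], the exponent [ll i] grows by 1. *)
Lemma alpha_star_mono i d kk ll : star (al i) * mono d kk ll =
  mono d (fun j => kk j - (j == i))%N (fun j => ll j + ((j == i) - kk j))%N.
Proof.
have [s1 [s2 [es i1 i2]]] := ord_split i.
rewrite !monoE es !foldl_cat /= -mfacs_mull -mfac_mull -mfacs_mull -time_alpha_star.
rewrite mfacs_comm; last first.
- by move=> j js; rewrite alpha_star_starC.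
- by move=> j js; rewrite alpha_starC //; apply: contraNneq i1 => <-.
set kk' := fun j => (kk j - _)%N; set ll' := fun j => (ll j + _)%N.
have h1 j : j != i -> kk j = kk' j by rewrite /kk' => /negPf ->; rewrite subn0.
have h2 j : j != i -> ll j = ll' j by rewrite /ll' => /negPf ->; rewrite sub0n addn0.
have h3 a : a * V (vp A p) = a -> mfac kk ll (a * star (al i)) i = mfac kk' ll' a i.
  move=> ha; rewrite /mfac /kk' /ll' eqxx; case: (kk i) => [|n].
    by rewrite subn0 addn1 mulXS.
  rewrite mulXS -mulgA; have := edge_starl (alpha i); rewrite rng_alpha => ->.
  by rewrite ha !subSS !subn0 sub0n addn0.
rewrite h3; last by apply: mfacs_vert; apply: time_el_vert.
rewrite (mfacs_ext (s := s1) (kk' := kk') (ll' := ll')).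
- by apply: mfacs_ext => j js; [apply: h1|apply: h2]; apply: contraNneq i2 => <-.
- by move=> j js; apply: h1; apply: contraNneq i1 => <-.
- by move=> j js; apply: h2; apply: contraNneq i1 => <-.
Qed.

(** One [alpha i] can be brought to the front, and it is orthogonal to [beta t] because both lie in
    $X_i^{(p)}$. *)
Lemma beta_star_mono0 i (t : 'I_(nbeta i)) d kk ll : (0 < kk i)%N ->
  star (Ed (beta t)) * mono d kk ll = szero.
Proof.
move=> ki.
have -> : mono d kk ll = al i * mono d (fun j => kk j - (j == i))%N ll.
  rewrite alpha_mono; congr mono; apply/funext => j; case: eqP => [->|]; rewrite ?subn0 ?addn0 //.
  by rewrite subn1 addn1 prednK.
rewrite mulgA (edge_orth (sep_cyc i) (cyc_beta t) (cyc_alpha i)) ?mul0s //.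
exact/nesym/alpha_beta.
Qed.

Lemma beta_mfac i (t : 'I_(nbeta i)) j d kk ll : j != i ->
  mfac kk ll (TT (rng (beta t)) d * star (Ed (beta t))) j =
  TT (rng (beta t)) (d + ((kk j)%:Z - (ll j)%:Z) *: 'X^(unbump i j))%R * star (Ed (beta t)).
Proof.
move=> ji; have [h1 h2] := beta_star_alpha t ji; rewrite /mfac.
have -> : forall n d', mulX (TT (rng (beta t)) d' * star (Ed (beta t))) (al j) n =
   TT (rng (beta t)) (d' + n%:Z *: 'X^(unbump i j))%R * star (Ed (beta t)).
  elim=> [|n IH] d'; first by rewrite scale0r addr0.
  by rewrite /= IH -mulgA h1 mulgA -time_elD -addrA -{2}[('X^_)%R]scale1r -scalerDl -PoszD addn1.
have -> : forall n d', mulX (TT (rng (beta t)) d' * star (Ed (beta t))) (star (al j)) n =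
   TT (rng (beta t)) (d' - n%:Z *: 'X^(unbump i j))%R * star (Ed (beta t)).
  elim=> [|n IH] d'; first by rewrite scale0r subr0.
  rewrite /= IH -mulgA h2 mulgA -time_elD -addrA -opprD -{2}[('X^_)%R]scale1r -scalerDl.
  by rewrite -PoszD addn1.
by rewrite -addrA -scalerBl.
Qed.

Lemma beta_mfacs i (t : 'I_(nbeta i)) s d kk ll : i \notin s ->
  foldl (mfac kk ll) (TT (rng (beta t)) d * star (Ed (beta t))) s =
  TT (rng (beta t)) (d + \sum_(j <- s) ((kk j)%:Z - (ll j)%:Z) *: 'X^(unbump i j))%R *
    star (Ed (beta t)).
Proof.
elim: s d => [|j s IH] d /=; first by rewrite big_nil addr0.
rewrite in_cons negb_or eq_sym => /andP[ji si].
by rewrite beta_mfac // IH // big_cons addrA.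
Qed.

Lemma path_el_alpha i l : PE (vp A p) (alpha i :: l) = al i * PE (vp A p) l.
Proof. by have := path_el_cons (alpha i) l; rewrite src_alpha rng_alpha. Qed.

Lemma star_path_el_nseq i n a : a * V (vp A p) = a ->
  mulX a (star (al i)) n = a * star (PE (vp A p) (nseq n (alpha i))).
Proof.
move=> h; elim: n => [|n IH]; first by rewrite /path_el /= vert_star.
by rewrite /= IH -mulgA -starM path_el_alpha.
Qed.

(** By (R8) the factors of other indices become powers of the $t_l$ and produce [cvec], the vector
    $c$ in the definition of $\phi_{\gamma'}$. Of index [i] only starred loops are left, and they
    stay next to $\beta^*$. *)
Lemma beta_star_mono i (t : 'I_(nbeta i)) d kk ll : kk i = 0%N ->
  star (Ed (beta t)) * mono d kk ll =
  TT (rng (beta t)) (trl A (beta t) d + cvec i kk ll)%R *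
    star (PE (vp A p) (rcons (nseq (ll i) (alpha i)) (beta t))).
Proof.
move=> ki; have [s1 [s2 [es i1 i2]]] := ord_split i.
have bd : star (Ed (beta t)) * TT (vp A p) d =
    TT (rng (beta t)) (trl A (beta t) d) * star (Ed (beta t)).
  by have := edge_star_time (beta t) d; rewrite (src_cyc (cyc_beta t)).
rewrite monoE es foldl_cat /= -mfacs_mull -mfac_mull -mfacs_mull bd.
rewrite beta_mfacs // {2}/mfac ki /=.
rewrite star_path_el_nseq; last first.
  by rewrite -mulgA -[V _]vert_star -starM -{1}(src_cyc (cyc_beta t)) vert_edge.
(* The factors after index [i] stand to the right of the powers of $\alpha_i^*$ and have to cross
   them before $\beta^*$ can absorb them. *)
have nseqC (x : S) : x * al i = al i * x ->
    x * V (vp A p) = V (vp A p) * x ->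
    x * PE (vp A p) (nseq (ll i) (alpha i)) = PE (vp A p) (nseq (ll i) (alpha i)) * x.
  move=> h hv; elim: (ll i) => [|n IH] /=; first by rewrite /path_el.
  by rewrite path_el_alpha mulgA h -!mulgA IH.
rewrite mfacs_comm; last first.
- move=> j js; rewrite -!starM; congr star; apply/esym/nseqC; first exact: alphaC.
  by rewrite alpha_vp vp_alpha.
- move=> j js; rewrite -[al j]starK -!starM; congr star; apply/esym/nseqC.
    by rewrite alpha_starC //; apply: contraNneq i2 => ->.
  by rewrite alpha_star_vp vp_alpha_star.
rewrite beta_mfacs // -mulgA; congr (TT _ _ * _).
  rewrite -addrA; congr (_ + _)%R.
  have -> : cvec i kk ll =
    (\sum_(j <- enum 'I_(k p) | j != i) ((kk j)%:Z - (ll j)%:Z) *: 'X^(unbump i j))%R.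
    by rewrite big_enum_cond.
  rewrite es.
  by rewrite big_cat big_cons eqxx /=; congr (_ + _)%R; rewrite -[RHS]big_filter;
    congr (\sum_(j <- _) _)%R; apply/esym/all_filterP/allP => j js;
    [apply: contraNneq i1 => <-|apply: contraNneq i2 => <-].
by rewrite path_el_rcons starM.
Qed.

Definition alphas (l : 'I_(k p) -> nat) : S := mono 0%R l (fun=> 0%N).

Lemma alphas_foldl (l : 'I_(k p) -> nat) s : foldl (fun a j => mulX a (al j) (l j)) (V (vp A p)) s =
  foldl (mfac l (fun=> 0%N)) (V (vp A p)) s.
Proof. by elim: s (V _) => //= j s IH a; exact: IH. Qed.

Lemma alphas_mono (l : 'I_(k p) -> nat) d kk ll : alphas l * mono d kk ll = mono d (fun j => kk j + l j)%N ll.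
Proof.
rewrite /alphas monoE time_el0.
have h n j kk' : iter n (fun a => al j * a) (mono d kk' ll) =
    mono d (fun i => kk' i + n * (i == j))%N ll.
  elim: n => [|n IH] /=; first by congr mono; apply/funext => i; rewrite mul0n addn0.
  by rewrite IH alpha_mono; congr mono; apply/funext => i; rewrite mulSn; lia.
have h' n j a (M : S) : mulX a (al j) n * M = a * iter n (fun a => al j * a) M.
  by elim: n a M => //= n IH a M; rewrite -mulgA IH -iterSr.
(* The induction runs over partial products along arbitrary lists; in the enumeration of all indices
   every count is 1. *)
have -> : forall s kk', foldl (mfac l (fun=> 0%N)) (V (vp A p)) s * mono d kk' ll =
   mono d (fun j => kk' j + l j * count_mem j s)%N ll.
  elim/last_ind => [|s j IH] kk'.
    rewrite /= -time_el0 time_mono add0r; congr mono; apply/funext => i.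
    by rewrite muln0 addn0.
  rewrite foldl_rcons {1}/mfac /= h' h IH; congr mono; apply/funext => i.
  rewrite -cats1 count_cat /= addn0 eq_sym; case: eqP => [->|]; lia.
congr mono; apply/funext => j.
by rewrite count_uniq_mem ?enum_uniq // mem_enum muln1.
Qed.

Lemma alphas_star_mono (l : 'I_(k p) -> nat) d kk ll : star (alphas l) * mono d kk ll =
  mono d (fun j => kk j - l j)%N (fun j => ll j + (l j - kk j))%N.
Proof.
rewrite /alphas monoE time_el0.
have h n j kk' ll' : iter n (fun a => star (al j) * a) (mono d kk' ll') =
    mono d (fun i => kk' i - n * (i == j))%N (fun i => ll' i + (n * (i == j) - kk' i))%N.
  elim: n => [|n IH] /=.
    by congr mono; apply/funext => i; rewrite mul0n ?subn0 // sub0n addn0.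
  by rewrite IH alpha_star_mono; congr mono; apply/funext => i; rewrite mulSn; lia.
have h' n j a (M : S) : star (mulX a (al j) n) * M = iter n (fun a => star (al j) * a) (star a * M).
  by elim: n a M => //= n IH a M; rewrite starM -mulgA IH.
have -> : forall s kk' ll', star (foldl (mfac l (fun=> 0%N)) (V (vp A p)) s) * mono d kk' ll' =
   mono d (fun j => kk' j - l j * count_mem j s)%N (fun j => ll' j + (l j * count_mem j s - kk' j))%N.
  elim/last_ind => [|s j IH] kk' ll'.
    rewrite /= vert_star -time_el0 time_mono add0r.
    by congr mono; apply/funext => i; rewrite muln0 ?subn0 // sub0n addn0.
  rewrite foldl_rcons {1}/mfac /= h' IH h; congr mono; apply/funext => i;
  by rewrite -cats1 count_cat /= addn0 eq_sym; case: eqP => [->|]; lia.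
congr mono; apply/funext => j;
by rewrite count_uniq_mem ?enum_uniq // mem_enum muln1.
Qed.

Lemma vp_alphas (l : 'I_(k p) -> nat) : V (vp A p) * alphas l = alphas l.
Proof. by rewrite -time_el0 time_mono addr0. Qed.

(** With all starred loops collected on the right, the action of a monomial is the composite of
    three simple ones. *)
Lemma monoP d kk ll : mono d kk ll = TT (vp A p) d * alphas kk * star (alphas ll).
Proof.
have -> : star (alphas ll) = star (alphas ll) * mono 0%R (fun=> 0%N) (fun=> 0%N).
  by rewrite mono00 time_el0 -{1}vert_star -starM vp_alphas.
rewrite alphas_star_mono -mulgA alphas_mono time_mono addr0.
by congr mono; apply/funext => j; rewrite ?sub0n ?subn0 ?add0n.
Qed.

Lemma alphas_starl (l : 'I_(k p) -> nat) : star (alphas l) * alphas l = V (vp A p).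
Proof.
rewrite alphas_star_mono -time_el0 -mono00.
by congr mono; apply/funext => j; rewrite ?subnn.
Qed.

Lemma alphas_vp (l : 'I_(k p) -> nat) : alphas l * V (vp A p) = alphas l.
Proof. exact: mono_vert. Qed.

Lemma time_alphas d (l : 'I_(k p) -> nat) : TT (vp A p) d * alphas l = alphas l * TT (vp A p) d.
Proof.
rewrite -(mono00 d) alphas_mono mono00 time_mono addr0.
by congr mono; apply/funext => j; rewrite add0n.
Qed.
End Monomials.
End Algebra.

(** * Local form of the action *)

Section Local.
Variables (E : sep_graph) (A : adaptable E).
Implicit Types (v w : vert E) (e f : edge E) (l gam : seq (edge E)) (p q : tcomp E) (d : Zoo).
Implicit Types (x y z : dpath E) (n : Zoo * Zoo) (L : nat -> nat).

Local Notation k p := (ncyc A p).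
Local Notation S := (SEC A).
Local Notation V := (svert A).
Local Notation Ed := (sedge A).
Local Notation PE := (path_el A).
Local Notation TT := (time_el A).

(** The chosen representative is immaterial: [actS_pi] allows any term for [a], thanks to
    [scong_act]. *)
Definition actS (a : S) x n y : Prop := term_act A (SEC_repr a) x n y.

Lemma actS_pi (a : sterm E) x n y : actS (SEC_pi A a) x n y <-> term_act A a x n y.
Proof. by apply: scong_act; apply/SEC_piP; apply: SEC_reprK. Qed.

Lemma actS_mul (a b : S) x n y : actS (a * b)%g x n y <->
  exists z n1 n2, [/\ actS a x n1 z, actS b z n2 y & n = n1 + n2].
Proof. by rewrite -(SEC_reprK a) -(SEC_reprK b) -SEC_piM !SEC_reprK actS_pi. Qed.

Lemma actS_star (a : S) x n y : actS (star a) x n y <-> actS a y (- n) x.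
Proof. by rewrite -{1}(SEC_reprK a) -SEC_piS actS_pi. Qed.

Lemma actS_starI (a : S) x n y : actS a x n y -> actS (star a) y (- n) x.
Proof. by move=> h; apply/actS_star; rewrite opprK. Qed.

Lemma actS_0 x n y : ~ actS szero x n y.
Proof. by move/actS_pi. Qed.

Lemma actS_vert v x n y : actS (V v) x n y <-> [/\ x = y, n = 0, dvalid A y & dv y = v].
Proof. exact: actS_pi. Qed.

Lemma actS_edge e x n y : actS (Ed e) x n y <-> aedge A e x n y.
Proof. exact: actS_pi. Qed.

Lemma actS_valid (a : S) x n y : actS a x n y -> dvalid A x /\ dvalid A y.
Proof. exact: term_act_valid. Qed.

Lemma actS_fun (a : S) x n y x' n' : actS a x n y -> actS a x' n' y -> x = x' /\ n = n'.
Proof. by move=> /term_act_bij[h _]; apply: h. Qed.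

Lemma actS_inj (a : S) x n y n' y' : actS a x n y -> actS a x n' y' -> y = y' /\ n = n'.
Proof. by move=> /term_act_bij[_ h]; apply: h. Qed.

Lemma actS_time v d x n y : actS (TT v d) x n y <->
  [/\ x = y, n = (dtr A y d, 0), dvalid A y & dv y = v].
Proof.
elim/Zoo_ind: d x n y => [|i b|d d' IH IH'] x n y.
- by rewrite time_el0 dtr0; apply: actS_vert.
- by rewrite time_elX; apply: actS_pi.
rewrite time_elD actS_mul; split.
  by move=> [z [n1 [n2 [/IH[-> -> _ _] /IH'[-> -> vy ey] ->]]]]; rewrite pairD -dtrD addr0.
move=> [-> -> vy ey]; exists y, (dtr A y d, 0), (dtr A y d', 0).
by split; [exact/IH|exact/IH'|rewrite pairD -dtrD addr0].
Qed.

Lemma actS_timeI d y : dvalid A y -> actS (TT (dv y) d) y (dtr A y d, 0) y.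
Proof. by move=> vy; apply/actS_time. Qed.

Lemma tail_path v lam m : tail_ok A v (TReg lam) ->
  is_path (cedge A (comp v)) v (mkseq lam m) /\ path_end v (mkseq lam m) = src (lam m).
Proof.
move=> [_ s0 h]; elim: m => [|m [IH1 IH2]] //.
rewrite mkseqS -cats1 is_path_cat path_end_cat IH2 /=; have [h1 h2] := h m.
by rewrite /path_end /= h2.
Qed.

(* Initial segments of x, of depth L past its c-path: for a free end L j is the
   exponent of alpha(p,j), for a regular end L 0 is the length kept of the tail. *)
Definition dsegpath x L := if dt x is TReg lam then dg x ++ mkseq lam (L 0%N) else dg x.
Definition dsegend x L := path_end (dv x) (dsegpath x L).

Definition dseg x L : S :=
  if dt x is TReg _ then PE (dv x) (dsegpath x L)
  else (PE (dv x) (dg x) * alphas (fun j : 'I_(k (dcomp x)) => L j))%g.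

Definition drest x L : tail E :=
  if dt x is TReg lam then TReg (fun m => lam (L 0%N + m)%N) else TFree E.

(** This is $|\cdot|_\infty$ of the initial segment, as recorded in [seg_data]. *)
Definition dsegdeg x L : Zoo :=
  \sum_(j < ndim A (dcomp x)) (L j + size (dg x))%:Z *: 'X^j.

(* The two initial segments leave the same infinite path, so that they give rise
   to elements of H from y to x with n_2 = d. *)
Definition dmatch x L' (d : Zoo) y L :=
  [/\ dcomp x = dcomp y, dsegend x L' = dsegend y L, drest x L' = drest y L &
      dsegdeg x L' - dsegdeg y L = d].

Lemma dvalid_path x L : dvalid A x -> is_path setT (dv x) (dsegpath x L).
Proof.
move=> [/cpath_is_path c tk]; rewrite /dsegpath; case: (dt x) tk => // lam tk.
by apply/is_path_cat; split=> //; apply: is_path_sub (proj1 (tail_path _ tk)).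
Qed.

Lemma dtr_segpath x L d : dvalid A x -> translate_path A (dsegpath x L) d = dtr A x d.
Proof.
move=> [_]; rewrite /dsegpath /dtr; case: (dt x) => // lam tk.
rewrite translate_path_cat translate_path_nc //.
exact: is_path_connector (proj1 (tail_path _ tk)).
Qed.

Lemma tfree_end x : dvalid A x -> dt x = TFree E -> isfree A (dcomp x) /\ dend x = vp A (dcomp x).
Proof.
by move=> [_ +] e; rewrite e /= => f; split=> //; apply: vp_eq.
Qed.

Lemma treg_comp x lam : dvalid A x -> dt x = TReg lam -> ~~ isfree A (dcomp x).
Proof. by move=> [_ +] e; rewrite e => -[]. Qed.

Lemma dseg_end x L : dvalid A x -> (dseg x L * V (dsegend x L) = dseg x L)%g.
Proof.
move=> vx; rewrite /dseg /dsegend /dsegpath; case e: (dt x) => [|lam]; last exact: path_el_end.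
have [_] := tfree_end vx e; rewrite /dend => ->.
by rewrite -mulgA alphas_vp.
Qed.

Lemma vert_dseg x L : (V (dv x) * dseg x L = dseg x L)%g.
Proof. by rewrite /dseg; case: (dt x) => [|lam]; rewrite ?mulgA vert_path_el. Qed.

Lemma time_dseg x L d : dvalid A x ->
  (TT (dv x) d * dseg x L = dseg x L * TT (dsegend x L) (dtr A x d))%g.
Proof.
move=> vx; have px := dvalid_path L vx.
have := path_el_time A d px; rewrite dtr_segpath //.
rewrite /dseg /dsegend /dsegpath; case e: (dt x) => [|lam] // h.
have [_] := tfree_end vx e; rewrite /dend => h'.
by rewrite mulgA h -!mulgA h' time_alphas.
Qed.

Lemma dmatch_refl x L : dmatch x L 0 x L.
Proof. by split=> //; rewrite subrr. Qed.

Lemma dmatch_sym x L' d y L : dmatch x L' d y L -> dmatch y L (- d) x L'.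
Proof. by move=> [h1 h2 h3 <-]; split=> //; rewrite opprB. Qed.

Lemma dmatch_trans z L1 x L0 d d' y L2 : dmatch x L0 d z L1 -> dmatch z L1 d' y L2 ->
  dmatch x L0 (d + d') y L2.
Proof.
move=> [a1 a2 a3 <-] [b1 b2 b3 <-]; split; rewrite ?a1 ?a2 ?a3 //.
by rewrite addrA subrK.
Qed.

(* Near y the element a is either zero or of the form g t^n h^*, with n and the
   initial segments g and h determined by the degree of its action at y: this is
   what makes the triple of a germ determine the germ. *)
Definition is_local (a : S) := forall y, dvalid A y ->
  (exists x n c, actS a x n y /\ forall L, (forall j, (c <= L j)%N) ->
     exists L', [/\ forall j, (L j <= L' j + c)%N, dmatch x L' n.2 y L &
       (a * dseg y L = dseg x L' * TT (dsegend y L) n.1)%g]) \/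
  (exists c, forall L, (forall j, (c <= L j)%N) -> (a * dseg y L)%g = szero).

(** The clause [L j <= L' j + c] says that [b] shortens segments by at most [c]; above [c + c'] its
    output is therefore still long enough for [a]. *)
Lemma is_local_mul (a b : S) : is_local a -> is_local b -> is_local (a * b)%g.
Proof.
move=> la lb y vy; have [[z [n [c [h H]]]]|[c H]] := lb y vy; last first.
  by right; exists c => L cL; rewrite -mulgA H // muls0.
have [vz _] := actS_valid h.
have [[x [m [c' [h' H']]]]|[c' H']] := la z vz; last first.
  right; exists (c + c')%N => L cL.
  have [j|L' [h1 h2 h3]] := H L; first exact: leq_trans (leq_addr _ _) (cL j).
  rewrite -mulgA h3 mulgA H' ?mul0s // => j.
  by have := leq_trans (cL j) (h1 j); rewrite [leqRHS]addnC leq_add2l.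
left; exists x, (m + n), (c + c')%N; split.
  by apply/actS_mul; exists z, m, n.
move=> L cL; have [j|L' [h1 h2 h3]] := H L; first exact: leq_trans (leq_addr _ _) (cL j).
have [j|L'' [g1 g2 g3]] := H' L'.
  by have := leq_trans (cL j) (h1 j); rewrite [leqRHS]addnC leq_add2l.
exists L''; split.
- by move=> j; have := h1 j; have := g1 j; lia.
- exact: dmatch_trans h2.
rewrite -mulgA h3 mulgA g3 -mulgA; congr (_ * _)%g.
by case: h2 => _ -> _ _; rewrite -time_elD.
Qed.

Lemma is_local0 : is_local szero.
Proof. by move=> y vy; right; exists 0%N => L _; rewrite mul0s. Qed.

Lemma vert_dseg0 v y L : dv y <> v -> (V v * dseg y L)%g = szero.
Proof. by move=> h; rewrite -vert_dseg mulgA vert_orth ?mul0s //; apply/nesym. Qed.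

Lemma is_local_time v d : is_local (TT v d).
Proof.
move=> y vy; have [ey|ny] := pselect (dv y = v); last first.
  by right; exists 0%N => L _; rewrite -time_el_vert -mulgA vert_dseg0 // muls0.
left; exists y, (dtr A y d, 0), 0%N; split; first exact/actS_time.
move=> L _; exists L; split=> [j||]; first by rewrite addn0.
- exact: dmatch_refl.
- by rewrite -ey time_dseg.
Qed.

Lemma is_local_vert v : is_local (V v).
Proof. by rewrite -time_el0; apply: is_local_time. Qed.

Lemma mkseq_cons (e : edge E) lam m :
  mkseq (fun i : nat => if i is i'.+1 then lam i' else e) m.+1 = e :: mkseq lam m.
Proof. by rewrite /mkseq /= -add1n iotaDl -map_comp. Qed.

(** The shift [c] is 1 when [e] joins the tail, where the new edge is counted by [L], and 0 when [e]
    enters the c-path, whose length [L] does not count. *)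
Lemma dseg_dcons e y : nonalpha A e -> dvalid A y -> dv y = rng e ->
  exists c : nat, (c <= 1)%N /\ forall L,
    (Ed e * dseg y L = dseg (dcons e y) (fun j => L j + c)%N)%g /\
    dmatch (dcons e y) (fun j => L j + c)%N (dunit A (dcomp y)) y L.
Proof.
move=> na vy ey; have dc := dcomp_dcons na vy ey.
have [h|/not_orP[/contrapT gy /not_orP[/negP ce _]]] :=
    pselect (dg y <> [::] \/ connector e \/ dt y = @TFree E).
  have deg L : dsegdeg (dcons e y) L - dsegdeg y L = dunit A (dcomp y).
    rewrite /dsegdeg dc dcons_nonreg // -sumrB; apply: eq_bigr => j _ /=.
    rewrite -scalerBl.
    have -> : (L j + (size (dg y)).+1)%:Z - (L j + size (dg y))%:Z = 1 by lia.
    by rewrite scale1r.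
  exists 0%N; split=> // L; have -> : (fun j => (L j + 0)%N) = L.
    by apply/funext => j; rewrite addn0.
  rewrite /dmatch deg dc /dseg /dsegend /drest; split.
    rewrite /dsegpath dcons_nonreg //=; case: (dt y) => [|lam].
      rewrite path_el_cons -mulgA ey; congr (_ * (_ * _))%g.
      by rewrite /dcomp /dend /= /path_end /= -ey.
    by rewrite path_el_cons ey.
  by rewrite /dsegpath dcons_nonreg //=; split=> //; rewrite /path_end ey; case: (dt y).
have [lam ly] := nonalpha_tail na vy ey gy ce.
have rc := treg_comp vy ly.
exists 1%N; split=> // L.
rewrite /dmatch /dsegdeg dc (dcons_reg gy ce ly) /dseg /dsegend /dsegpath /drest ly gy /=.
rewrite addn1 mkseq_cons ey path_el_cons; split=> //; split=> //.
rewrite /ndim /dunit /ndim (negPf rc) !big_ord1 -scalerBl !addn0.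
by rewrite (_ : _ - _ = 1) ?scale1r //; lia.
Qed.

(** The edge [e] can be removed only from a segment that contains it, whence the bound 1 on the
    [L j]. *)
Lemma dseg_dcons_pred e y L : nonalpha A e -> dvalid A y -> dv y = rng e ->
  (forall j, (1 <= L j)%N) -> exists L', [/\ forall j, (L j <= L' j + 1)%N,
    (Ed e * dseg y L' = dseg (dcons e y) L)%g & dmatch (dcons e y) L (dunit A (dcomp y)) y L'].
Proof.
move=> na vy ey hL; have [c [c1 H]] := dseg_dcons na vy ey.
have [h1 h2] := H (fun j => L j - c)%N.
have e1 : (fun j => (L j - c + c)%N) = L.
  by apply/funext => j; rewrite subnK // (leq_trans c1).
rewrite e1 in h1 h2; exists (fun j => L j - c)%N; split=> // j.
by have := hL j; lia.
Qed.

Lemma is_local_na e : nonalpha A e -> is_local (Ed e).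
Proof.
move=> na y vy; have [ey|ny] := pselect (dv y = rng e); last first.
  by right; exists 0%N => L _; rewrite -edge_vert -mulgA vert_dseg0 // muls0.
have [c [c1 H]] := dseg_dcons na vy ey.
left; exists (dcons e y), (0, dunit A (dcomp y)), 1%N; split.
  by apply/actS_edge; apply: ae_cons.
move=> L _; have [h1 h2] := H L; exists (fun j => L j + c)%N; split=> //.
  by move=> j; rewrite -addnA leq_addr.
rewrite h1 time_el0; case: (h2) => _ <- _ _; rewrite dseg_end //.
exact: dvalid_dcons.
Qed.

Lemma is_local_na_star e y : nonalpha A e -> dvalid A y -> dv y = rng e ->
  (exists x n c, actS (star (Ed e)) x n (dcons e y) /\ forall L, (forall j, (c <= L j)%N) ->
     exists L', [/\ forall j, (L j <= L' j + c)%N, dmatch x L' n.2 (dcons e y) L &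
       (star (Ed e) * dseg (dcons e y) L = dseg x L' * TT (dsegend (dcons e y) L) n.1)%g]).
Proof.
move=> na vy ey; exists y, (0, - dunit A (dcomp y)), 1%N; split.
  by apply/actS_star; rewrite pairN opprK oppr0; apply/actS_edge; apply: ae_cons.
move=> L /(dseg_dcons_pred na vy ey)[L' [h0 h1 h2]]; exists L'; split=> //.
  exact: dmatch_sym.
rewrite -h1 mulgA edge_starl -ey vert_dseg time_el0.
by case: h2 => _ -> _ _; rewrite dseg_end.
Qed.

Lemma reg_head y : dvalid A y -> ~~ isfree A (comp (dv y)) ->
  exists f z, [/\ nonalpha A f, dvalid A z, dv z = rng f, y = dcons f z & src f = dv y].
Proof.
case: y => v g t [/= c tk] r; have [g0|[f [g' [gE sf c' h]]]] := cpath_reg_inv r c.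
  subst g; have [lam tE] := tail_reg r tk; subst t; case: (tk) => [_ s0 H].
  have [ce r0] := H 0%N; exists (lam 0%N), (DPath (rng (lam 0%N)) [::] (TReg (fun m => lam m.+1))).
  have cc := connector_cedge ce; have [_ cr] := cedge_sub ce.
  split=> //.
  - by apply: nonalpha_reg; rewrite s0.
  - split; first exact: cpath_nil.
    by split; rewrite /dend /path_end /= ?cr // => m; apply: H.
  rewrite /dcons /= cc s0 /=; congr (DPath _ _ (TReg _)).
  by apply/funext => -[].
have naf : nonalpha A f by apply: nonalpha_reg; rewrite sf.
exists f, (DPath (rng f) g' t); split=> //.
  by split=> //; move: tk; rewrite /dend /= gE /path_end /=.
rewrite dcons_nonreg /= ?sf ?gE //; case: h => [cf|[_ gn]]; [by right; left|by left].
Qed.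

Lemma PE_block p (i : 'I_(k p)) (t : 'I_(nbeta i)) m gam :
  PE (vp A p) (nseq m (alpha i) ++ beta t :: gam) =
  (iter m (fun a => Ed (alpha i) * a) (Ed (beta t) * PE (rng (beta t)) gam))%g.
Proof.
elim: m => [|m IH] /=; last by rewrite path_el_alpha IH.
by rewrite -{1}(src_cyc (cyc_beta t)) path_el_cons.
Qed.

(** A loop of the same index is orthogonal to [beta s] by (R2). Past loops of another index
    $\beta^*$ moves, leaving a $t_l$ behind, until it meets a different [beta] and (R4) applies. *)
Lemma beta_star_block p (i j : 'I_(k p)) (s : 'I_(nbeta i)) (t : 'I_(nbeta j)) m gam :
  (beta s <> beta t \/ (0 < m)%N) ->
  (star (Ed (beta s)) * PE (vp A p) (nseq m (alpha j) ++ beta t :: gam))%g = szero.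
Proof.
rewrite PE_block; elim: m => [|m IH] /= h.
  by rewrite mulgA beta_orth ?mul0s //; case: h.
rewrite mulgA; have [ij|ji] := eqVneq j i.
  subst j; rewrite (edge_orth A (sep_cyc i) (cyc_beta s) (cyc_alpha i)) ?mul0s //.
  exact/nesym/alpha_beta.
rewrite (beta_star_alpha s ji).1 -mulgA IH ?muls0 //; left => e.
have := cyc_beta s; rewrite e => /(cyc_inj (cyc_beta t)) ji'.
by rewrite ji' eqxx in ji.
Qed.

Lemma alpha_skip p (i j : 'I_(k p)) (t : 'I_(nbeta j)) m gam : i != j ->
  is_path setT (rng (beta t)) gam ->
  let d := translate_path A gam 'X^(unbump j i) in
  let g := PE (vp A p) (nseq m (alpha j) ++ beta t :: gam) in
  (Ed (alpha i) * g = g * TT (path_end (rng (beta t)) gam) d)%g /\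
  (star (Ed (alpha i)) * g = g * TT (path_end (rng (beta t)) gam) (- d))%g.
Proof.
move=> ij pg /=; rewrite PE_block; have [h1 h2] := alpha_beta_comm t ij.
elim: m => [|m [IH1 IH2]] /=.
  by rewrite !mulgA h1 h2 -!mulgA !(path_el_time A _ pg) -translate_pathN.
by rewrite !mulgA alphaC -alpha_starC 1?eq_sym // -!mulgA IH1 IH2.
Qed.

(** The factor [c] holds the loops at a free end, or just the end vertex. Since it commutes with the
    $t_i$, a power of $t$ that has crossed the path part also reaches the end of the segment. *)
Lemma dseg_block p (i : 'I_(k p)) m (t : 'I_(nbeta i)) z L : dvalid A z -> dv z = rng (beta t) ->
  exists c, dsegend (dblock m t z) L = dsegend z L /\
    dseg (dblock m t z) L =
      (PE (vp A p) (nseq m (alpha i) ++ beta t :: dsegpath z L) * c)%g /\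
    (forall d, (TT (dsegend z L) d * c = c * TT (dsegend z L) d)%g).
Proof.
move=> vz ez; have de : dsegend (dblock m t z) L = dsegend z L.
  rewrite /dsegend /dsegpath /=; case: (dt z) => [|lam]; rewrite -?catA path_end_cat /= /path_end /=;
    by rewrite ez.
case tz: (dt z) => [|lam].
  exists (alphas (fun j : 'I_(k (dcomp z)) => L j)); split=> //; split.
    by rewrite /dseg /= /dsegpath tz dcomp_block.
  move=> d; have [_] := tfree_end vz tz; rewrite /dend /dsegend /dsegpath tz => ->.
  exact: time_alphas.
exists (V (dsegend z L)); split=> //; split.
  rewrite -de -dseg_end; last exact: dvalid_block.
  by rewrite /dseg /dsegpath /= tz -catA.
by move=> d; rewrite vert_time_el time_el_vert.
Qed.

Lemma alpha_dseg_block p (i j : 'I_(k p)) m (t : 'I_(nbeta j)) z L :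
  i != j -> dvalid A z -> dv z = rng (beta t) ->
  let y := dblock m t z in
  (Ed (alpha i) * dseg y L = dseg y L * TT (dsegend y L) (dtr A z 'X^(unbump j i)))%g /\
  (star (Ed (alpha i)) * dseg y L = dseg y L * TT (dsegend y L) (- dtr A z 'X^(unbump j i)))%g.
Proof.
move=> ij vz ez /=; have [c [-> [-> h]]] := dseg_block m L vz ez.
have pz : is_path setT (rng (beta t)) (dsegpath z L) by rewrite -ez; apply: dvalid_path.
have [h1 h2] := alpha_skip m ij pz.
by rewrite !mulgA h1 h2 -!mulgA -ez -/(dsegend z L) dtr_segpath // !h.
Qed.

Lemma alpha_dseg_same p (i : 'I_(k p)) m (t : 'I_(nbeta i)) z L :
  dvalid A z -> dv z = rng (beta t) ->
  (Ed (alpha i) * dseg (dblock m t z) L = dseg (dblock m.+1 t z) L)%g /\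
  dmatch (dblock m.+1 t z) L (dunit A (dcomp z)) (dblock m t z) L.
Proof.
move=> vz ez; split.
  rewrite /dseg /dsegpath /= !dcomp_block //.
  by case: (dt z) => [|lam]; rewrite path_el_alpha ?mulgA.
have [_ [e1 _]] := dseg_block m L vz ez; have [_ [e2 _]] := dseg_block m.+1 L vz ez.
split; rewrite ?dcomp_block ?e1 ?e2 //.
rewrite /dsegdeg !dcomp_block // -sumrB; apply: eq_bigr => j _ /=.
by rewrite -scalerBl (_ : _ - _ = 1) ?scale1r //; lia.
Qed.

Lemma dcomp_pure p : isfree A p -> dcomp (dpure A p) = p.
Proof. by move=> f; rewrite /dcomp /dend /= comp_vp. Qed.

Lemma dseg_pure p L : isfree A p -> dseg (dpure A p) L = alphas (fun j : 'I_(k p) => L j).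
Proof.
move=> f; rewrite /dseg /=; move: (dcomp_pure f); move: (dcomp _) => q ->.
exact: vp_alphas.
Qed.

Lemma dsegdeg_pure p L : isfree A p -> dsegdeg (dpure A p) L = \sum_(j < k p) (L j)%:Z *: 'X^j.
Proof.
move=> f; rewrite /dsegdeg dcomp_pure // /ndim f; apply: eq_bigr => j _.
by rewrite addn0.
Qed.

(** Here the path stays the same but its segment grows by one loop, which is what the degree $X^i$
    records. *)
Lemma alpha_dseg_pure p (i : 'I_(k p)) L (L' := fun j => (L j + (j == i))%N) :
  (Ed (alpha i) * dseg (dpure A p) L = dseg (dpure A p) L')%g /\
  dmatch (dpure A p) L' 'X^i (dpure A p) L.
Proof.
have f := ord_free i; rewrite !dseg_pure // alpha_mono; split=> //; split=> //.
rewrite !dsegdeg_pure // -sumrB (bigD1 i) //= big1 ?addr0 => [|j ji].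
  by rewrite /L' eqxx -scalerBl (_ : _ - _ = 1) ?scale1r //; lia.
by rewrite /L' (_ : (j == i :> nat) = false) ?addn0 ?subrr //; apply/negbTE.
Qed.

Lemma is_local_alpha p (i : 'I_(k p)) : is_local (Ed (alpha i)).
Proof.
have f := ord_free i; move=> y vy.
have [ey|ny] := pselect (dv y = vp A p); last first.
  by right; exists 0%N => L _; rewrite -edge_vert rng_alpha -mulgA vert_dseg0 // muls0.
left; have [yE|[j [t [m [z [vz ez yE]]]]]] := dfree_inv f ey vy; subst y.
  exists (dpure A p), (0, 'X^i), 0%N; split; first by apply/actS_edge; apply: ae_pure.
  move=> L _; have [h1 h2] := alpha_dseg_pure i L.
  exists (fun j => L j + (j == i))%N; split=> //; first by move=> j; lia.
  by rewrite h1 time_el0 dseg_end.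
exists (dblock ((j == i) + m) t z), (adeg i j z), 0%N; split.
  by apply/actS_edge; apply: ae_block.
move=> L _; exists L; split; first by move=> j'; rewrite addn0.
  have [ji|ji] := eqVneq j i; rewrite /adeg; last by rewrite (negPf ji); apply: dmatch_refl.
  by subst j; rewrite eqxx; case: (alpha_dseg_same m L vz ez).
have [ji|ji] := eqVneq j i; rewrite /adeg.
  subst j; rewrite eqxx time_el0; have [-> [_ <- _ _]] := alpha_dseg_same m L vz ez.
  by rewrite dseg_end //; apply: dvalid_block.
rewrite (negPf ji); rewrite eq_sym in ji.
by have [-> _] := alpha_dseg_block m L ji vz ez.
Qed.

Lemma is_local_alpha_star p (i : 'I_(k p)) : is_local (star (Ed (alpha i))).
Proof.
have f := ord_free i; move=> y vy.
have [ey|ny] := pselect (dv y = vp A p); last first.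
  by right; exists 0%N => L _; rewrite -alpha_star_vp -mulgA vert_dseg0 // muls0.
have ss L z : dv z = vp A p -> (star (Ed (alpha i)) * (Ed (alpha i) * dseg z L) = dseg z L)%g.
  by move=> ez; rewrite mulgA edge_starl rng_alpha -ez vert_dseg.
have [yE|[j [t [m [z [vz ez yE]]]]]] := dfree_inv f ey vy; subst y.
  (* The threshold 1 guarantees that the segment contains a loop [alpha i] to remove. *)
  left; exists (dpure A p), (0, - 'X^i), 1%N; split.
    by apply/actS_star/actS_edge; rewrite pairN oppr0 opprK; apply: ae_pure.
  move=> L hL; have [h1 h2] := alpha_dseg_pure i (fun j => L j - (j == i))%N.
  have e1 : (fun j => L j - (j == i) + (j == i))%N = L.
    by apply/funext => j; rewrite subnK // (leq_trans _ (hL j)) // leq_b1.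
  rewrite e1 in h1 h2; exists (fun j => L j - (j == i))%N; split.
  - by move=> j; have := hL j; case: (j == i) => /=; lia.
  - exact: dmatch_sym.
  by rewrite -h1 ss // time_el0 dseg_end.
have [ji|ji] := eqVneq j i.
  subst j; case: m vy ey => [|m] vy ey.
    right; exists 0%N => L _; have [c [_ [-> _]]] := dseg_block 0 L vz ez.
    rewrite mulgA PE_block /= (mulgA _ (Ed _)).
    rewrite (edge_orth A (sep_cyc i) (cyc_alpha i) (cyc_beta t)) ?mul0s //.
    exact: alpha_beta.
  left; exists (dblock m t z), (- adeg i i z), 0%N; split.
    apply/actS_star/actS_edge; rewrite opprK.
    by have := @ae_block _ A _ p i i m t z erefl vz ez; rewrite eqxx.
  move=> L _; have [h1 h2] := alpha_dseg_same m L vz ez.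
  exists L; split; first by move=> j; rewrite addn0.
    by rewrite /adeg eqxx; apply: dmatch_sym.
  rewrite -h1 ss // /adeg eqxx /= oppr0 time_el0.
  by case: (h2) => _ -> _ _; rewrite dseg_end //; apply: dvalid_block.
left; exists (dblock m t z), (- adeg i j z), 0%N; split.
  apply/actS_star/actS_edge; rewrite opprK.
  by have := @ae_block _ A _ p i j m t z erefl vz ez; rewrite (negPf ji).
move=> L _; exists L; split; first by move=> j'; rewrite addn0.
  by rewrite /adeg (negPf ji) /= oppr0; apply: dmatch_refl.
rewrite /adeg (negPf ji); rewrite eq_sym in ji.
by have [_ ->] := alpha_dseg_block m L ji vz ez.
Qed.

Lemma is_local_star_na e : nonalpha A e -> is_local (star (Ed e)).
Proof.
move=> na y vy; have [ey|ny] := pselect (dv y = src e); last first.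
  right; exists 0%N => L _.
  by rewrite -vert_edge starM vert_star -mulgA vert_dseg0 // muls0.
have [r|[p [i [t et]]]] := nonalphaP na.
  have [||f [z [naf vz ez yE sf]]] := reg_head (y := y) => //; first by rewrite ey.
  have [ef|ef] := pselect (f = e).
    by left; subst f; rewrite yE; apply: is_local_na_star.
  right; exists 1%N => L /(dseg_dcons_pred naf vz ez)[L' [_ h _]]; rewrite yE -h mulgA.
  by rewrite edge_orth_reg ?mul0s ?sf //; apply/nesym.
rewrite et (src_cyc (cyc_beta t)) in ey; subst e.
have [yE|[j [s [m [z [vz ez yE]]]]]] := dfree_inv (ord_free i) ey vy; subst y.
  (* From length 1 on the segment contains [alpha i], to which [beta t] is orthogonal. *)
  right; exists 1%N => L hL; rewrite dseg_pure; last exact: ord_free i.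
  exact: beta_star_mono0.
have [[bs ->]|h] := pselect (beta s = beta t /\ m = 0%N).
  left; rewrite -dcons_beta bs; apply: is_local_na_star => //.
  by rewrite -bs.
right; exists 0%N => L hL; have [c [_ [-> _]]] := dseg_block m L vz ez.
rewrite mulgA beta_star_block ?mul0s //.
have [bs|] := pselect (beta s = beta t); [right|by left; apply/nesym].
by case: m h {vy ey} => // h; case: h.
Qed.

(** Locality of an element gives no direct access to its adjoint, so [star a] is carried through the
    induction on generators. *)
Lemma is_localP (a : S) : is_local a.
Proof.
suff [] : is_local a /\ is_local (star a) by [].
elim/sec_ind: a => [|v|e|v i b|a b [a1 a2] [b1 b2]|a [a1 a2]].
- by rewrite star0; split; apply: is_local0.
- by rewrite vert_star; split; apply: is_local_vert.
- have [na|/existsNP[p /existsNP[i /contrapT ->]]] := pselect (nonalpha A e).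
    by split; [apply: is_local_na|apply: is_local_star_na].
  by split; [apply: is_local_alpha|apply: is_local_alpha_star].
- by rewrite time_star -!time_elX; split; apply: is_local_time.
- by rewrite starM; split; apply: is_local_mul.
- by rewrite starK; split.
Qed.

End Local.

(** * Existence of normal forms *)

Section NormalForms.
Variables (E : sep_graph) (A : adaptable E).
Implicit Types (v w u : vert E) (e f : edge E) (l gam nu : seq (edge E)) (p q : tcomp E) (d : Zoo).
Implicit Types (m : monomial A).
Local Open Scope group_scope.

Local Notation k p := (ncyc A p).
Local Notation S := (SEC A).
Local Notation V := (svert A).
Local Notation Ed := (sedge A).
Local Notation PE := (path_el A).
Local Notation TT := (time_el A).

Definition has_nf (s : S) := s = szero \/ exists v gam m w nu,
  is_normal_form v gam m w nu /\ s = normal_form_el v gam m w nu.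

Lemma path_el_star_cat w nu l : star (PE (path_end w nu) l) * star (PE w nu) =
  star (PE w (nu ++ l)).
Proof. by rewrite -starM path_el_cat. Qed.

(** The middle monomial is $t^d$ alone, read as a free or as a regular monomial according to [v]. *)
Lemma nf_time v d w nu : cpath A w nu -> path_end w nu = v ->
  has_nf (TT v d * star (PE w nu)).
Proof.
move=> c e; right; case: (boolP (isfree A (comp v))) => f.
  have vE := vp_eq f erefl.
  exists v, [::], (MFree d (fun _ : 'I_(k (comp v)) => 0%N) (fun=> 0%N)), w, nu; split.
    by split=> //; [apply: cpath_nil | rewrite e].
  have := mono00 A (comp v) d; rewrite -vE /mono /normal_form_el => ->.
  by rewrite vert_time_el.
exists v, [::], (MReg A v [::] v [::] d), w, nu; split.
  by split=> //; apply: cpath_nil.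
by rewrite /normal_form_el /= /path_el /= vert_star !time_el_vert vert_time_el.
Qed.

Lemma time_monomial m d : monomial_ok m ->
  exists m', [/\ monomial_ok m', mleft m' = mleft m, mright m' = mright m &
    TT (mleft m) d * monomial_el m = monomial_el m'].
Proof.
case: m => [p d' kk ll|a lam b eta d'] ok.
  by exists (MFree (d + d')%R kk ll); split=> //; apply: time_mono.
exists (MReg A a lam b eta (d + d')%R); split=> //.
by rewrite /= !mulgA -time_elD.
Qed.

Lemma nf_free_nil p d (kk ll : 'I_(k p) -> nat) w nu :
  normal_form_el (vp A p) [::] (MFree d kk ll) w nu = mono d kk ll * star (PE w nu).
Proof.
rewrite /normal_form_el -/(mono d kk ll); congr (_ * _).
have := time_mono 0%R d kk ll; rewrite time_el0 add0r; exact.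
Qed.

Lemma nf_reg_nil v lam b eta d w nu :
  normal_form_el v [::] (MReg A v lam b eta d) w nu =
  TT v d * PE v lam * star (PE b eta) * star (PE w nu).
Proof. by rewrite /normal_form_el /monomial_el {1}/path_el /= !mulgA vert_time_el. Qed.

(** A power of $t$ that has travelled through the c-path is absorbed by the exponents of the
    monomial. *)
Lemma has_nf_time_cpath v gam m w nu d : is_normal_form v gam m w nu ->
  has_nf (PE v gam * TT (path_end v gam) d * monomial_el m * star (PE w nu)).
Proof.
move=> [c c' ok e1 e2]; have [m' [ok' e3 e4 h]] := time_monomial d ok.
right; exists v, gam, m', w, nu; split; first by split; rewrite ?e3 ?e4.
by rewrite /normal_form_el -h -e1 !mulgA.
Qed.

Lemma vert_nf0 u v gam m w nu : u <> v -> V u * normal_form_el v gam m w nu = szero.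
Proof.
by move=> uv; rewrite /normal_form_el -(vert_path_el A v gam) !mulgA vert_orth // !mul0s.
Qed.

Definition nf_stable (a : S) := forall s, has_nf s -> has_nf (a * s).

Lemma nf_stable_mul (a b : S) : nf_stable a -> nf_stable b -> nf_stable (a * b).
Proof. by move=> la lb s /lb /la; rewrite mulgA. Qed.

Lemma nf_stable_intro (a : S) : (forall v gam m w nu, is_normal_form v gam m w nu ->
  has_nf (a * normal_form_el v gam m w nu)) -> nf_stable a.
Proof.
move=> h s [->|[v [gam [m [w [nu [n ->]]]]]]]; last exact: h.
by left; rewrite muls0.
Qed.

Lemma nf_stable_start (a : S) u : a * V u = a -> (forall gam m w nu, is_normal_form u gam m w nu ->
  has_nf (a * normal_form_el u gam m w nu)) -> nf_stable a.
Proof.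
move=> e h; apply: nf_stable_intro => v gam m w nu n; have [uv|uv] := pselect (u = v).
  by subst u; apply: h.
by left; rewrite -e -mulgA vert_nf0 // muls0.
Qed.

Lemma nf_stable_time u d : nf_stable (TT u d).
Proof.
apply: (@nf_stable_start _ u); first exact: time_el_vert.
move=> gam m w nu n; rewrite /normal_form_el !mulgA.
have [c _ _ _ _] := n; rewrite (path_el_time A _ (cpath_is_path c)).
exact: has_nf_time_cpath.
Qed.

Lemma mleft_free p m : isfree A p -> monomial_ok m -> mleft m = vp A p ->
  exists d kk ll, m = MFree (p := p) d kk ll.
Proof.
case: m => [q d kk ll|a lam b eta d] f /= ok e.
  have pq : q = p by rewrite -(comp_vp ok) -(comp_vp f) e.
  by subst q; exists d, kk, ll.
by case: ok => -[]; rewrite e comp_vp // f.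
Qed.

Lemma mleft_reg v m : ~~ isfree A (comp v) -> monomial_ok m -> mleft m = v ->
  exists lam b eta d, m = MReg A v lam b eta d.
Proof.
case: m => [q d kk ll|a lam b eta d] r /= ok e.
  by move: r; rewrite -e comp_vp // ok.
by exists lam, b, eta, d; rewrite e.
Qed.

Lemma nf_stable_na e : nonalpha A e -> nf_stable (Ed e).
Proof.
move=> na; apply: (@nf_stable_start _ (rng e)); first exact: edge_vert.
move=> gam m w nu [c c' ok e1 e2].
have [h|] := pselect (connector e \/ gam <> [::]).
  right; exists (src e), (e :: gam), m, w, nu; split.
    split=> //; case: (boolP (connector e)) => ce; first exact: cpath_connector.
    case: h => [h|gn]; first by rewrite h in ce.
    by have [r ed _] := nonalpha_cedge na ce; apply: cpath_cedge.
  by rewrite /normal_form_el path_el_cons !mulgA.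
(* An edge of $E_p$ before an empty c-path does not form a c-path; it becomes the head of [lam]. *)
move=> /not_orP[/negP ce /contrapT g0]; subst gam.
have [r ed re] := nonalpha_cedge na ce.
have [|lam [b [eta [d mE]]]] := mleft_reg _ ok (esym e1); first by rewrite /path_end /= re.
rewrite /path_end /= in e1 e2 mE; subst m; move: ok => /= [[r' cb] pl pe el].
right; exists (src e), [::], (MReg A (src e) (e :: lam) b eta d), w, nu; split.
  split=> //; [exact: cpath_nil|].
  by rewrite re in pl pe cb; split; [split|split| |].
by rewrite !nf_reg_nil path_el_cons !mulgA time_el_edge trl_reg.
Qed.

Lemma nf_stable_alpha p (i : 'I_(k p)) : nf_stable (Ed (alpha i)) /\ nf_stable (star (Ed (alpha i))).
Proof.
have f := ord_free i; split; apply: (@nf_stable_start _ (vp A p)); [exact: alpha_vp| |exact: alpha_star_vp|];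
  move=> gam m w nu n; have [c c' ok e1 e2] := n;
  have [g0|[j [t [r [g [gE cg]]]]]] := cpath_free_inv f c.
- subst gam; have [d [kk [ll mE]]] := mleft_free f ok (esym e1); subst m.
  right; exists (vp A p), [::], (MFree d (fun j => kk j + (j == i))%N ll), w, nu; split=> //.
  by rewrite !nf_free_nil mulgA alpha_mono.
- have [ij|ij] := eqVneq i j.
    subst j; right; exists (vp A p), (alpha i :: gam), m, w, nu; split.
      split=> //; first by rewrite gE; apply: (cpath_block r.+1).
      by rewrite -e1 /path_end /= rng_alpha gE; case: (r).
    by rewrite /normal_form_el path_el_alpha !mulgA.
  have [h _] := alpha_skip r ij (cpath_is_path cg).
  rewrite /normal_form_el !mulgA {1}gE h -gE.
  have <- : path_end (vp A p) gam = path_end (rng (beta t)) g.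
    by rewrite gE path_end_cat.
  exact: has_nf_time_cpath.
- subst gam; have [d [kk [ll mE]]] := mleft_free f ok (esym e1); subst m.
  right; exists (vp A p), [::], (MFree d (fun j => kk j - (j == i))%N
    (fun j => ll j + ((j == i) - kk j))%N), w, nu; split=> //.
  by rewrite !nf_free_nil mulgA alpha_star_mono.
- have [ij|ij] := eqVneq i j.
    subst j; case: r gE => [|r] gE.
      left; rewrite /normal_form_el gE /= -{1}(src_cyc (cyc_beta t)) path_el_cons !mulgA.
      rewrite (edge_orth A (sep_cyc i) (cyc_alpha i) (cyc_beta t)) ?mul0s //.
      exact: alpha_beta.
    right; exists (vp A p), (nseq r (alpha i) ++ beta t :: g), m, w, nu; split.
      split=> //; first exact: cpath_block.
      by rewrite -e1 gE /path_end /= rng_alpha; case: (r).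
    by rewrite /normal_form_el gE /= path_el_alpha !mulgA edge_starl rng_alpha vert_path_el.
  have [_ h] := alpha_skip r ij (cpath_is_path cg).
  rewrite /normal_form_el !mulgA {1}gE h -gE.
  have <- : path_end (vp A p) gam = path_end (rng (beta t)) g.
    by rewrite gE path_end_cat.
  exact: has_nf_time_cpath.
Qed.

Lemma nf_stable_star_beta p (i : 'I_(k p)) (t : 'I_(nbeta i)) : nf_stable (star (Ed (beta t))).
Proof.
have f := ord_free i; have sb := src_cyc (cyc_beta t).
apply: (@nf_stable_start _ (vp A p)).
  by rewrite -sb -{1}vert_star -starM vert_edge.
move=> gam m w nu n; have [c c' ok e1 e2] := n.
have [g0|[j [s [r [g [gE cg]]]]]] := cpath_free_inv f c.
  subst gam; have [d [kk [ll mE]]] := mleft_free f ok (esym e1); subst m.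
  rewrite nf_free_nil mulgA; have [ki|ki] := posnP (kk i); last by left; rewrite beta_star_mono0 ?mul0s.
  (* The monomial sinks to the range of [beta t]: the remaining $\alpha^*$ and $\beta^*$ extend
     [nu], and only a power of $t$ stays in the middle. *)
  rewrite /= in e2; rewrite beta_star_mono // -mulgA -e2 path_el_star_cat.
  apply: nf_time; last by rewrite path_end_cat path_end_rcons.
  apply: cpath_cat => //; rewrite e2 -cats1; apply: cpath_block; exact: cpath_nil.
have [[bs r0]|h] := pselect (beta t = beta s /\ r = 0%N).
  subst r; right; exists (rng (beta s)), g, m, w, nu; split.
    by split=> //; rewrite -e1 gE.
  rewrite /normal_form_el gE /= bs -{1}(src_cyc (cyc_beta s)) path_el_cons !mulgA edge_starl.
  by rewrite vert_path_el.
left; rewrite /normal_form_el gE !mulgA beta_star_block ?mul0s //.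
have [bs|] := pselect (beta t = beta s); [right|by left].
by case: r h gE => // h; case: h.
Qed.

Lemma nf_stable_star_reg e : ~~ isfree A (comp (src e)) -> nf_stable (star (Ed e)).
Proof.
move=> r; apply: (@nf_stable_start _ (src e)).
  by rewrite -{1}vert_star -starM vert_edge.
move=> gam m w nu n; have [c c' ok e1 e2] := n.
have [g0|[f [g [gE sf cg _]]]] := cpath_reg_inv r c; last first.
  have [fe|fe] := pselect (e = f); last first.
    left; rewrite /normal_form_el gE -{1}sf path_el_cons !mulgA edge_orth_reg //.
    by rewrite !mul0s.
  subst f; right; exists (rng e), g, m, w, nu; split; first by split=> //; rewrite -e1 gE.
  by rewrite /normal_form_el gE path_el_cons !mulgA edge_starl vert_path_el.
subst gam; have [lam [b [eta [d mE]]]] := mleft_reg r ok (esym e1); subst m.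
move: ok => /= [[_ cb] pl pe el]; rewrite /= in e2.
rewrite nf_reg_nil !mulgA edge_star_time trl_reg //.
case: lam pl el {n e1 c} => [|f lam] /=.
  move=> _ el; rewrite /path_end /= in el; rewrite {1}/path_el /=.
  have -> : TT (rng e) d * star (Ed e) * V (src e) = TT (rng e) d * star (Ed e).
    by rewrite -mulgA -{1}vert_star -starM vert_edge.
  have -> : TT (rng e) d * star (Ed e) * star (PE b eta) * star (PE w nu) =
      TT (rng e) d * star (PE b (rcons eta e)) * star (PE w nu).
    by rewrite -(mulgA _ (star (Ed e))) -starM path_el_rcons.
  (* With [lam] empty, $e^*$ passes to the right: a connector completes [eta] to a step at the end
     of [nu], an edge of $E_p$ is appended to [eta]. *)
  case: (boolP (connector e)) => ce.
    rewrite -mulgA -e2 path_el_star_cat; apply: nf_time; last first.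
      by rewrite path_end_cat path_end_rcons.
    apply: cpath_reg_connector => //; rewrite ?e2 ?cb //.
    by rewrite path_end_cat e2.
  have ed := reg_edge r ce; have [_ re] := cedge_sub ed.
  right; exists (rng e), [::], (MReg A (rng e) [::] b (rcons eta e) d), w, nu; split.
    split=> //; first exact: cpath_nil.
    split=> //; rewrite ?re //; last by rewrite path_end_rcons.
    by rewrite -cats1; apply/is_path_cat; split=> //=; split.
  by rewrite nf_reg_nil {1}/path_el /= time_el_vert.
move=> [ed sf pl] el; have [fe|fe] := pselect (e = f); last first.
  left; rewrite -sf path_el_cons !mulgA -(mulgA (TT _ _)) edge_orth_reg //.
  by rewrite muls0 !mul0s.
subst f; have [_ re] := cedge_sub ed.
right; exists (rng e), [::], (MReg A (rng e) lam b eta d), w, nu; split.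
  by split=> //; [exact: cpath_nil|split; rewrite ?re].
rewrite nf_reg_nil path_el_cons !mulgA.
by rewrite -(mulgA _ (star (Ed e))) edge_starl time_el_vert.
Qed.

Lemma has_nfP (s : S) : has_nf s.
Proof.
(* There is no unit to which stability could be applied, so [has_nf] is carried along; the adjoints
   serve the star case. *)
suff [] : [/\ nf_stable s, nf_stable (star s), has_nf s & has_nf (star s)] by [].
have nfV v : has_nf (V v).
  have := @nf_time v 0%R v [::] (cpath_nil A v) erefl.
  by rewrite time_el0 /path_el /= vert_star vertM.
elim/sec_ind: s => [|v|e|v i b|a b [a1 a2 a3 a4] [b1 b2 b3 b4]|a [a1 a2 a3 a4]].
- by rewrite star0; split; try (by left); move=> s _; left; rewrite mul0s.
- by rewrite vert_star -time_el0; split; try exact: nf_stable_time; rewrite time_el0.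
- have [h1 h2] : nf_stable (Ed e) /\ nf_stable (star (Ed e)).
    have [r|[p [i ->]]|[p [i [t et]]]] := edge_cases A e.
    + by split; [apply/nf_stable_na/nonalpha_reg|apply: nf_stable_star_reg].
    + exact: nf_stable_alpha.
    + subst e; split; [apply/nf_stable_na/nonalpha_beta|exact: nf_stable_star_beta].
  split=> //.
    by rewrite -edge_vert; apply: h1.
  by rewrite -vert_edge starM vert_star; apply: h2.
- rewrite time_star -!time_elX; split; try exact: nf_stable_time;
  by rewrite -time_el_vert; apply: nf_stable_time.
- by rewrite starM; split; [apply: nf_stable_mul|apply: nf_stable_mul|apply: a1|apply: b2].
- by rewrite starK.
Qed.

End NormalForms.

(** * The action of normal forms *)

Section NormalFormAction.
Variables (E : sep_graph) (A : adaptable E).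
Implicit Types (v w : vert E) (e f : edge E) (l gam nu : seq (edge E)) (p q : tcomp E) (d : Zoo).
Implicit Types (x y z : dpath E) (n : Zoo * Zoo) (m : monomial A).

Local Notation k p := (ncyc A p).
Local Notation S := (SEC A).
Local Notation V := (svert A).
Local Notation PE := (path_el A).
Local Notation TT := (time_el A).
Local Notation actS := (@actS E A).

Definition toinf x := infcat (dv x) (dg x) (dt x).

Definition ipre v gam (ip : infpath E) : infpath E :=
  match ip with
  | PFree _ g => PFree v (gam ++ g)
  | PReg f => PReg (fun i : nat => nth (f (i - size gam)%N) gam i)
  end.

Lemma ipre_infcat v gam w g t : ipre v gam (infcat w g t) = infcat v (gam ++ g) t.
Proof.
case: t => [//|lam] /=; congr PReg; apply/funext => i.
rewrite nth_cat size_cat subnDA; case: ltnP => h; first exact: set_nth_default.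
by rewrite nth_default.
Qed.

Definition dpre v gam y := DPath v (gam ++ dg y) (dt y).
(** Edges are prepended one at a time, since those of $E_p$ have to join the tail when the c-path of
    [y] is empty. *)
Definition dcat lam y := foldr (@dcons E) y lam.

Lemma toinf_dpre v gam y : toinf (dpre v gam y) = ipre v gam (toinf y).
Proof. by rewrite ipre_infcat. Qed.

Lemma toinf_dcons e y : toinf (dcons e y) = ipre (src e) [:: e] (toinf y).
Proof.
case: y => v [|f g] [|lam]; rewrite /toinf ipre_infcat /dcons //=.
case: ifP => //= _; congr PReg; apply/funext => -[|i] //=.
by rewrite subn1 nth_nil.
Qed.

Lemma ipre_ipre v gam w g ip : ipre v gam (ipre w g ip) = ipre v (gam ++ g) ip.
Proof.
case: ip => [u h|f] /=; first by rewrite catA.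
congr PReg; apply/funext => i; rewrite nth_cat size_cat subnDA; case: ltnP => h; first exact: set_nth_default.
by rewrite nth_default.
Qed.

Lemma toinf_dcat F v lam z : is_path F v lam -> dv z = path_end v lam ->
  toinf (dcat lam z) = ipre v lam (toinf z).
Proof.
elim: lam v => [|e lam IH] v /=; first by move=> _ e; rewrite ipre_infcat /toinf e.
by move=> [_ <- pl] ez; rewrite toinf_dcons (IH _ pl ez) ipre_ipre.
Qed.

Lemma act_PE_dom v gam x n y : actS (PE v gam) x n y -> dv y = path_end v gam.
Proof.
by rewrite -path_el_end => /actS_mul[z [n1 [n2 [_ /actS_vert[_ _ _ ->] _]]]].
Qed.

Lemma act_PE_src v gam x n y : actS (PE v gam) x n y -> dv x = v.
Proof.
by rewrite -vert_path_el => /actS_mul[z [n1 [n2 [/actS_vert[-> _ _ ->]]]]].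
Qed.

Lemma actS_mulI (a b : S) x z y n1 n2 : actS a x n1 z -> actS b z n2 y ->
  actS (a * b)%g x (n1 + n2) y.
Proof. by move=> h1 h2; apply/actS_mul; exists z, n1, n2. Qed.

Lemma act_block p (i : 'I_(k p)) (t : 'I_(nbeta i)) r y : dvalid A y -> dv y = rng (beta t) ->
  actS (PE (vp A p) (rcons (nseq r (alpha i)) (beta t))) (dblock r t y)
    (0, dunit A (dcomp y) *+ r.+1) y.
Proof.
move=> vy ey; elim: r => [|r IH].
  rewrite -(src_cyc (cyc_beta t)) path_el1 -dcons_beta; apply/actS_edge/ae_cons => //.
  exact: nonalpha_beta.
rewrite /= path_el_alpha; apply/actS_mul.
exists (dblock r t y), (0, dunit A (dcomp y)), (0, dunit A (dcomp y) *+ r.+1); split=> //.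
  by apply/actS_edge; have := @ae_block _ A _ p i i r t y erefl vy ey; rewrite /adeg eqxx add1n.
by rewrite pairD addr0 [in LHS]mulrS.
Qed.

Lemma act_step v l y : step A v l -> dvalid A y -> dv y = path_end v l ->
  actS (PE v l) (dpre v l y) (0, dunit A (dcomp y) *+ size l) y.
Proof.
case=> {l} [p i t r f ->|lam b r pl sb cb] vy; rewrite path_end_rcons => ey.
  rewrite size_rcons size_nseq; have := @act_block p i t r y vy ey.
  by rewrite /dblock /dpre cat_rcons.
elim: lam v r pl sb => [|e lam IH] v r /=.
  rewrite /path_end /= => _ sb; rewrite -sb path_el1.
  have -> : dpre (src b) [:: b] y = dcons b y by rewrite dcons_nonreg //; right; left.
  by apply/actS_edge/ae_cons => //; apply: nonalpha_reg; rewrite sb.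
move=> [ed se pl] sb; have [_ re] := cedge_sub ed; rewrite -se path_el_cons.
have h := IH (rng e); rewrite re in h; have {}h := h r pl sb.
have [vz _] := actS_valid h.
have -> : dpre (src e) (e :: rcons lam b) y = dcons e (dpre (rng e) (rcons lam b) y).
  by rewrite dcons_nonreg //; left; case: (lam).
have dc : dcomp (dpre (rng e) (rcons lam b) y) = dcomp y.
  by rewrite /dcomp /dend /dpre /= path_end_cat path_end_rcons ey.
apply/actS_mul; exists (dpre (rng e) (rcons lam b) y), (0, dunit A (dcomp y)),
  (0, dunit A (dcomp y) *+ size (rcons lam b)); split=> //.
  by apply/actS_edge; rewrite -dc; apply: ae_cons => //; apply: nonalpha_reg; rewrite se.
by rewrite pairD addr0 mulrS.
Qed.

Lemma dcomp_dpre v gam y : dv y = path_end v gam -> dcomp (dpre v gam y) = dcomp y.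
Proof. by move=> ey; rewrite /dcomp /dend /dpre /= path_end_cat ey. Qed.

Lemma act_cpath v gam y : cpath A v gam -> dvalid A y -> dv y = path_end v gam ->
  actS (PE v gam) (dpre v gam y) (0, dunit A (dcomp y) *+ size gam) y.
Proof.
move=> c vy; elim: c => {v gam} [v|v l gam st c IH] ey.
  rewrite /path_end /= in ey; rewrite -ey.
  by apply/actS_vert; split=> //; rewrite /dpre; case: (y).
rewrite path_end_cat in ey; have {}IH := IH ey; have [vz _] := actS_valid IH.
have -> : dpre v (l ++ gam) y = dpre v l (dpre (path_end v l) gam y) by rewrite /dpre /= catA.
rewrite path_el_cat size_cat mulrnDr -[X in (X, _)](addr0 0) -pairD.
apply: actS_mulI IH; have := act_step st vz erefl.
by rewrite dcomp_dpre.
Qed.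

Lemma act_regpath v lam z : ~~ isfree A (comp v) -> is_path (cedge A (comp v)) v lam ->
  dvalid A z -> dv z = path_end v lam ->
  [/\ actS (PE v lam) (dcat lam z) (0, dunit A (dcomp z) *+ size lam) z,
     dcomp (dcat lam z) = dcomp z & forall d, dtr A (dcat lam z) d = dtr A z d].
Proof.
move=> + + vz; elim: lam v => [|e lam IH] v r /=.
  by move=> _ ez; split=> //; apply/actS_vert.
move=> [ed se pl] ez; have [_ re] := cedge_sub ed.
have := IH (rng e); rewrite re => /(_ r pl ez)[h1 h2 h3].
have na : nonalpha A e by apply: nonalpha_reg; rewrite se.
have [vy _] := actS_valid h1.
have ey := act_PE_src h1.
split.
- rewrite -se path_el_cons mulrS -[X in (X, _)](addr0 0) -pairD; apply: actS_mulI h1.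
  by rewrite -h2; apply/actS_edge; apply: ae_cons.
- by rewrite (dcomp_dcons na vy ey).
- by move=> d; rewrite dtr_dcons trl_reg ?h3 // se.
Qed.

Lemma addr_swap (a b c d : Zoo) : a + (b - c) - d = b + a - (c + d).
Proof. by rewrite opprD !addrA (addrC a b). Qed.

Lemma act_nf_reg v gam a lam b eta d w nu x n y :
  is_normal_form v gam (MReg A a lam b eta d) w nu ->
  actS (normal_form_el v gam (MReg A a lam b eta d) w nu) x n y <->
  exists z, [/\ dvalid A z, dv z = path_end a lam, x = dpre v gam (dcat lam z),
    y = dpre w nu (dcat eta z) &
    n = (dtr A z d, dunit A (dcomp z) *+ (size gam + size lam)
                    - dunit A (dcomp z) *+ (size nu + size eta))].
Proof.
move=> [c c' /= [[r cb] pl pe el] e1 e2].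
have key z : dvalid A z -> dv z = path_end a lam ->
  [/\ actS (PE v gam) (dpre v gam (dcat lam z)) (0, dunit A (dcomp z) *+ size gam) (dcat lam z),
      actS (TT a d) (dcat lam z) (dtr A z d, 0) (dcat lam z),
      actS (PE a lam) (dcat lam z) (0, dunit A (dcomp z) *+ size lam) z,
      actS (PE b eta) (dcat eta z) (0, dunit A (dcomp z) *+ size eta) z &
      actS (PE w nu) (dpre w nu (dcat eta z)) (0, dunit A (dcomp z) *+ size nu) (dcat eta z)].
  move=> vz ez; have [h1 h2 h3] := act_regpath r pl vz ez.
  have [||||g1 g2 g3] := act_regpath (v := b) (lam := eta) (z := z); rewrite ?cb -?el //.
  have [vx _] := actS_valid h1; have [vy _] := actS_valid g1.
  have ex := act_PE_src h1; have ey := act_PE_src g1.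
  split=> //.
  - by rewrite -h2; apply: act_cpath; rewrite ?ex.
  - by apply/actS_time; rewrite h3.
  - by rewrite -g2; apply: act_cpath; rewrite ?ey.
have built z (vz : dvalid A z) (ez : dv z = path_end a lam) :
  actS (normal_form_el v gam (MReg A a lam b eta d) w nu) (dpre v gam (dcat lam z))
    (dtr A z d, dunit A (dcomp z) *+ (size gam + size lam)
                - dunit A (dcomp z) *+ (size nu + size eta)) (dpre w nu (dcat eta z)).
  have [g1 g2 g3 g4 g5] := key z vz ez.
  have := actS_mulI (actS_mulI g1 (actS_mulI (actS_mulI g2 g3) (actS_starI g4))) (actS_starI g5).
  by rewrite !pairN !pairD !oppr0 !addr0 !add0r addr_swap -!mulrnDr (addnC (size lam)) (addnC (size eta)).
(* For the converse, the factor [PE a lam] supplies [z]; uniqueness of images then identifies the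
   path before [nu], then [y], and finally [x] and [n], with those built from [z]. *)
split=> [h|[z [vz ez -> -> ->]]]; last exact: (built z vz ez).
have := h; rewrite /normal_form_el /monomial_el => /actS_mul[y1 [? [? [+ /actS_star h5 _]]]].
move=> /actS_mul[? [? [? [_ + _]]]].
move=> /actS_mul[z [? [? [+ /actS_star h4 _]]]].
move=> /actS_mul[? [? [? [_ h3 _]]]].
have [_ vz] := actS_valid h3; have ez := act_PE_dom h3; have [_ _ _ g4 g5] := key z vz ez.
have [y1E _] := actS_fun h4 g4; subst y1; have [yE _] := actS_fun h5 g5; subst y.
by exists z; have [-> ->] := actS_fun h (built z vz ez).
Qed.

Lemma addr_sub_cancel (a b c : Zoo) : a + c - (b + c) = a - b.
Proof. by rewrite opprD addrACA subrr addr0. Qed.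

Lemma sum_pair (I : Type) (s : seq I) (P : pred I) (F G : I -> Zoo) :
  \sum_(j <- s | P j) (F j, G j) =
  (\sum_(j <- s | P j) F j, \sum_(j <- s | P j) G j) :> Zoo * Zoo.
Proof. by elim: s => [|j s IH]; rewrite ?big_nil // !big_cons IH; case: ifP. Qed.

Lemma scaleZn i d : i%:Z *: d = d *+ i.
Proof. by rewrite -scaler_nat natz. Qed.

Lemma dtrMn z d i : dtr A z (d *+ i) = dtr A z d *+ i.
Proof. by elim: i => [|i IH]; rewrite ?mulr0n ?dtr0 // !mulrS dtrD IH. Qed.

Lemma pairMn (a b : Zoo) i : (a, b) *+ i = (a *+ i, b *+ i) :> Zoo * Zoo.
Proof. by elim: i => // i IH; rewrite !mulrS IH. Qed.

Section Free.
Variable p : tcomp E.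
Hypothesis fp : isfree A p.
Implicit Types (i j : 'I_(k p)) (kk ll : 'I_(k p) -> nat).

Lemma act_alphas_pure kk :
  actS (alphas kk) (dpure A p) (0, \sum_(j < k p) 'X^j *+ kk j) (dpure A p).
Proof.
rewrite /alphas monoE time_el0.
suff h s : actS (foldl (mfac kk (fun=> 0%N)) (V (vp A p)) s) (dpure A p)
    (0, \sum_(j <- s) 'X^j *+ kk j) (dpure A p).
  by have := h (enum 'I_(k p)); rewrite big_enum.
elim/last_ind: s => [|s j IH].
  by rewrite big_nil; apply/actS_vert; split=> //; apply: dvalid_pure.
rewrite foldl_rcons -cats1 big_cat big_seq1 {1}/mfac /=.
elim: (kk j) => [|r IHr]; first by rewrite mulr0n addr0.
rewrite /= mulrSr addrA -[X in (X, _)](addr0 0) -pairD.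
by apply: actS_mulI IHr _; apply/actS_edge; apply: ae_pure.
Qed.

(** Only loops of the index of the block lengthen it; the others contribute [cvec] to the first
    coordinate of the degree. *)
Lemma act_alphas_block kk i (t : 'I_(nbeta i)) r z : dvalid A z -> dv z = rng (beta t) ->
  actS (alphas kk) (dblock (kk i + r) t z)
    (dtr A z (cvec i kk (fun=> 0%N)), dunit A (dcomp z) *+ kk i) (dblock r t z).
Proof.
move=> vz ez; rewrite /alphas monoE time_el0.
have h s r' : actS (foldl (mfac kk (fun=> 0%N)) (V (vp A p)) s)
    (dblock (\sum_(j <- s) kk j * (j == i) + r') t z) (\sum_(j <- s) adeg j i z *+ kk j)
    (dblock r' t z).
  elim/last_ind: s r' => [|s j IH] r'.
    rewrite !big_nil; apply/actS_vert; split=> //; exact: dvalid_block.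
  rewrite foldl_rcons -cats1 !big_cat !big_seq1 {1}/mfac /=.
  elim: (kk j) r' => [|c IHc] r'; first by rewrite mul0n mulr0n addr0 addn0; apply: IH.
  rewrite /= mulrSr addrA; apply: (actS_mulI (z := dblock ((j == i) + r') t z)).
    by have := IHc ((j == i) + r')%N; rewrite mulSn [in X in _ -> X](addnC (j == i) _) !addnA.
  by apply/actS_edge; have := @ae_block _ A _ p j i r' t z erefl vz ez; rewrite eq_sym.
have := h (enum 'I_(k p)) r; rewrite !big_enum /= (bigD1 i) //= eqxx muln1 big1 ?addn0; last first.
  by move=> j /negPf ->; rewrite muln0.
congr (actS _ _ _ _).
rewrite (bigD1 i) //= /adeg eqxx pairMn mul0rn.
rewrite (eq_bigr (fun j => (dtr A z 'X^(unbump i j) *+ kk j, 0))); last first.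
  by move=> j; rewrite eq_sym => /negPf ->; rewrite pairMn mul0rn.
rewrite sum_pair [X in _ + (_, X)]big1 // pairD add0r addr0 /cvec; congr (_, _).
rewrite (big_morph (dtr A z) (dtrD A z) (dtr0 A z)); apply: eq_bigr => j _.
by rewrite subr0 scaleZn dtrMn.
Qed.

Lemma dpre_pure v gam : path_end v gam = vp A p -> dcomp (dpre v gam (dpure A p)) = p.
Proof. by move=> e; rewrite dcomp_dpre ?e // dcomp_pure. Qed.

Lemma cvecE i kk ll : cvec i kk ll = cvec i kk (fun=> 0%N) - cvec i ll (fun=> 0%N).
Proof. by rewrite /cvec -sumrB; apply: eq_bigr => j _; rewrite -scalerBl !subr0. Qed.

(** The two alternatives are the two kinds of paths from $v^p$, and they match the two families of
    triples in $\mathcal Z(s)$ at a free monomial. *)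
Lemma act_nf_free v gam d kk ll w nu x n y :
  is_normal_form v gam (MFree d kk ll) w nu ->
  actS (normal_form_el v gam (MFree d kk ll) w nu) x n y <->
  [/\ x = dpre v gam (dpure A p), y = dpre w nu (dpure A p) &
    n = (d, \sum_(j < k p) 'X^j *+ kk j + dunit A p *+ size gam
            - (\sum_(j < k p) 'X^j *+ ll j + dunit A p *+ size nu))] \/
  exists i (t : 'I_(nbeta i)) r z, [/\ dvalid A z, dv z = rng (beta t),
    x = dpre v gam (dblock (kk i + r) t z), y = dpre w nu (dblock (ll i + r) t z) &
    n = (dtr A z (d * 'X^((k p).-1) + cvec i kk ll),
         dunit A (dcomp z) *+ (kk i + size gam) - dunit A (dcomp z) *+ (ll i + size nu))].
Proof.
move=> [c c' /= _ e1 e2].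
have pre u g z : cpath A u g -> path_end u g = vp A p -> dvalid A z -> dv z = vp A p ->
   actS (PE u g) (dpre u g z) (0, dunit A (dcomp z) *+ size g) z.
  by move=> cu eu vz ez; apply: act_cpath; rewrite ?eu.
have vpure := dvalid_pure fp.
rewrite /normal_form_el -/(mono d kk ll) monoP.
have pure := actS_mulI (actS_mulI (pre _ _ _ c e1 vpure erefl) (actS_mulI (actS_mulI
  (actS_timeI d vpure) (act_alphas_pure kk))
  (actS_starI (act_alphas_pure ll)))) (actS_starI (pre _ _ _ c' e2 vpure erefl)).
rewrite !dcomp_pure // dtr_pure !pairN !pairD !oppr0 !add0r !addr0 addr_swap in pure.
have block i (t : 'I_(nbeta i)) r z (vz : dvalid A z) (ez : dv z = rng (beta t)) :=
  let vx := dvalid_block (kk i + r) ez vz in let vy := dvalid_block (ll i + r) ez vz in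
  actS_mulI (actS_mulI (pre _ _ _ c e1 vx erefl) (actS_mulI (actS_mulI
  (actS_timeI d vx) (act_alphas_block kk r vz ez))
  (actS_starI (act_alphas_block ll r vz ez)))) (actS_starI (pre _ _ _ c' e2 vy erefl)).
have blockdeg i (t : 'I_(nbeta i)) r z (ez : dv z = rng (beta t)) :
  (0, dunit A (dcomp (dblock (kk i + r) t z)) *+ size gam) +
   ((dtr A (dblock (kk i + r) t z) d, 0) + (dtr A z (cvec i kk (fun=> 0%N)), dunit A (dcomp z) *+ kk i)
    + - (dtr A z (cvec i ll (fun=> 0%N)), dunit A (dcomp z) *+ ll i))
   + - (0, dunit A (dcomp (dblock (ll i + r) t z)) *+ size nu) =
  (dtr A z (d * 'X^((k p).-1) + cvec i kk ll),
   dunit A (dcomp z) *+ (kk i + size gam) - dunit A (dcomp z) *+ (ll i + size nu)).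
  rewrite !dcomp_block // dtr_block !pairN !pairD !oppr0 !add0r !addr0 -dtrN -!dtrD addr_swap.
  by rewrite (cvecE i kk ll) addrA !mulrnDr.
split=> [h|]; last first.
  by case=> [[-> -> ->]//|[i [t [r [z [vz ez -> -> ->]]]]]]; have := block i t r z vz ez; rewrite blockdeg.
have := h => /actS_mul[y1 [? [? [+ /actS_star h3 _]]]].
move=> /actS_mul[? [? [? [_ + _]]]].
move=> /actS_mul[z [? [? [+ /actS_star h2 _]]]].
move=> /actS_mul[? [? [? [_ h1 _]]]].
have [_ vz] := actS_valid h1; have ez : dv z = vp A p.
  by move: h1; rewrite -alphas_vp => /actS_mul[? [? [? [_ /actS_vert[_ _ _ ->] _]]]].
have [_ vy1] := actS_valid h3; have ey1 := act_PE_dom h3; rewrite e2 in ey1.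
have [yE _] := actS_fun h3 (pre _ _ _ c' e2 vy1 ey1); subst y.
have [zE|[i [t [r [z0 [vz0 ez0 zE]]]]]] := dfree_inv fp ez vz; subst z; [left|right].
  have [y1E _] := actS_fun h2 (act_alphas_pure ll); subst y1.
  by have [-> ->] := actS_fun h pure.
have [y1E _] := actS_fun h2 (act_alphas_block ll r vz0 ez0); subst y1.
have [-> ->] := actS_fun h (block i t r z0 vz0 ez0).
by exists i, t, r, z0; rewrite blockdeg.
Qed.

End Free.

(** A nonempty c-path ends in a connector and regular tails contain none, so neither c-path can be
    longer than the other. *)
Lemma toinf_inj x y : dvalid A x -> dvalid A y -> toinf x = toinf y -> x = y.
Proof.
have le v g lam v' g' lam' : dvalid A (DPath v g (TReg lam)) ->
    dvalid A (DPath v' g' (TReg lam')) -> (fun i : nat => nth (lam (i - size g)%N) g i) =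
    (fun i : nat => nth (lam' (i - size g')%N) g' i) -> (size g <= size g')%N.
  move=> [/= c _] [_ [_ _ h']] /= /(congr1 (fun u : nat -> edge E => u (size g).-1)) /= eF.
  rewrite leqNgt; apply/negP => lt; case: (cpath_last c) lt eF => [-> //|[g0 [b [-> cb]]]].
  rewrite size_rcons ltnS /= => gg; rewrite nth_rcons ltnn eqxx nth_default // => bE.
  by have [/connector_cedge] := h' (size g0 - size g')%N; rewrite -bE cb.
case: x => v g t; case: y => v' g' t' vx vy; rewrite /toinf /=.
case: t vx => [|lam] vx; case: t' vy => [|lam'] vy //=; first by case=> -> ->.
case=> ef; have sg : size g = size g'.
  by apply/eqP; rewrite eqn_leq (le _ _ _ _ _ _ vx vy ef) (le _ _ _ _ _ _ vy vx (esym ef)).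
have fE i := congr1 (fun u : nat -> edge E => u i) ef.
have gg : g = g'.
  apply: (eq_from_nth (x0 := lam 0%N)) => // i ig; have /= := fE i.
  rewrite (set_nth_default (lam 0%N)) // => ->; apply: set_nth_default; by rewrite -sg.
subst g'; have ll : lam = lam'.
  apply/funext => i; have /= := fE (size g + i)%N; rewrite !nth_default ?leq_addr //.
  by rewrite addnC addnK.
(* [PReg] does not store the source; it is recovered as the source of the first edge. *)
subst lam'; congr DPath; case: vx vy => [/cpath_is_path p1 [_ s1 _]] [/cpath_is_path p2 [_ s2 _]].
move: p1 p2 s1 s2; rewrite /dend /=; case: (g) => [|e h] /=; first by rewrite /path_end /= => _ _ <-.
by move=> [_ -> _] [_ -> _].
Qed.

Lemma cpath_inf_lengthE q gam : cpath_inf_length A q gam = dunit A q *+ size gam.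
Proof.
rewrite /cpath_inf_length /inf_length /dunit /ndim; case: ifP => f.
  by rewrite -sumrMnl; apply: eq_bigr => j _; rewrite add0n scaleZn.
by rewrite big_ord1 expr0 -[RHS]scaleZn -alg_polyC.
Qed.

Lemma act_normal_form v gam m w nu (h : triple E) : is_normal_form v gam m w nu ->
  Z_normal_form v gam m w nu h <->
  exists x n y, actS (normal_form_el v gam m w nu) x n y /\ h = (toinf x, n, toinf y).
Proof.
case: m => [p d kk ll|a lam b eta d] nf; last first.
  have [_ _ [[r cb] pl pe el] e1 e2] := nf.
  have tox z : dv z = path_end a lam ->
     toinf (dpre v gam (dcat lam z)) = infcat v (gam ++ lam ++ dg z) (dt z).
    by move=> ez; rewrite toinf_dpre (toinf_dcat pl ez) ipre_ipre ipre_infcat catA.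
  have toy z : dv z = path_end a lam ->
     toinf (dpre w nu (dcat eta z)) = infcat w (nu ++ eta ++ dg z) (dt z).
    move=> ez; rewrite toinf_dpre (toinf_dcat pe) -?el // ipre_ipre ipre_infcat.
    by rewrite catA.
  split=> [[gam' [t [n1 [c tk ex ->]]]]|[x [n [y [+ ->]]]]].
    pose z := DPath (path_end a lam) gam' t.
    exists (dpre v gam (dcat lam z)), (dtr A z d, dunit A (dcomp z) *+ (size gam + size lam)
                    - dunit A (dcomp z) *+ (size nu + size eta)), (dpre w nu (dcat eta z)).
    split; first by apply/act_nf_reg => //; exists z.
    rewrite tox // toy // ex !cpath_inf_lengthE !size_cat !addnA !mulrnDr /=.
    by rewrite addr_sub_cancel.
  move=> /(act_nf_reg _ _ _ nf)[z [vz ez -> -> ->]].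
  exists (dg z), (dt z), (dtr A z d).
  rewrite tox // toy //; split; [by rewrite -ez; case: vz|by rewrite -ez; case: vz|by []|].
  by rewrite !cpath_inf_lengthE !size_cat !addnA !mulrnDr /= -!ez addr_sub_cancel.
have [_ _ /= fp e1 e2] := nf.
have tox u g c i (t : 'I_(nbeta i)) r z : toinf (dpre u g (dblock (c + r) t z)) =
   infcat u (g ++ nseq c (alpha i) ++ nseq r (alpha i) ++ beta t :: dg z) (dt z).
  by rewrite toinf_dpre ipre_infcat /dblock /= nseqD -!catA.
have deg0 : \sum_(j < k p) ((kk j)%:Z + (size gam)%:Z - (ll j)%:Z - (size nu)%:Z) *: 'X^j =
   \sum_(j < k p) 'X^j *+ kk j + dunit A p *+ size gam
            - (\sum_(j < k p) 'X^j *+ ll j + dunit A p *+ size nu) :> Zoo.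
  rewrite /dunit /ndim fp -!sumrMnl -!big_split /= -sumrB; apply: eq_bigr => j _.
  by rewrite -!scaleZn -!scalerDl -scalerBl; congr (_ *: _); rewrite opprD !addrA.
have degi q i r (s : 'I_(nbeta i)) g :
   cpath_inf_length A q (gam ++ nseq (kk i) (alpha i) ++ nseq r (alpha i) ++ beta s :: g) -
   cpath_inf_length A q (nu ++ nseq (ll i) (alpha i) ++ nseq r (alpha i) ++ beta s :: g) =
   dunit A q *+ (kk i + size gam) - dunit A q *+ (ll i + size nu).
  rewrite !cpath_inf_lengthE !size_cat !size_nseq !addnA (mulrnDr _ (_ + _ + _)%N) (mulrnDr _ (size nu + _ + _)%N).
  rewrite addr_sub_cancel (mulrnDr _ (_ + _)%N) (mulrnDr _ (size nu + _)%N).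
  by rewrite addr_sub_cancel (addnC (kk i)) (addnC (ll i)).
split.
  case=> [->|[i [r [s [g [t [n1 [c tk ex ->]]]]]]]].
    do 3 eexists; split; first by apply/act_nf_free => //; left; exact: And3 erefl erefl erefl.
    by rewrite deg0 !toinf_dpre !ipre_infcat !cats0.
  pose z := DPath (rng (beta s)) g t.
  (* [cpath_free_inv] returns some block decomposition of the c-path; [block_inj] identifies its
     remainder with [g]. *)
  have vz : dvalid A z.
    have [/(congr1 size)|[j [s' [r' [g' [gE cg]]]]]] := cpath_free_inv fp c.
      by rewrite size_cat addnS.
    have [_ e2' eg] := @block_inj _ A _ _ _ r r' s s' z (DPath (rng (beta s')) g' t) erefl erefl
      (congr1 (fun u => DPath (vp A p) u t) gE).
    split; first by case: eg => es eg'; rewrite /= es eg'.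
    by move: tk; rewrite path_end_cat.
  do 3 eexists; split.
    by apply/act_nf_free => //; right; exists i, s, r, z; exact: And5 vz erefl erefl erefl erefl.
  rewrite !tox degi; congr (_, (_, _), _).
    case: ex => [[]|]; first by case: (r).
    move=> [i' [s' [r' [g' [gE ->]]]]].
    have [_ e2' eg] := @block_inj _ A _ _ _ r r' s s' z (DPath (rng (beta s')) g' t) erefl erefl
      (congr1 (fun u => DPath (vp A p) u t) gE).
    have ii : i = i' by exact: (congr1 (@tag _ _) e2').
    subst i'; have ss := eq_from_Tagged e2'; subst s'.
    case: eg => <-; rewrite /dtr /= /translate.
    by rewrite (comp_src_cyc (cyc_beta s)) fp.
  by rewrite path_end_cat.
move=> [x [n [y [/(act_nf_free fp _ _ _ nf) + ->]]]].
case=> [[-> -> ->]|[i [s [r [z [vz ez -> -> ->]]]]]]; [left|right].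
  by rewrite deg0 !toinf_dpre !ipre_infcat !cats0.
exists i, r, s, (dg z), (dt z), (dtr A z (d * 'X^((k p).-1) + cvec i kk ll)).
have [cb tb] := dvalid_block r ez vz; split=> //.
  right; exists i, s, r, (dg z); split=> //.
  by rewrite /dtr /translate (comp_src_cyc (cyc_beta s)) fp.
rewrite !tox degi; congr (_, (_, _ *+ _ - _ *+ _), _);
  by congr (dunit A _); rewrite -(dcomp_block r ez).
Qed.

(** Every vertex of a regular component emits an edge inside $E_p$, so edges can be chosen one after
    the other for ever. *)
Lemma tail_exists v : exists t, tail_ok A v t.
Proof.
case: (boolP (isfree A (comp v))) => f; first by exists (TFree E).
have /choice[next nextP] : forall w, exists e, comp w = comp v -> cedge A (comp v) e /\ src e = w.
  move=> w; have [cw|] := pselect (comp w = comp v).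
    by have [e [_ [_ ce _ se _]]] := reg_two_edges f cw; exists e.
  by have [e [_ [_ ce _ se _]]] := reg_two_edges f (erefl (comp v)); exists e.
pose lam := fix lam i := if i is i'.+1 then next (rng (lam i')) else next v.
have lamP i : cedge A (comp v) (lam i).
  elim: i => [|i IH] /=; first by case: (nextP v).
  by have [_ /nextP[]] := cedge_sub IH.
exists (TReg lam); split=> //; first by case: (nextP v).
by move=> i; split=> //=; have [_ /nextP[_ ->]] := cedge_sub (lamP i).
Qed.

(** A normal form acts somewhere: at the pure path if its monomial is free, and on any regular tail
    otherwise. *)
Lemma act_nonempty (s : S) : s <> szero -> exists x n y, actS s x n y.
Proof.
case: (has_nfP s) => // -[v [gam [m [w [nu [nf ->]]]]]] _.
case: m nf => [p d kk ll|a lam b eta d] nf.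
  have [_ _ /= fp _ _] := nf.
  by do 3 eexists; apply/act_nf_free => //; left; exact: And3 erefl erefl erefl.
have [t tk] := tail_exists (path_end a lam).
do 3 eexists; apply/act_nf_reg => //; exists (DPath (path_end a lam) [::] t).
by split; try reflexivity; split=> //; apply: cpath_nil.
Qed.

(** As the action depends on [s] alone, every decomposition of [s] describes the same set of
    triples. *)
Lemma Zset_act (s : S) (h : Hcarrier A) : Zset s h <->
  exists x n y, actS s x n y /\ sval h = (toinf x, n, toinf y).
Proof.
split=> [[_ [v [gam [m [w [nu [nf -> hz]]]]]]]|[x [n [y [sx hE]]]]].
  by apply/act_normal_form.
split; first by move=> s0; rewrite s0 in sx; apply: actS_0 sx.
case: (has_nfP s) => [s0|]; first by rewrite s0 in sx; case: (actS_0 sx).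
move=> [v [gam [m [w [nu [nf sE]]]]]]; exists v, gam, m, w, nu; split=> //.
by apply/act_normal_form => //; exists x, n, y; rewrite -sE.
Qed.

End NormalFormAction.

(** * Idempotents and tight filters *)

Section Filters.
Variables (E : sep_graph) (A : adaptable E).
Implicit Types (v w : vert E) (l gam nu : seq (edge E)) (p q : tcomp E) (d : Zoo).
Implicit Types (x y z : dpath E) (n : Zoo * Zoo) (L : nat -> nat).

Local Notation k p := (ncyc A p).
Local Notation S := (SEC A).
Local Notation V := (svert A).
Local Notation Ed := (sedge A).
Local Notation PE := (path_el A).
Local Notation TT := (time_el A).
Local Notation actS := (@actS E A).

Definition unital (s : S) := forall x n y, actS s x n y -> x = y /\ n = 0.

(** Applying [e] twice gives the same result as once; so [e] fixes [x], with degree 0 by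
    cancellation, and injectivity then forces [y = x]. *)
Lemma idem_unital (e : S) : idem e -> unital e.
Proof.
move=> ee x n y h; have := h; rewrite -{1}ee => /actS_mul[z [n1 [n2 [h1 h2 nE]]]].
have [xz nn] := actS_fun h h2; subst z n2.
have n10 : n1 = 0 by apply: (addIr n); rewrite add0r -nE.
by rewrite n10 in h1; have [<- ->] := actS_inj h1 h.
Qed.

Lemma act_range (a : S) x m y : actS (a * star a)%g x m y <->
  [/\ x = y, m = 0 & exists n z, actS a x n z].
Proof.
rewrite actS_mul; split.
  move=> [z [n1 [n2 [h1 /actS_star h2 ->]]]]; have [xy nn] := actS_fun h1 h2.
  by split=> //; [rewrite nn addNr | exists n1, z].
move=> [<- -> [n [z h]]]; exists z, n, (- n); rewrite addrN; split=> //.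
exact: actS_starI.
Qed.

Lemma range_idem (a c : S) : (star a * a = c)%g -> (a * c = a)%g ->
  idem (a * star a)%g /\ star (a * star a)%g = (a * star a)%g.
Proof.
move=> h1 h2; rewrite /idem starM starK; split=> //.
by rewrite mulgA -(mulgA a) h1 h2.
Qed.

(* The normal form of s must be of the form g g^*. *)
Lemma unital_idem (s : S) : unital s -> idem s /\ star s = s.
Proof.
move=> u; case: (has_nfP s) => [->|[v [gam [m [w [nu [nf sE]]]]]]].
  by rewrite /idem mul0s star0.
have [c c' ok e1 e2] := nf; case: m ok nf e1 e2 sE => [p d kk ll|a lam b eta d] /= ok nf e1 e2 sE.
  (* Testing at the pure path: equal endpoints give [gam = nu], and degree 0 gives [d = 0] and
     [kk = ll]. *)
  have : actS s (dpre v gam (dpure A p)) (d, \sum_(j < k p) 'X^j *+ kk j + dunit A p *+ size gam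
            - (\sum_(j < k p) 'X^j *+ ll j + dunit A p *+ size nu)) (dpre w nu (dpure A p)).
    by rewrite sE; apply/act_nf_free => //; left.
  move=> /u[[vw]]; rewrite !cats0 => gn [d0] h; subst w nu d.
  have kl : kk = ll.
    apply/funext => i; move: h; rewrite opprD addrACA subrr addr0 => /eqP.
    rewrite subr_eq0 => /eqP/(congr1 (fun u : Zoo => u`_i)).
    have cf (f : 'I_(k p) -> nat) : (\sum_(j < k p) 'X^j *+ f j : Zoo)`_i = (f i)%:Z.
      rewrite coef_sum (bigD1 i) //= coefMn coefXn eqxx natz big1 ?addr0 // => j ji.
      by rewrite coefMn coefXn eq_sym (_ : (j == i :> nat) = false) ?mul0rn //; apply/negbTE.
    by rewrite !cf => -[].
  subst ll; have g : s = ((PE v gam * alphas kk) * star (PE v gam * alphas kk))%g.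
    rewrite sE /normal_form_el -/(mono 0 kk kk) monoP time_el0 vp_alphas starM.
    by rewrite !mulgA.
  rewrite g; apply: (@range_idem _ (V (vp A p))).
    rewrite starM -mulgA (mulgA (star (PE _ _))) (path_el_starl A (cpath_is_path c)) e1.
    by rewrite vp_alphas alphas_starl.
  by rewrite -mulgA alphas_vp.
case: ok => -[r cb] pl pe el.
have [t tk] := tail_exists A (path_end a lam).
pose z := DPath (path_end a lam) [::] t.
have vz : dvalid A z by split; [apply: cpath_nil|].
have rz : ~~ isfree A (comp (path_end a lam)) by rewrite (is_path_comp erefl pl).
have : actS s (dpre v gam (dcat lam z)) (dtr A z d, dunit A (dcomp z) *+ (size gam + size lam)
     - dunit A (dcomp z) *+ (size nu + size eta)) (dpre w nu (dcat eta z)).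
  by rewrite sE; apply/act_nf_reg => //; exists z.
move=> /u[xy [d0 /eqP]]; rewrite subr_eq0 => /eqP sz.
have d00 : d = 0 by exact: d0.
have size_eq : (size gam + size lam)%N = (size nu + size eta)%N.
  move: sz; rewrite /dunit /ndim /dcomp /dend /= (negPf rz) big_ord1 expr0.
  move=> /(congr1 (fun u : Zoo => u`_0)); rewrite !coefMn coef1 eqxx !natz.
  by case.
have vw : v = w := congr1 (@dv E) xy.
(* Only the concatenations matter for $gg^*$. Their lengths agree by the degree, their edges because
   both begin the same infinite path. *)
have gg : gam ++ lam = nu ++ eta.
  have [lamb tE] := tail_reg rz tk.
  have := congr1 (@toinf E) xy.
  rewrite !toinf_dpre (toinf_dcat pl) // (toinf_dcat pe) // !ipre_ipre !ipre_infcat /= tE !cats0.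
  case=> h; apply: (eq_from_nth (x0 := lamb 0%N)); first by rewrite !size_cat.
  move=> i ig; have := congr1 (fun u : nat -> edge E => u i) h.
  rewrite /= (set_nth_default (lamb 0%N)) // => ->; apply: set_nth_default.
  by move: ig; rewrite !size_cat size_eq.
have g : s = (PE v (gam ++ lam) * star (PE v (gam ++ lam)))%g.
  rewrite {2}gg sE /normal_form_el /= d00 time_el0 vert_path_el -path_el_star_cat vw e2.
  by rewrite -vw path_el_cat e1 !mulgA.
have pg : is_path setT v (gam ++ lam).
  apply/is_path_cat; split; first exact: cpath_is_path c.
  by rewrite e1; apply: is_path_sub pl.
rewrite g; apply: (@range_idem _ (V (path_end v (gam ++ lam)))); first exact: path_el_starl pg.
exact: path_el_end.
Qed.

Lemma idem_star (e : S) : idem e -> star e = e.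
Proof. by move=> /idem_unital/unital_idem[]. Qed.

Lemma idemM (e f : S) : idem e -> idem f -> idem (e * f)%g.
Proof.
move=> /idem_unital ue /idem_unital uf; apply: (proj1 (unital_idem _)) => x n y.
by move=> /actS_mul[z [n1 [n2 [/ue[<- ->] /uf[<- ->] ->]]]]; rewrite addr0.
Qed.

(* e f is self-adjoint since it acts as a unit. *)
Lemma idemC (e f : S) : idem e -> idem f -> (e * f = f * e)%g.
Proof.
move=> ie jf; have := idem_star (idemM ie jf).
by rewrite starM (idem_star ie) (idem_star jf).
Qed.

Definition dom (e : S) x := actS e x 0 x.

Lemma dom_mul (e f : S) x : idem e -> idem f -> dom (e * f)%g x <-> dom e x /\ dom f x.
Proof.
move=> /idem_unital ue /idem_unital uf; rewrite /dom actS_mul; split.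
  move=> [z [n1 [n2 [h1 h2 _]]]].
  by have [xz n10] := ue _ _ _ h1; have [_ n20] := uf _ _ _ h2; subst.
by move=> [h1 h2]; exists x, 0, 0; rewrite addr0.
Qed.

Lemma act_dom (e : S) x n y : idem e -> actS e x n y -> dom e x /\ dom e y.
Proof. by move=> /idem_unital u h; have [xy n0] := u _ _ _ h; subst. Qed.

Lemma dom_neq0 (e : S) x : dom e x -> e <> szero.
Proof. by move=> h e0; rewrite e0 in h; apply: actS_0 h. Qed.

Lemma dom_nonempty (e : S) : idem e -> e <> szero -> exists x, dom e x.
Proof. by move=> ie /act_nonempty[x [n [y h]]]; exists x; case: (act_dom ie h). Qed.

Definition rg (a : S) : S := (a * star a)%g.

Lemma rg_idem (a : S) : idem (rg a).
Proof. by apply: (proj1 (unital_idem _)) => x n y /act_range[]. Qed.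

Lemma dom_rg (a : S) x : dom (rg a) x <-> exists n z, actS a x n z.
Proof. by split=> [/act_range[]//|h]; apply/act_range. Qed.

(** Together with [dseg_ext] this shows that $|\cdot|_\infty$ determines the initial segment of a
    given path. *)
Lemma dsegdeg_inj x L L' : dsegdeg A x L = dsegdeg A x L' ->
  forall j, (j < ndim A (dcomp x))%N -> L j = L' j.
Proof.
rewrite /dsegdeg -!(poly_def _ (fun j => (_ j + size (dg x))%:Z)) => h j jn.
by have := congr1 (fun u : Zoo => u`_j) h; rewrite !coef_poly jn => -[] /addIn.
Qed.

Lemma dseg_ext x L L' : dvalid A x -> (forall j, (j < ndim A (dcomp x))%N -> L j = L' j) ->
  dseg A x L = dseg A x L'.
Proof.
move=> vx h; rewrite /dseg /dsegpath; case e: (dt x) => [|lam].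
  have [f _] := tfree_end vx e; congr (_ * alphas _)%g; apply/funext => j.
  by apply: h; rewrite /ndim f.
by rewrite h // /ndim (negPf (treg_comp vx e)).
Qed.

Lemma mkseq_shift (lam : nat -> edge E) c :
  (fun i : nat => nth (lam (c + (i - c))%N) (mkseq lam c) i) = lam.
Proof.
apply/funext => i; have [h|h] := ltnP i c; first by rewrite nth_mkseq.
by rewrite nth_default ?size_mkseq // subnKC.
Qed.

Lemma init_segment_reg v gam t : init_segment A v gam -> tail_ok A (path_end v gam) t ->
  ~~ isfree A (comp (path_end v gam)) ->
  exists gam' lam z, [/\ gam = gam' ++ lam, cpath A v gam', dvalid A z, dv z = path_end v gam &
   [/\ is_path (cedge A (comp (path_end v gam'))) (path_end v gam') lam,
       ~~ isfree A (comp (path_end v gam')),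
       dt z = t, dg z = [::] & toinf (dpre v gam' (dcat lam z)) = infcat v gam t]].
Proof.
rewrite /init_segment => + tk r; rewrite (negPf r) => -[gam' [lam [gE c pl]]].
have ee : path_end v gam = path_end (path_end v gam') lam by rewrite gE path_end_cat.
exists gam', lam, (DPath (path_end v gam) [::] t); split=> //.
  by split; [exact: cpath_nil|].
split=> //; first by rewrite -(is_path_comp erefl pl) -ee.
by rewrite toinf_dpre (toinf_dcat pl) //= ipre_ipre /toinf /= ipre_infcat cats0 -gE.
Qed.

(** Translates the bookkeeping by [L] into the initial segments, tails and lengths that define
    $\mathcal H$. *)
Lemma seg_data x L : dvalid A x ->
  [/\ init_segment A (dv x) (dsegpath x L), comp (dsegend x L) = dcomp x,
      tail_ok A (dsegend x L) (drest x L),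
      toinf x = infcat (dv x) (dsegpath x L) (drest x L) &
      inf_length (dsegpath x L) (fun j : 'I_(k (dcomp x)) => L j) = dsegdeg A x L].
Proof.
case: x => v gam [|lam] vx; have [c tk] := vx; rewrite /dsegend /dsegpath /drest /dsegdeg /=.
  have [f _] := tfree_end vx erefl; split=> //; first by rewrite /init_segment f.
  by rewrite /inf_length /ndim f.
have [pl el] := tail_path (L 0%N) tk; have r := treg_comp vx erefl.
have ce : comp (path_end v (gam ++ mkseq lam (L 0%N))) = comp (path_end v gam).
  by rewrite path_end_cat (is_path_comp erefl pl).
split=> //.
- by rewrite /init_segment ce (negPf r); exists gam, (mkseq lam (L 0%N)).
- rewrite ce path_end_cat [path_end _ (mkseq _ _)]el addn0; split=> // i.
  by rewrite addnS; case: tk.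
- rewrite /toinf /=; congr PReg; apply/funext => i; rewrite nth_cat size_cat size_mkseq.
  case: ltnP => h; first exact: set_nth_default.
  rewrite nth_default // subnDA.
  exact: (congr1 (fun u : nat -> edge E => u (i - size gam)%N) (esym (mkseq_shift lam (L 0%N)))).
- rewrite /inf_length /ndim (negPf r) big_ord1 expr0 size_cat size_mkseq addnC.
  by rewrite scaleZn -[RHS]scaler_nat natz -alg_polyC.
Qed.

Lemma act_init_segment_reg x v gam t : dvalid A x -> toinf x = infcat v gam t ->
  init_segment A v gam -> tail_ok A (path_end v gam) t -> ~~ isfree A (comp (path_end v gam)) ->
  exists n z, actS (PE v gam) x n z.
Proof.
move=> vx xE isg tk r.
have [gam' [lam [z [gE c vz ez [pl r' _ _ zE]]]]] := init_segment_reg isg tk r.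
have ez' : dv z = path_end (path_end v gam') lam by rewrite ez gE path_end_cat.
have [h1 _ _] := act_regpath r' pl vz ez'; have [vd _] := actS_valid h1.
have h2 := act_cpath c vd (act_PE_src h1); have [vd' _] := actS_valid h2.
have -> : x = dpre v gam' (dcat lam z) by apply: (@toinf_inj _ A); rewrite // xE zE.
by rewrite gE path_el_cat; do 2 eexists; apply: actS_mulI h2 h1.
Qed.

Lemma act_dseg y L : dvalid A y -> exists n z, actS (dseg A y L) y n z.
Proof.
move=> vy; have [isg ce tk yE _] := seg_data L vy; rewrite /dseg; case e: (dt y) => [|lam].
  have [f ev] := tfree_end vy e; have [c _] := vy.
  have h := actS_mulI (act_cpath c (dvalid_pure f) (esym ev)) (act_alphas_pure f (fun j => L j)).
  have -> : y = dpre (dv y) (dg y) (dpure A (dcomp y)).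
    by case: y e {vy isg ce tk yE f ev c h} => v g t /= ->; rewrite /dpre /= cats0.
  by rewrite dpre_pure //=; do 2 eexists; rewrite cats0; apply: h.
apply: (act_init_segment_reg vy yE isg tk); rewrite -/(dsegend y L) ce.
exact: treg_comp vy e.
Qed.

(** For large [L] these projections lie below any given idempotent defined at [y] and are orthogonal
    to any other one, so they decide membership in the filter of [y]. *)
Definition fseg y L : S := rg (dseg A y L).

Lemma dom_fseg y L : dvalid A y -> dom (fseg y L) y.
Proof. by move=> vy; apply/dom_rg/act_dseg. Qed.

Lemma act_neq0 (a b : S) x n y m z : actS a x n y -> actS b y m z -> (a * b)%g <> szero.
Proof. by move=> h1 h2 e; have := actS_mulI h1 h2; rewrite e; apply: actS_0. Qed.

Lemma local_act (a : S) x n y : actS a x n y -> exists c, forall L, (forall j, (c <= L j)%N) ->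
  exists L', [/\ forall j, (L j <= L' j + c)%N, dmatch A x L' n.2 y L &
       (a * dseg A y L = dseg A x L' * TT (dsegend y L) n.1)%g].
Proof.
move=> h; have [_ vy] := actS_valid h.
have [[x' [n' [c [h' H]]]]|[c H]] := is_localP a vy.
  by have [xx nn] := actS_fun h h'; subst; exists c.
have [m [z hz]] := act_dseg (fun=> c) vy.
by case: (act_neq0 h hz); apply: H.
Qed.

Lemma germ_local (a b : S) x n y : actS a x n y -> actS b x n y ->
  exists L, (a * fseg y L = b * fseg y L)%g.
Proof.
move=> ha hb; have [vx vy] := actS_valid ha.
have [c1 H1] := local_act ha; have [c2 H2] := local_act hb.
exists (fun=> maxn c1 c2).
have [j|L1 [_ [_ _ _ e1] g1]] := H1 (fun=> maxn c1 c2); first exact: leq_maxl.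
have [j|L2 [_ [_ _ _ e2] g2]] := H2 (fun=> maxn c1 c2); first exact: leq_maxr.
(* Both segments of [x] have the length vector of the segment of [y] plus $n_2$, hence they
   coincide. *)
rewrite /fseg /rg !mulgA g1 g2; congr (_ * _ * _)%g; apply: dseg_ext => //.
by apply: dsegdeg_inj; apply: (addIr (- dsegdeg A y (fun=> maxn c1 c2))); rewrite e1 e2.
Qed.

Lemma dom_fseg_le (e : S) y : idem e -> dom e y -> exists c, forall L, (forall j, (c <= L j)%N) ->
  (fseg y L * e)%g = fseg y L.
Proof.
move=> ie de; have [_ vy] := actS_valid de; have [c H] := local_act de; exists c => L hL.
have [L' [_ [_ _ _ h1] h2]] := H L hL.
rewrite idemC //; last exact: rg_idem.
rewrite /fseg /rg mulgA h2 /= time_el0 (dseg_ext (L' := L)) ?dseg_end //.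
by apply: dsegdeg_inj; move/eqP: h1; rewrite subr_eq0 => /eqP.
Qed.

Lemma ndom_fseg (e : S) y : idem e -> dvalid A y -> ~ dom e y ->
  exists c, forall L, (forall j, (c <= L j)%N) -> (fseg y L * e)%g = szero.
Proof.
move=> ie vy nd; have [[x [n [c [h _]]]]|[c H]] := is_localP e vy.
  by case: nd; case: (act_dom ie h).
exists c => L hL; rewrite idemC //; last exact: rg_idem.
by rewrite /fseg /rg mulgA H // mul0s.
Qed.

Definition eta x : set S := [set e | idem e /\ dom e x].

Lemma seq_bound (T : eqType) (s : seq T) (P : T -> nat -> Prop) :
  {in s, forall t, exists c, forall c', (c <= c')%N -> P t c'} ->
  exists c, forall c', (c <= c')%N -> {in s, forall t, P t c'}.
Proof.
elim: s => [|t s IH] h; first by exists 0%N.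
have [c1 H1] := h t (mem_head t s).
have [|c2 H2] := IH; first by move=> u us; apply: h; rewrite in_cons us orbT.
exists (maxn c1 c2) => c'; rewrite geq_max => /andP[h1 h2] u.
by rewrite in_cons => /orP[/eqP->|us]; [apply: H1|apply: H2].
Qed.

(** If no member of a finite cover of [e] were defined at [x], a sufficiently long [fseg] of [x]
    would be a nonzero idempotent below [e] orthogonal to them all. *)
Lemma eta_tight x : dvalid A x -> is_tight (eta x).
Proof.
move=> vx; split.
  split.
  - exists (V (dv x)); split; first exact: vertM.
    by apply/actS_vert.
  - by move=> e [].
  - by move=> [_ /dom_neq0].
  - by move=> e f [ie de] [jf df]; split; [apply: idemM|apply/dom_mul].
  - by move=> e f [ie de] jf ef; split=> //; move: de; rewrite -ef => /(dom_mul _ ie jf)[].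
move=> e Z [ie de] [/finite_seqP[s ZE] Zs cov]; apply: contrapT => ne.
have [c H] : exists c, forall c', (c <= c')%N -> {in s, forall z : S, (fseg x (fun=> c') * z)%g = szero}.
  apply: (@seq_bound _ _ (fun (z : S) c' => (fseg x (fun=> c') * z)%g = szero)) => z zs.
  have Zz : Z z by rewrite ZE.
  have [iz _] := Zs z Zz.
  have [|c H] := ndom_fseg iz vx; first by move=> dz; apply: ne; exists z; split.
  by exists c => c' cc; apply: H.
have [c1 H1] := dom_fseg_le ie de.
have [|||z Zz] := cov (fseg x (fun=> maxn c c1)).
- exact: rg_idem.
- by apply: H1 => j; apply: leq_maxr.
- exact: dom_neq0 (dom_fseg _ vx).
by apply; apply: H; [apply: leq_maxl|move: Zz; rewrite ZE].
Qed.

(** Nonzero idempotents are defined at some path, so a cover can be tested on infinite paths. The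
    members of [Z] are cut down to the products [e * z], which lie below [e]. *)
Lemma tight_split (h : set S) (e : S) (Z : set S) : is_tight h -> h e -> finite_set Z ->
  Z `<=` [set z | idem z] -> (forall x, dom e x -> exists2 z, Z z & dom z x) ->
  exists2 z, Z z & h z.
Proof.
move=> [[_ hi h0 hM hU] ht] he fZ iZ cov; have ie := hi e he.
have [|u [[z Zz <-] hz]] := ht e [set (e * z)%g | z in Z] he.
  split; first exact: finite_image.
    move=> _ [z Zz <-]; have iz := iZ z Zz; split; first exact: idemM.
    by rewrite /idem_le (idemC ie iz) -mulgA ie.
  move=> f jf fe fn; have [x fx] := dom_nonempty jf fn.
  have [_ ex] : dom f x /\ dom e x by apply/dom_mul => //; rewrite fe.
  have [z Zz zx] := cov x ex; exists (e * z)%g; first by exists z.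
  have iz := iZ z Zz.
  apply: (@dom_neq0 _ x); apply/dom_mul => //; [exact: idemM|].
  by split=> //; apply/dom_mul.
have iz := iZ z Zz; exists z => //; apply: (hU _ _ hz iz).
by rewrite /idem_le -mulgA iz.
Qed.

Lemma tight_dom (h : set S) (e f : S) : is_tight h -> h e -> idem f ->
  (forall x, dom e x -> dom f x) -> h f.
Proof.
move=> th he jf ef; have [||x ex|z -> //] := @tight_split h e [set f] th he.
- exact: finite_set1.
- by move=> z ->.
- by exists f => //; apply: ef.
Qed.

(** * The infinite path of a tight filter *)

Definition pf v gam : S := rg (PE v gam).

Lemma dom_pf v gam x : cpath A v gam -> dom (pf v gam) x ->
  exists y, [/\ dvalid A y, dv y = path_end v gam & x = dpre v gam y].
Proof.
move=> c /dom_rg[n [y h]]; have [_ vy] := actS_valid h; have ey := act_PE_dom h.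
by exists y; split=> //; case: (actS_fun h (act_cpath c vy ey)).
Qed.

Lemma dom_pf_cat v gam l y n z : cpath A v gam -> dv y = path_end v gam ->
  actS (PE (path_end v gam) l) y n z -> dom (pf v (gam ++ l)) (dpre v gam y).
Proof.
move=> c ey h; have [vy _] := actS_valid h; apply/dom_rg.
by do 2 eexists; rewrite path_el_cat; apply: actS_mulI h; apply: act_cpath.
Qed.

Lemma act_nseq_alpha p (i j : 'I_(k p)) (t : 'I_(nbeta j)) N r y : dvalid A y ->
  dv y = rng (beta t) -> exists n,
  actS (PE (vp A p) (nseq N (alpha i))) (dblock ((j == i) * N + r) t y) n (dblock r t y).
Proof.
move=> vy ey; elim: N => [|N [n IH]].
  by exists 0; rewrite muln0; apply/actS_vert; split=> //; apply: dvalid_block.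
rewrite /= path_el_alpha; eexists; apply: actS_mulI IH; apply/actS_edge.
rewrite mulnS -addnA; exact: ae_block.
Qed.

Lemma act_nseq_le p (i : 'I_(k p)) (t : 'I_(nbeta i)) N r y n z : dvalid A y ->
  dv y = rng (beta t) ->
  actS (PE (vp A p) (nseq N (alpha i))) (dblock r t y) n z -> (N <= r)%N.
Proof.
move=> vy ey; elim: N r n => // N IH r n.
rewrite /= path_el_alpha => /actS_mul[x2 [m1 [m2 [/actS_edge h1 h2 _]]]].
move: h1 => /(aedge_blockE _ _ _ _ vy ey)[r' [-> x2E _]]; subst x2.
by rewrite eqxx add1n ltnS; apply: IH h2.
Qed.

Lemma act_nseq_pure p (i : 'I_(k p)) N : exists n,
  actS (PE (vp A p) (nseq N (alpha i))) (dpure A p) n (dpure A p).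
Proof.
have f := ord_free i; elim: N => [|N [n IH]].
  by exists 0; apply/actS_vert; split=> //; apply: dvalid_pure.
rewrite /= path_el_alpha; eexists; apply: actS_mulI IH; apply/actS_edge.
exact: ae_pure.
Qed.

Lemma filter_foldl (h : set S) (T : Type) (s : seq T) (F : T -> S) (e : S) :
  is_filter h -> h e -> (forall t, h (F t)) -> h (foldl (fun a t => a * F t)%g e s).
Proof.
by move=> [_ _ _ hM _] + hF; elim: s e => //= t s IH e he; apply/IH/hM.
Qed.

Lemma dom_foldl (T : eqType) (s : seq T) (F : T -> S) (e : S) x :
  idem e -> (forall t, idem (F t)) -> dom (foldl (fun a t => a * F t)%g e s) x ->
  dom e x /\ {in s, forall t, dom (F t) x}.
Proof.
move=> + iF; elim: s e => //= t s IH e ie /(IH _ (idemM ie (iF t)))[/(dom_mul _ ie (iF t))[h1 h2] h3].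
by split=> // u; rewrite in_cons => /orP[/eqP->|/h3].
Qed.

Lemma dpre_inj v gam y y' : dv y = dv y' -> dpre v gam y = dpre v gam y' -> y = y'.
Proof.
case: y => a g t; case: y' => a' g' t' /= -> [+ ->].
by elim: gam => [|e gam IH] /= => [->|[/IH]].
Qed.

Lemma act_dpre_cat v gam l y n z : cpath A v gam -> dvalid A y -> dv y = path_end v gam ->
  actS (PE v (gam ++ l)) (dpre v gam y) n z -> exists n', actS (PE (path_end v gam) l) y n' z.
Proof.
move=> c vy ey; rewrite path_el_cat => /actS_mul[x [n1 [n2 [h1 h2 _]]]].
have [_ vx] := actS_valid h1; have ex := act_PE_dom h1; exists n2.
have [xx _] := actS_fun h1 (act_cpath c vx ex).
by rewrite (dpre_inj _ xx) ?ex ?ey.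
Qed.

(* Descends along connectors as long as h contains the range of one. In the free
   case without such a connector, the paths that start with alpha(p,i)^N beta(p,i,t)
   for some N < L are excluded by h, so that h contains all the alpha(p,i)^L. *)
Lemma tight_path (h : set S) p : is_tight h -> forall v gam, cpath A v gam ->
  comp (path_end v gam) = p -> h (pf v gam) ->
  exists2 x, dvalid A x & forall L, h (fseg x L).
Proof.
move=> th; have [fh _] := th; have hi : h `<=` [set e | idem e] by case: fh.
elim/(tcomp_lt_wf A): p => p IH v gam c cp hp.
case: (boolP (isfree A p)) => f.
  have ev := vp_eq f cp.
  have [[i [N [t ht]]]|nb] := pselect (exists (i : 'I_(k p)) N (t : 'I_(nbeta i)),
      h (pf v (gam ++ rcons (nseq N (alpha i)) (beta t)))).
    apply: (IH (comp (rng (beta t)))) ht; first exact: free_beta.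
      apply: cpath_cat => //; rewrite ev -cats1; apply: cpath_block; exact: cpath_nil.
    by rewrite path_end_cat path_end_rcons.
  have ha (i : 'I_(k p)) N : h (pf v (gam ++ nseq N (alpha i))).
    (* The finite cover: a path from $v^p$ either lies in the range of $\alpha(p,i)^N$ or starts
       with $\alpha(p,i)^r\beta(p,i,t)$ for some $r<N$. *)
    pose Fb (u : 'I_N * 'I_(nbeta i)) := pf v (gam ++ rcons (nseq u.1 (alpha i)) (beta u.2)).
    have [||z|z] := @tight_split h _ (pf v (gam ++ nseq N (alpha i)) |` range Fb) th hp.
    - rewrite finite_setU; split; [exact: finite_set1|apply: finite_image; exact: finite_finset].
    - by move=> z [->|[u _ <-]]; apply: rg_idem.
    - move=> dz; have [y [vy ey ->]] := dom_pf c dz; rewrite ev in ey.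
      have hN n z0 : actS (PE (vp A p) (nseq N (alpha i))) y n z0 ->
          exists2 z, (pf v (gam ++ nseq N (alpha i)) |` range Fb) z & dom z (dpre v gam y).
        by rewrite -ev => hn; eexists; [left|apply: dom_pf_cat hn => //; rewrite ey].
      have [yE|[j [t [r [z0 [vz ez yE]]]]]] := dfree_inv f ey vy; subst y.
        by have [n /hN] := act_nseq_pure i N.
      have [ji|ji] := eqVneq j i; last first.
        by have [n] := act_nseq_alpha i N r vz ez; rewrite (negPf ji) mul0n add0n => /hN.
      subst j; have [rN|Nr] := ltnP r N.
        exists (Fb (Ordinal rN, t)); first by right; exists (Ordinal rN, t).
        by apply: (dom_pf_cat c); rewrite ev //; apply: act_block.
      by have [n] := act_nseq_alpha i N (r - N) vz ez; rewrite eqxx mul1n subnKC // => /hN.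
    - by move=> [->//|[[m t] _ <-] hz]; case: nb; exists i, m, t.
  have vx : dvalid A (dpre v gam (dpure A p)).
    by have [] := actS_valid (act_cpath c (dvalid_pure f) (esym ev)).
  exists (dpre v gam (dpure A p)) => // L.
  have fs : fseg (dpre v gam (dpure A p)) L = rg (PE v gam * alphas (fun j : 'I_(k p) => L j))%g.
    by rewrite /fseg /dseg /= dpre_pure // cats0.
  (* A path in the range of each single $\alpha(p,i)^{L_i}$ lies in the range of their product,
     because only the index of its first block imposes a condition. *)
  pose e := foldl (fun a (i : 'I_(k p)) => a * pf v (gam ++ nseq (L i) (alpha i)))%g (pf v gam) (enum 'I_(k p)).
  have he : h e by apply: filter_foldl => // i; apply: ha.
  apply: (tight_dom th he); first exact: rg_idem.
  move=> x /dom_foldl[||d1 d2]; first exact: rg_idem.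
    by move=> i; apply: rg_idem.
  rewrite fs; have [y [vy ey xE]] := dom_pf c d1; rewrite ev in ey.
  have dA : exists n z, actS (alphas (fun j : 'I_(k p) => L j)) y n z.
    have [yE|[j [t [r [z0 [vz ez yE]]]]]] := dfree_inv f ey vy; subst y.
      by do 2 eexists; apply: act_alphas_pure.
    have /dom_rg[n [z]] := d2 j (mem_enum _ _).
    rewrite xE => /(act_dpre_cat c vy (etrans ey (esym ev)))[n' h2]; rewrite ev in h2.
    have Lr := act_nseq_le vz ez h2.
    have := act_alphas_block (fun j : 'I_(k p) => L j) (r - L j) vz ez.
    by rewrite subnKC // => hh; do 2 eexists; apply: hh.
  have [n [z hz]] := dA; apply/dom_rg; rewrite xE.
  by do 2 eexists; apply: actS_mulI hz; apply: act_cpath; rewrite ?ev.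
have r : ~~ isfree A (comp (path_end v gam)) by rewrite cp.
pose Q lam := is_path (cedge A p) (path_end v gam) lam /\ h (pf v (gam ++ lam)).
have [[lam [b [[pl hl] sb cb hb]]]|nb] := pselect (exists lam b, [/\ Q lam,
    src b = path_end v (gam ++ lam), connector b & h (pf v (gam ++ rcons lam b))]).
  have sp : comp (src b) = p by rewrite sb path_end_cat (is_path_comp cp pl).
  apply: (IH (comp (rng b))) hb; first by move: cb => /asboolP; rewrite sp.
    by apply: cpath_reg_connector => //; rewrite cp.
  by rewrite path_end_cat path_end_rcons.
have step lam : Q lam -> exists e, Q (rcons lam e).
  move=> [pl hl]; pose w := path_end v (gam ++ lam).
  have cw : comp w = p by rewrite /w path_end_cat (is_path_comp cp pl).
  have rw : ~~ isfree A (comp w) by rewrite cw.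
  (* Since $C_w$ has one element, finite separation bounds the edges from $w$, and the one-edge
     extensions of [lam] form a finite cover. *)
  have fin : finite_set [set e : edge E | src e = w].
    have [X sX] := reg_sep rw erefl; have [/seteqP[_ hs] _ _] := sep_partition w.
    apply: (@sub_finite_set _ _ X); first by move=> e /hs[Y]; rewrite sX => ->.
    by apply: (@finitely_separated _ A w); rewrite sX.
  have [||z|z [e se <-] he] := @tight_split h _ [set pf v (gam ++ rcons lam e) | e in [set e : edge E | src e = w]] th hl.
  - exact: finite_image.
  - by move=> z [e _ <-]; apply: rg_idem.
  - move=> /dom_rg[n [y hy]]; have [_ vy] := actS_valid hy; have ey := act_PE_dom hy.
    have [|e [y' [na vy' ey' yE se]]] := reg_head vy; first by rewrite ey.
    exists (pf v (gam ++ rcons lam e)); first by exists e => //; rewrite /= se ey.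
    apply/dom_rg; do 2 eexists; rewrite -rcons_cat path_el_rcons; apply: actS_mulI hy _.
    by apply/actS_edge; rewrite yE; apply: ae_cons.
  exists e; split=> //; rewrite -cats1; apply/is_path_cat; split=> //=; split=> //; last first.
    by rewrite se /w path_end_cat.
  have cse : comp (src e) = p by rewrite se.
  have [|//|lt] := reg_edges f (e := e) => //.
  case: nb; exists lam, e; split=> //; apply/asboolP; by rewrite cse.
have [e0 _] := reg_two_edges f cp.
have /choice[next nextP] : forall lam, exists e, Q lam -> Q (rcons lam e).
  move=> lam; have [ql|nq] := pselect (Q lam); last by exists e0.
  by have [e qe] := step lam ql; exists e.
(* Each stage extends the previous one by an edge, so the chosen edges form an infinite path in
   $E_p$. *)
pose fix lams i := if i is i'.+1 then rcons (lams i') (next (lams i')) else [::].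
have Q0 : Q [::] by split=> //; rewrite cats0.
have Ql i : Q (lams i) by elim: i => // i /= /nextP.
pose lam i := next (lams i).
have lamsE i : lams i = mkseq lam i by elim: i => // i /= IHi; rewrite mkseqS -IHi.
have tk : tail_ok A (path_end v gam) (TReg lam).
  have ql i : is_path (cedge A p) (path_end v gam) (rcons (mkseq lam i) (lam i)).
    by rewrite -mkseqS -lamsE; case: (Ql i.+1).
  have ql' i : cedge A p (lam i) /\ src (lam i) = path_end (path_end v gam) (mkseq lam i).
    by have := ql i; rewrite -cats1 => /is_path_cat[_ []].
  split=> //; first by case: (ql' 0%N).
  move=> i; rewrite cp; split; first by case: (ql' i).
  by have [_ ->] := ql' i.+1; rewrite mkseqS path_end_rcons.
exists (DPath v gam (TReg lam)) => // L.
by rewrite /fseg /dseg /dsegpath /= -lamsE; case: (Ql (L 0%N)).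
Qed.

(** Once [h] contains all [fseg x L], it is determined: each idempotent is above or orthogonal to a
    long one. *)
Lemma tight_eta (h : set S) : is_tight h -> exists2 x, dvalid A x & h = eta x.
Proof.
move=> th; have [[[e0 he0] hi h0 hM hU] _] := th.
have [v hv] : exists v, h (V v).
  case: (has_nfP e0) => [e00|[v [gam [m [w [nu [nf eE]]]]]]]; first by rewrite e00 in he0.
  (* A normal form ends with the adjoint of a path from [w], so the idempotent [e0] lies below
     [w]. *)
  exists w; apply: (hU _ _ he0); first exact: vertM.
  by rewrite /idem_le eE /normal_form_el -!mulgA -{1}vert_star -starM vert_path_el.
have [||x vx hx] := @tight_path h (comp v) th v [::] (cpath_nil A v) => //.
  by rewrite /pf /rg /path_el /= vert_star vertM.
exists x => //; apply/seteqP; split=> e.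
  move=> he; have ie := hi e he; split=> //; apply: contrapT => nd.
  have [c H] := ndom_fseg ie vx nd.
  by apply: h0; rewrite -(H (fun=> c)) //; apply: hM.
move=> [ie de]; have [c H] := dom_fseg_le ie de.
exact: (hU _ _ (hx (fun=> c)) ie (H _ (fun _ => leqnn c))).
Qed.

Lemma eta_inj x y : dvalid A x -> dvalid A y -> eta x = eta y -> x = y.
Proof.
move=> vx vy e; have sub f : idem f -> dom f x -> dom f y.
  by move=> jf df; have [] : eta y f by rewrite -e; split.
case: x vx sub {e} => v gam [|lam] vx sub; have [c tk] := vx.
  have [f ev] := tfree_end vx erefl; set p := dcomp _ in f ev.
  have xE : DPath v gam (TFree E) = dpre v gam (dpure A p) by rewrite /dpre /= cats0.
  have dN (i : 'I_(k p)) N : dom (pf v (gam ++ nseq N (alpha i))) y.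
    apply: sub; first exact: rg_idem.
    by have [n hn] := act_nseq_pure i N; rewrite xE; apply: (dom_pf_cat (y := dpure A p) c (esym ev)); rewrite [path_end _ _]ev; apply: hn.
  have dp : dom (pf v gam) y.
    apply: sub; first exact: rg_idem.
    by apply/dom_rg; rewrite xE; do 2 eexists; apply: act_cpath => //; apply: dvalid_pure.
  have [z [vz ez yE]] := dom_pf c dp; rewrite [path_end _ _]ev in ez.
  suff zE : z = dpure A p by rewrite yE zE.
  have [//|[j [s [r [z0 [vz0 ez0 zE]]]]]] := dfree_inv f ez vz.
  (* A remainder starting with a block of exponent [r] is not in the range of
     $\alpha(p,j)^{r+1}$. *)
  have /dom_rg[n [u]] := dN j r.+1; rewrite yE.
  move=> /(act_dpre_cat c vz (etrans ez (esym ev)))[n' h2]; rewrite zE [path_end _ _]ev in h2.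
  by have := act_nseq_le vz0 ez0 h2; rewrite ltnn.
have r := treg_comp vx erefl.
pose x0 := DPath (path_end v gam) [::] (TReg lam).
have vx0 : dvalid A x0 by split; [exact: cpath_nil|].
have xE : DPath v gam (TReg lam) = dpre v gam x0 by rewrite /dpre /= cats0.
have dp : dom (pf v gam) y.
  apply: sub; first exact: rg_idem.
  by apply/dom_rg; rewrite xE; do 2 eexists; apply: act_cpath.
have [z [vz ez yE]] := dom_pf c dp.
have pre N : exists ip, toinf z = ipre (path_end v gam) (mkseq lam N) ip.
  have [pl el] := tail_path N tk.
  have /dom_rg[n [u]] : dom (fseg (DPath v gam (TReg lam)) (fun=> N)) y.
    by apply: sub; [exact: rg_idem|exact: dom_fseg].
  rewrite /dseg /dsegpath /= yE => /(act_dpre_cat c vz ez)[n' h2].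
  have [_ vu] := actS_valid h2; have eu := act_PE_dom h2.
  have [h3 _ _] := act_regpath r pl vu eu.
  by have [-> _] := actS_fun h2 h3; exists (toinf u); rewrite (toinf_dcat pl).
suff zE : z = x0 by rewrite xE yE zE.
apply: (@toinf_inj _ A) => //; case: (toinf z) pre => [a g|f] pre.
  (* A path with a free end has only the finite list [g], too short to begin with [(size g).+1]
     edges of [lam]. *)
  have [[a' g'|//] h] := pre (size g).+1; have e : g = mkseq lam (size g).+1 ++ g' by case: h.
  by have := congr1 size e; rewrite size_cat size_mkseq; lia.
congr PReg; apply/funext => i; have [[//|f'] [->]] := pre i.+1.
by rewrite -/(mkseq lam i.+1) nth_mkseq //= nth_nil subn0.
Qed.

Lemma segment_el_free v gam (l : 'I_(k (comp (path_end v gam))) -> nat) :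
  isfree A (comp (path_end v gam)) ->
  segment_el l = (PE v gam * alphas l)%g.
Proof.
move=> f; rewrite /segment_el /alphas monoE time_el0 -alphas_foldl.
have h s a : foldl (fun a j => mulX a (Ed (alpha j)) (l j)) (PE v gam * a)%g s =
   (PE v gam * foldl (fun a j => mulX a (Ed (alpha j)) (l j)) a s)%g.
  by elim: s a => //= j s IH a; rewrite mulX_mull IH.
by rewrite -h -(vp_eq f erefl) path_el_end.
Qed.

Lemma segment_el_reg v gam (l : 'I_(k (comp (path_end v gam))) -> nat) :
  ~~ isfree A (comp (path_end v gam)) -> segment_el l = PE v gam.
Proof.
move=> /reg_ncyc k0; rewrite /segment_el; have : enum 'I_(k (comp (path_end v gam))) = [::].
  by apply: size0nil; rewrite size_enum_ord k0.
by move=> ->.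
Qed.

Lemma infpath_filter_eta x : dvalid A x -> infpath_filter (toinf x) = eta x.
Proof.
move=> vx; apply/seteqP; split=> e.
  move=> [ie [v [gam [l [t [isg tk xE]]]]]] /= ge; split=> //.
  suff dg : dom (rg (segment_el l)) x.
    by move: dg; rewrite /rg -ge => /dom_mul[] //; exact: rg_idem.
  apply/dom_rg; case: (boolP (isfree A (comp (path_end v gam)))) => f.
    have ev := vp_eq f erefl; move: isg; rewrite /init_segment f => c.
    have tE := tail_free f (eq_ind _ (fun w => tail_ok A w t) tk _ ev).
    have xE' : x = dpre v gam (dpure A (comp (path_end v gam))).
      apply: (@toinf_inj _ A) => //.
        by have [] := actS_valid (act_cpath c (dvalid_pure f) (esym ev)).
      by rewrite xE tE toinf_dpre ipre_infcat cats0.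
    rewrite segment_el_free // xE'; do 2 eexists; apply: actS_mulI.
      exact: (act_cpath c (dvalid_pure f) (esym ev)).
    exact: act_alphas_pure.
  by rewrite segment_el_reg //; apply: act_init_segment_reg vx xE isg tk f.
move=> [ie de]; split=> //; have [N H] := dom_fseg_le ie de.
have {}H := H (fun=> N) (fun _ => leqnn N).
have [isg ce tk xE _] := seg_data (fun=> N) vx.
exists (dv x), (dsegpath x (fun=> N)), (fun=> N), (drest x (fun=> N)); split=> //=.
suff -> : segment_el (A := A) (v := dv x) (gam := dsegpath x (fun=> N)) (fun=> N) = dseg A x (fun=> N) by [].
move: ce; rewrite /dsegend /dseg /dsegpath; case tE: (dt x) => [|lam] ce.
  by have [f _] := tfree_end vx tE; rewrite segment_el_free.
have r : ~~ isfree A (comp (path_end (dv x) (dg x ++ mkseq lam N))).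
  by rewrite ce (treg_comp vx tE).
by rewrite segment_el_reg.
Qed.

End Filters.

(** * The groupoid H *)

Section Topology.
Variables (E : sep_graph) (A : adaptable E).
Implicit Types (v w : vert E) (p q : tcomp E) (d : Zoo).
Implicit Types (x y z : dpath E) (n : Zoo * Zoo) (L : nat -> nat).

Local Notation k p := (ncyc A p).
Local Notation S := (SEC A).
Local Notation H := (Hcarrier A).

(** The common tail required by $\mathcal H$ comes from locality: a long segment of [y] is matched
    with one of [x] that leaves the same remainder. *)
Lemma act_in_H (s : S) x n y : actS s x n y -> in_H A (toinf x, n, toinf y).
Proof.
move=> h; have [vx vy] := actS_valid h; have [c Hc] := local_act h.
have [L' [_ [e1 e2 e3 e4] _]] := Hc (fun=> c) (fun _ => leqnn c).
have [i1 c1 t1 x1 l1] := seg_data L' vx; have [i2 c2 t2 y2 l2] := seg_data (fun=> c) vy.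
exists (dcomp x), (dv x), (dsegpath x L'), (fun j : 'I_(k (dcomp x)) => L' j),
  (dv y), (dsegpath y (fun=> c)), (fun j : 'I_(k (dcomp x)) => c), (drest x L').
split=> //.
- split.
    by exists (dv x), (dg x), (dt x); case: vx.
  by exists (dv y), (dg y), (dt y); rewrite e1; case: vy.
- split=> //=; first by rewrite e3.
  by rewrite l1 -e4; congr (_ - _); rewrite -l2; move: (dcomp x) e1 => q ->.
Qed.

(** The monomial is taken in the component where the paths end, so nothing is translated and $n_1$
    itself serves as the exponent [d]. *)
Lemma in_H_act (h : triple E) : in_H A h -> exists (s : S) x n y,
  actS s x n y /\ h = (toinf x, n, toinf y).
Proof.
case: h => [[ip n] iq] [p [v [gam [l [w [nu [l' [t [_ [i1 i2] [cp ew] tk [-> -> dE]]]]]]]]]].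
subst p; have tk' : tail_ok A (path_end w nu) t by rewrite ew.
case: (boolP (isfree A (comp (path_end v gam)))) => f.
  have ev := vp_eq f erefl; move: i1 i2; rewrite /init_segment ew f => c1 c2.
  have -> : t = TFree E by move: tk; rewrite {1}ev; apply: tail_free.
  have nf : is_normal_form v gam (MFree n.1 l l') w nu by split=> //=; rewrite ?ew.
  exists (normal_form_el v gam (MFree n.1 l l') w nu).
  do 3 eexists; split; first by apply/act_nf_free => //; left; exact: And3 erefl erefl erefl.
  rewrite !toinf_dpre !ipre_infcat !cats0.
  congr (_, _, _); rewrite [n]surjective_pairing dE; congr (_, _).
  have ie g (u : 'I_(k (comp (path_end v gam))) -> nat) : inf_length g u =
      \sum_(j < k (comp (path_end v gam))) 'X^j *+ u j + dunit A (comp (path_end v gam)) *+ size g.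
    rewrite /inf_length f /dunit /ndim f -sumrMnl -big_split; apply: eq_bigr => j _ /=.
    by rewrite -mulrnDr scaleZn.
  by rewrite !ie.
have r' : ~~ isfree A (comp (path_end w nu)) by rewrite ew.
have [gam' [lam [z [gE c vz ez [pl r tE gz xE]]]]] := init_segment_reg i1 tk f.
have [nu' [eta [z' [nE c' vz' ez' [pl' rr tE' gz' yE]]]]] := init_segment_reg i2 tk' r'.
have zz : z' = z.
  case: z' ez' tE' gz' {vz' yE} => a b u /= -> -> ->; case: z ez tE gz {vz xE} => a' b' u' /= -> -> ->.
  by rewrite ew.
subst z'.
have e1 : path_end v gam = path_end (path_end v gam') lam by rewrite gE path_end_cat.
have e2 : path_end w nu = path_end (path_end w nu') eta by rewrite nE path_end_cat.
have cc : comp (path_end w nu') = comp (path_end v gam').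
  by rewrite -(is_path_comp erefl pl) -e1 -ew e2 (is_path_comp erefl pl').
have nf : is_normal_form v gam' (MReg A (path_end v gam') lam (path_end w nu') eta n.1) w nu'.
  by split=> //; split=> //; rewrite -?e1 -?e2 ?ew // -cc.
exists (normal_form_el v gam' (MReg A (path_end v gam') lam (path_end w nu') eta n.1) w nu').
do 3 eexists; split; first by apply/act_nf_reg => //; exists z;
  exact: And5 vz (etrans ez e1) erefl erefl erefl.
rewrite xE yE; congr (_, _, _); rewrite [n]surjective_pairing dE /=; congr (_, _).
  by rewrite /dtr gz.
have du g (u : 'I_(k (comp (path_end v gam))) -> nat) : inf_length g u = dunit A (dcomp z) *+ size g.
  have -> : dcomp z = comp (path_end v gam) by rewrite /dcomp /dend gz ez.
  by rewrite /inf_length (negPf f) /dunit /ndim (negPf f) big_ord1 expr0 -scaleZn -alg_polyC.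
by rewrite !du gE nE !size_cat.
Qed.

Definition mkH (s : S) x n y (h : actS s x n y) : H := exist _ _ (act_in_H h).

Lemma H_data (h : H) : exists (s : S) x n y, actS s x n y /\ sval h = (toinf x, n, toinf y).
Proof. exact: in_H_act (proj2_sig h). Qed.

Lemma H_eq (h h' : H) : sval h = sval h' -> h = h'.
Proof. by case: h => a ha; case: h' => b hb /= e; apply: eq_exist. Qed.

Lemma H_val (h : H) ip n iq : Hrng h = ip -> Hdeg h = n -> Hsrc h = iq -> sval h = (ip, n, iq).
Proof. by rewrite /Hrng /Hdeg /Hsrc; case: (sval h) => [[? ?] ?] /= -> -> ->. Qed.

Lemma ZsetP (s : S) (h : H) x n y : dvalid A x -> dvalid A y ->
  sval h = (toinf x, n, toinf y) -> Zset s h <-> actS s x n y.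
Proof.
move=> vx vy hE; rewrite Zset_act; split=> [[x' [n' [y' [h']]]]|h']; last by exists x, n, y.
have [vx' vy'] := actS_valid h'.
by rewrite hE => -[/(toinf_inj vx vx') -> -> /(toinf_inj vy vy') ->].
Qed.

Lemma Zset_exists (h : H) : exists s : S, Zset s h.
Proof.
have [s [x [n [y [h1 h2]]]]] := H_data h; exists s.
by apply/Zset_act; exists x, n, y.
Qed.

Lemma Zset_restrict (s : S) y L (h : H) : Zset (s * fseg A y L)%g h <->
  Zset s h /\ exists2 y', dvalid A y' & Hsrc h = toinf y' /\ dom (fseg A y L) y'.
Proof.
have u := idem_unital (rg_idem (dseg A y L)).
split.
  move=> /Zset_act[x [n [y' [/actS_mul[z [n1 [n2 [h1 h2 ->]]]] hE]]]].
  have [zy n0] := u _ _ _ h2; subst z n2; rewrite addr0 in hE.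
  split; first by apply/Zset_act; exists x, n1, y'.
  by exists y'; [case: (actS_valid h1)|split; [rewrite /Hsrc hE|]].
move=> [/Zset_act[x [n [y'' [h1 hE]]]] [y' vy' [+ d]]].
have [_ vy''] := actS_valid h1; rewrite /Hsrc hE /= => /(toinf_inj vy'' vy') yy; subst y''.
by apply/Zset_act; exists x, n, y'; split=> //; rewrite -[n]addr0; apply: actS_mulI h1 d.
Qed.

(** By [germ_local], [s] and [s'] agree after restriction to a long segment of the source; the
    restriction is the required element. *)
Lemma Zset_inter (s s' : S) (h : H) : Zset s h -> Zset s' h ->
  exists a : S, Zset a h /\ forall h', Zset a h' -> Zset s h' /\ Zset s' h'.
Proof.
move=> hs hs'; have [x [n [y [h1 hE]]]] := (proj1 (Zset_act _ _) hs).
have [vx vy] := actS_valid h1; have /(ZsetP _ vx vy hE) h2 := hs'.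
have [L e] := germ_local h1 h2; exists (s * fseg A y L)%g; split.
  apply/Zset_restrict; split=> //; exists y => //; split; first by rewrite /Hsrc hE.
  exact: dom_fseg.
by move=> h' hz; split; [case/Zset_restrict: hz|rewrite e in hz; case/Zset_restrict: hz].
Qed.

(** The map [f] lets the lemma serve twice: with the identity for the topology of $\mathcal H$, and
    with the isomorphism to show that it is open. *)
Lemma Zset_seq (T : Type) (f : T -> H) (t : T) (s : seq (set T)) :
  (forall j, j \in s -> exists a : S, Zset a (f t) /\ forall t', Zset a (f t') -> j t') ->
  exists a : S, Zset a (f t) /\ forall t', Zset a (f t') -> forall j, j \in s -> j t'.
Proof.
elim: s => [|j s IH] hs; first by have [a ha] := Zset_exists (f t); exists a.
have [a [a1 a2]] := hs j (mem_head j s).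
have [|b [b1 b2]] := IH; first by move=> i si; apply: hs; rewrite in_cons si orbT.
have [c [c1 c2]] := Zset_inter a1 b1; exists c; split=> // t' ct' i; rewrite in_cons => /orP[/eqP->|si].
  by apply: a2; case: (c2 _ ct').
by apply: b2 => //; case: (c2 _ ct').
Qed.

Lemma Zset_open (s : S) : open (Zset s : set H).
Proof.
exists [set Zset s]; last by rewrite bigcup_set1.
by move=> _ ->; apply: (@finI_from1 _ _ _ id); exists s.
Qed.

Lemma H_nbhs (h : H) (W : set H) : nbhs h W -> exists a : S, Zset a h /\ Zset a `<=` W.
Proof.
rewrite nbhsE => -[B [[D' sD' <-] [C D'C Ch]] BW].
have [F sF FE] := sD' C D'C; rewrite -FE in Ch.
have [j jF|a [a1 a2]] := @Zset_seq _ id h (finmap.enum_fset F).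
  have /set_mem[s _ sE] := sF j jF.
  exists s; split; first by rewrite sE; apply: Ch; exact: jF.
  by move=> t'; rewrite sE.
exists a; split=> // h' ah'; apply: BW; exists C => //.
suff: C h' by [].
by rewrite -FE => j jF; apply: a2 => //; exact: jF.
Qed.

Lemma Zset_nbhs (s : S) (h : H) : Zset s h -> nbhs h (Zset s).
Proof. by move=> hs; apply: open_nbhs_nbhs; split=> //; apply: Zset_open. Qed.

Lemma H_mul_data (g h : H) (a b : S) : Hsrc g = Hrng h -> Zset a g -> Zset b h ->
  exists x y z n m, [/\ actS a x n y, actS b y m z, sval g = (toinf x, n, toinf y) &
     sval h = (toinf y, m, toinf z)].
Proof.
move=> e /Zset_act[x [n [y [h1 gE]]]] /Zset_act[y' [m [z [h2 hE]]]].
have [_ vy] := actS_valid h1; have [vy' _] := actS_valid h2.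
move: e; rewrite /Hsrc /Hrng gE hE => /(toinf_inj vy vy') yy; subst y'.
by exists x, y, z, n, m.
Qed.

Lemma H_mul_ex (g h : H) : Hsrc g = Hrng h -> exists k : H, H_mul g h k.
Proof.
move=> e; have [a ga] := Zset_exists g; have [b hb] := Zset_exists h.
have [x [y [z [n [m [h1 h2 gE hE]]]]]] := H_mul_data e ga hb.
by exists (mkH (actS_mulI h1 h2)); split=> //; rewrite /Hsrc /Hrng /Hdeg /= ?gE ?hE.
Qed.

Lemma H_mul_Zset (g h k : H) (a b : S) : H_mul g h k -> Zset a g -> Zset b h ->
  Zset (a * b)%g k.
Proof.
move=> [e e1 e2 e3] ga hb.
have [x [y [z [n [m [h1 h2 gE hE]]]]]] := H_mul_data e ga hb.
apply/Zset_act; exists x, (n + m), z; split; first exact: actS_mulI h1 h2.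
by apply: H_val; rewrite ?e1 ?e2 ?e3 /Hsrc /Hrng /Hdeg ?gE ?hE.
Qed.

Lemma H_inv_ex (g : H) : exists g' : H, H_inv g g'.
Proof.
have [s [x [n [y [h gE]]]]] := H_data g.
have h' := actS_starI h.
by exists (mkH h'); split; rewrite /Hsrc /Hrng /Hdeg gE.
Qed.

Lemma H_inv_Zset (g g' : H) (a : S) : H_inv g g' -> Zset a g -> Zset (star a) g'.
Proof.
move=> [e1 e2 e3] /Zset_act[x [n [y [h gE]]]].
apply/Zset_act; exists y, (- n), x; split; first exact: actS_starI.
by apply: H_val; rewrite ?e1 ?e2 ?e3 /Hsrc /Hrng /Hdeg ?gE.
Qed.

Lemma H_ext (h h' : H) : Hrng h = Hrng h' -> Hdeg h = Hdeg h' -> Hsrc h = Hsrc h' -> h = h'.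
Proof.
by move=> e1 e2 e3; apply: H_eq; rewrite (H_val e1 e2 e3); apply/esym/H_val.
Qed.

Lemma H_topological_groupoid : is_topological_groupoid (H_groupoid A).
Proof.
split=> /=.
- move=> g h k k' [_ a1 a2 a3] [_ b1 b2 b3].
  by apply: H_ext; rewrite ?a1 ?a2 ?a3 ?b1 ?b2 ?b3.
- move=> g; have [g' [a1 a2 a3]] := H_inv_ex g; exists g'; split=> // g'' [b1 b2 b3].
  by apply: H_ext; rewrite ?a1 ?a2 ?a3 ?b1 ?b2 ?b3.
- by move=> g g' [a1 a2 a3]; split=> //; rewrite a2 opprK.
- move=> g h k a b [a1 a2 a3 a4] [b1 b2 b3 b4].
  have [|c [c1 c2 c3 c4]] := @H_mul_ex a k; first by rewrite a4.
  exists c; split=> //; split; rewrite ?b2 // ?c2 ?c3 ?c4 ?b4 //.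
  by rewrite a3 b3 addrA.
- move=> g g' [a1 a2 a3]; split; first exact: H_mul_ex.
  move=> h k [b1 b2 b3 b4]; split; rewrite ?a3 ?b2 ?b4 // ?a1 ?b1 //.
  by rewrite a2 b3 addrA addNr add0r.
- move=> g g' [a1 a2 a3]; split; first exact: H_mul_ex.
  move=> h k [b1 b2 b3 b4]; split; rewrite ?a1 ?a3 ?b2 ?b4 // ?b1 //.
  by rewrite a2 b3 addrK.
- move=> g h k m W /H_nbhs[c [kc cW]].
  have [a ga] := Zset_exists g; have [b hb] := Zset_exists h.
  (* Continuity of the product: [c] and [a * b] agree at [k], hence also after restriction to a
     segment of its source, and this restriction can be put into [b]. *)
  have kab := H_mul_Zset m ga hb.
  have [x [n [y [h1 kE]]]] := (proj1 (Zset_act _ _) kc).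
  have [vx vy] := actS_valid h1; have /(ZsetP _ vx vy kE) h2 := kab.
  have [L e] := germ_local h1 h2.
  have hb' : Zset (b * fseg A y L)%g h.
    apply/Zset_restrict; split=> //; exists y => //; case: m => _ _ _ <-.
    by rewrite /Hsrc kE; split=> //; apply: dom_fseg.
  exists (Zset a, Zset (b * fseg A y L)%g); first by split; apply: Zset_nbhs.
  move=> [g1 h3] /= [g1a h3b] k' m'; apply: cW.
  have := H_mul_Zset m' g1a h3b; rewrite mulgA -e.
  by case/Zset_restrict.
- move=> g g' i W /H_nbhs[c [gc cW]].
  have i' : H_inv g' g by case: i => a1 a2 a3; split=> //; rewrite a2 opprK.
  have gz := H_inv_Zset i' gc; apply: filterS (Zset_nbhs gz) => h hz h' ih; apply: cW.
  by rewrite -[c]starK; apply: H_inv_Zset ih hz.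
Qed.

End Topology.

(** * The isomorphism *)

Section Transfer.
Variables (G H : groupoid_data) (phi : G -> H).

(** It spares the handling of representatives of germs, on which [germ_mul] and [germ_inv] are
    defined. *)
Lemma topological_groupoid_transfer : is_groupoid_isomorphism phi ->
  is_topological_groupoid H -> is_topological_groupoid G.
Proof.
move=> [[psi phiK psiK] phic phio phiM phiI] tH.
have inj := can_inj phiK.
have nb (g : G) W : nbhs g W -> nbhs (phi g) (phi @` W).
  rewrite nbhsE => -[B [oB Bg] BW]; apply: (filterS (P := phi @` B)).
    by move=> _ [u Bu <-]; exists u => //; apply: BW.
  by apply: open_nbhs_nbhs; split; [exact: phio|exists g].
split.
- by move=> g h k k' /phiM m /phiM m'; apply/inj/(gmul_fun tH m m').
- move=> g; have [h [h1 h2]] := ginv_fun tH (phi g); exists (psi h); split.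
    by apply/phiI; rewrite psiK.
  by move=> h' /phiI/h2 ->.
- by move=> g g' /phiI i; apply/phiI/(ginvK tH).
- move=> g h k a b /phiM m /phiM m'; have [c [c1 c2]] := gmulA tH m m'.
  by exists (psi c); split; apply/phiM; rewrite psiK.
- move=> g g' /phiI i; have [[u hu] h] := gmulKl tH i; split.
    by exists (psi u); apply/phiM; rewrite psiK.
  by move=> a b /phiM/h ?; apply/phiM.
- move=> g g' /phiI i; have [[u hu] h] := gmulKr tH i; split.
    by exists (psi u); apply/phiM; rewrite psiK.
  by move=> a b /phiM/h ?; apply/phiM.
- move=> g h k /phiM m W /nb kW; have [[P Q] [/= hP hQ] sub] := gmul_cont tH m kW.
  exists (phi @^-1` P, phi @^-1` Q); first by split; [exact: (phic g _ hP)|exact: (phic h _ hQ)].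
  move=> [g1 h1] /= [Pg Qh] k' /phiM m'.
  by have [u Wu /inj <-] := sub (phi g1, phi h1) (conj Pg Qh) _ m'.
- move=> g g' /phiI i W /nb kW; have h := ginv_cont tH i kW.
  have hn : nbhs g (phi @^-1` _) := phic g _ h.
  by apply: filterS hn => g1 /= h1 h' /phiI/h1 [u Wu /inj <-].
Qed.

End Transfer.

(** * Topologies on tight filters and on germs *)

Section TightTopology.
Variable S : starSemigroup0Type.
Local Notation TF := (tight_filter S).

Lemma tight_nbhs (h : TF) (e : S) : idem e -> sval h e -> nbhs h [set x : TF | sval x e].
Proof.
move=> ie he; pose u : {e : S | idem e} := exist _ e ie.
have hB : nbhs (indicator h) [set f : {ptws {e : S | idem e} -> bool} | f u].
  have /cvg_sup/(_ u) : nbhs (indicator h) --> indicator h by exact: cvg_id.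
  apply; exists [set f : {ptws {e : S | idem e} -> bool} | f u]; split=> //.
    by exists [set true] => //; exact: discrete_open.
  by apply/asboolP.
have hn : nbhs h (@indicator S @^-1` _) := @initial_continuous _ _ (@indicator S) h _ hB.
by apply: filterS hn => x /= /asboolP.
Qed.

(** The topology is that of pointwise convergence of indicators, so one idempotent can be tested at
    a time. *)
Lemma tight_cvg (F : set_system TF) (h : TF) : Filter F ->
  (forall e : S, idem e -> F [set x : TF | sval x e <-> sval h e]) -> F --> h.
Proof.
move=> FF cv W [_ [[V oV <-] Vh] VW].
have : (@indicator S) @ F --> indicator h.
  apply/cvg_sup => u B [_ [[C oC <-] Ch] CB].
  suff: F (@indicator S @^-1` B) by [].
  apply: filterS (cv (sval u) (proj2_sig u)) => x /= xe; apply: CB => /=.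
  suff -> : indicator x u = indicator h u by [].
  exact: asbool_equiv_eq.
move=> /(_ V) VF; apply: (filterS VW); apply: VF.
exact: open_nbhs_nbhs.
Qed.

Lemma open_D (e : S) : idem e -> open [set x : TF | sval x e].
Proof. by move=> ie; rewrite openE => x xe; apply: tight_nbhs. Qed.

Lemma germ_repr (g : germ S) : exists a, g = germ_of a.
Proof. by case: g => B [a e]; exists a; apply: eq_exist. Qed.

Lemma tight_filter_eq (x y : TF) : sval x = sval y -> x = y.
Proof. by case: x => a ha; case: y => b hb /= e; apply: eq_exist. Qed.

Lemma Theta_open (s : S) (U : set TF) : open U ->
  U `<=` [set x | sval x (star s * s)%g] -> open (Theta s U).
Proof.
move=> oU sU; exists [set Theta s U]; last by rewrite bigcup_set1.
by move=> _ ->; apply: (@finI_from1 _ _ _ id); exists s, U.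
Qed.

End TightTopology.

Section Isomorphism.
Variables (E : sep_graph) (A : adaptable E).
Implicit Types (x y z : dpath E) (n : Zoo * Zoo) (L : nat -> nat).

Local Notation S := (SEC A).
Local Notation H := (Hcarrier A).
Local Notation G := (germ S).
Local Notation TF := (tight_filter S).
Implicit Types (a b c : pregerm S) (h : H) (g : G).

Definition germ_triple a h := exists x n y,
  [/\ actS (sval a).1 x n y, sval (sval a).2 = @eta E A y & sval h = (toinf x, n, toinf y)].

Lemma eta_fseg y L : dvalid A y -> @eta E A y (fseg A y L).
Proof. by move=> vy; split; [exact: rg_idem|exact: dom_fseg]. Qed.

Lemma conj_idem (s f : S) : idem f -> idem (star s * f * s)%g.
Proof.
move=> /idem_unital u; apply: (proj1 (unital_idem _)) => x n y.
move=> /actS_mul[z [n1 [n2 [/actS_mul[w [n3 [n4 [/actS_star h1 h2 ->]]]] h3 ->]]]].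
have [wz n40] := u _ _ _ h2; subst w n4; have [<- <-] := actS_inj h1 h3.
by rewrite addr0 addrN.
Qed.

Lemma dom_conj (s f : S) x n y : idem f -> actS s x n y ->
  dom (star s * f * s)%g y <-> dom f x.
Proof.
move=> /idem_unital u h; split.
  move=> /actS_mul[z [n1 [n2 [/actS_mul[w [n3 [n4 [_ h2 _]]]] h3 _]]]].
  have [wz n40] := u _ _ _ h2; subst w n4.
  by have [<- _] := actS_fun h3 h.
move=> d; have h' := actS_starI h.
have := actS_mulI (actS_mulI h' d) h.
by rewrite addr0 addNr.
Qed.

Lemma act_eta (s : S) x n y : actS s x n y -> act s (@eta E A y) = @eta E A x.
Proof.
move=> h; apply/seteqP; split=> f [jf d]; split=> //.
  by case: d => _ /(dom_conj jf h).
by split; [exact: conj_idem|apply/(dom_conj jf h)].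
Qed.

Lemma dom_star_mul (s : S) y : dom (star s * s)%g y <-> exists x n, actS s x n y.
Proof.
split=> [/actS_mul[x [n1 [n2 [_ h _]]]]|[x [n h]]]; first by exists x, n2.
by apply/actS_mul; exists x, (- n), n; rewrite addNr; split=> //; apply: actS_starI.
Qed.

Lemma star_mul_idem (s : S) : idem (star s * s)%g.
Proof. by have := rg_idem (star s); rewrite /rg starK. Qed.

Lemma eta_star_mul (s : S) x n y : actS s x n y -> @eta E A y (star s * s)%g.
Proof.
move=> h; split; [exact: star_mul_idem|by apply/dom_star_mul; exists x, n].
Qed.

Lemma germ_triple_total a : exists h, germ_triple a h.
Proof.
case: a => -[s et] /= hs; have [y vy eE] := tight_eta (proj2_sig et).
have [_ /dom_star_mul[x [n h]]] : @eta E A y (star s * s)%g by rewrite -eE.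
by exists (mkH h), x, n, y.
Qed.

Lemma germ_triple_fun a h h' : germ_triple a h -> germ_triple a h' -> h = h'.
Proof.
move=> [x [n [y [s1 e1 hE]]]] [x' [n' [y' [s2 e2 hE']]]].
have [_ vy] := actS_valid s1; have [_ vy'] := actS_valid s2.
have yy : y = y' by apply: (eta_inj vy vy'); rewrite -e1 -e2.
subst y'; have [xx nn] := actS_fun s1 s2; subst x' n'.
by apply: H_eq; rewrite hE hE'.
Qed.

(** From equal triples, [germ_local] supplies some [fseg] of the source as the idempotent.
    Conversely, an idempotent of the filter is defined at [y], so both elements act there alike. *)
Lemma germ_triple_equiv a b h : germ_triple a h -> germ_triple b h <-> germ_equiv a b.
Proof.
move=> [x [n [y [s1 e1 hE]]]]; have [vx vy] := actS_valid s1; split.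
  move=> [x' [n' [y' [s2 e2 hE']]]]; have [vx' vy'] := actS_valid s2.
  move: hE'; rewrite hE => -[/(toinf_inj vx vx') xx nn /(toinf_inj vy vy') yy]; subst.
  split; first by apply: tight_filter_eq; rewrite e1 e2.
  have [L eL] := germ_local s1 s2; exists (fseg A y' L); split=> //.
  by rewrite e1; apply: eta_fseg.
move=> [e2 [f [fa fe]]]; exists x, n, y; split=> //; last by rewrite -e2.
rewrite e1 in fa; case: fa => jf df.
have := actS_mulI s1 df; rewrite fe addr0 => /actS_mul[z [n1 [n2 [h1 h2 nE]]]].
have [zy n20] := idem_unital jf h2; subst z n2.
by rewrite nE addr0.
Qed.

Lemma germ_of_eq a b h h' : germ_triple a h -> germ_triple b h' ->
  germ_of a = germ_of b <-> h = h'.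
Proof.
move=> ha hb; split=> [[e]|hh].
  have : germ_equiv a b.
    have : [set c | germ_equiv b c] b by apply/(germ_triple_equiv _ hb).
    by rewrite -e.
  by move/(germ_triple_equiv _ ha) => hb'; apply: germ_triple_fun hb' hb.
subst h'; apply: eq_exist; apply/seteqP; split=> c /=.
  by move/(germ_triple_equiv _ ha)/(germ_triple_equiv _ hb).
by move/(germ_triple_equiv _ hb)/(germ_triple_equiv _ ha).
Qed.

Section Phi.
Variable phi : G -> H.
Hypothesis phiP : forall a, germ_triple a (phi (germ_of a)).

Lemma phi_inj : injective phi.
Proof.
move=> g g'; have [a ->] := germ_repr g; have [b ->] := germ_repr g'.
by move/(germ_of_eq (phiP a) (phiP b)).
Qed.

Lemma phi_eq a h : germ_triple a h -> phi (germ_of a) = h.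
Proof. exact: germ_triple_fun. Qed.

Lemma pregerm_ex (s : S) x n y : actS s x n y ->
  exists a, [/\ (sval a).1 = s, sval (sval a).2 = @eta E A y &
    forall h, sval h = (toinf x, n, toinf y) -> germ_triple a h].
Proof.
move=> sx; have [_ vy] := actS_valid sx.
pose t : TF := exist _ (@eta E A y) (eta_tight vy).
have p : sval t (star s * s)%g := eta_star_mul sx.
exists (exist _ (s, t) p); split=> //= h hE.
by exists x, n, y.
Qed.

Lemma phi_bij : bijective phi.
Proof.
have /choice[psi psiP] : forall h, exists g, phi g = h.
  move=> h; have [s [x [n [y [sx hE]]]]] := H_data h.
  have [a [_ _ ha]] := pregerm_ex sx; exists (germ_of a).
  exact: phi_eq (ha h hE).
by exists psi => [g|h]; [apply: phi_inj; rewrite psiP|rewrite psiP].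
Qed.

Lemma phi_mul (g h k : G) : germ_mul g h k <-> H_mul (phi g) (phi h) (phi k).
Proof.
split.
  move=> [a [b [c [-> -> -> eab cE]]]].
  have [x [n [y' [s1 e1 gE]]]] := phiP a; have [y [m [z [s2 e2 hE]]]] := phiP b.
  have [x' [n' [z' [s3 e3 kE]]]] := phiP c.
  move: s3 e3; rewrite cE /= => s3 e3.
  have [_ vy'] := actS_valid s1; have [vy vz] := actS_valid s2; have [_ vz'] := actS_valid s3.
  have zz : z = z' by apply: (eta_inj vz vz'); rewrite -e2 -e3.
  have yy : y' = y by apply: (eta_inj vy' vy); rewrite -e1 eab e2 (act_eta s2).
  subst y' z'; have [xx nn] := actS_fun s3 (actS_mulI s1 s2); subst x' n'.
  by split; rewrite /Hsrc /Hrng /Hdeg ?gE ?hE ?kE.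
have [a ->] := germ_repr g; have [b ->] := germ_repr h; have [c0 ->] := germ_repr k.
have [x [n [y' [s1 e1 gE]]]] := phiP a; have [y [m [z [s2 e2 hE]]]] := phiP b.
have [_ vy'] := actS_valid s1; have [vy vz] := actS_valid s2.
move=> [+ k1 k2 k3]; rewrite {1}/Hsrc {1}/Hrng gE hE /= => /(toinf_inj vy' vy) yy; subst y'.
have s3 := actS_mulI s1 s2.
have p : sval (sval b).2 (star ((sval a).1 * (sval b).1) * ((sval a).1 * (sval b).1))%g.
  by rewrite e2; apply: eta_star_mul s3.
pose c : pregerm S := exist _ (((sval a).1 * (sval b).1)%g, (sval b).2) p.
exists a, b, c; split=> //; last by rewrite e1 e2 (act_eta s2).
apply/(germ_of_eq (phiP c0) (phiP c)); apply/esym/phi_eq.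
exists x, (n + m), z; split=> //.
by apply: H_val; rewrite ?k1 ?k2 ?k3 /Hsrc /Hrng /Hdeg ?gE ?hE.
Qed.

Lemma phi_inv g g' : germ_inv g g' <-> H_inv (phi g) (phi g').
Proof.
split.
  move=> [a [b [-> -> eb1 eb2]]].
  have [x [n [y [s1 e1 gE]]]] := phiP a; have [y' [m [x' [s2 e2 hE]]]] := phiP b.
  rewrite eb1 in s2; move/actS_star: s2 => s2.
  have [vx _] := actS_valid s1; have [vx' _] := actS_valid s2.
  have xx : x' = x by apply: (eta_inj vx' vx); rewrite -e2 eb2 e1 (act_eta s1).
  subst x'; have [yy nn] := actS_inj s2 s1; subst y'.
  by split; rewrite /Hsrc /Hrng /Hdeg ?gE ?hE //= -nn opprK.
have [a ->] := germ_repr g; have [b0 ->] := germ_repr g'.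
have [x [n [y [s1 e1 gE]]]] := phiP a; move=> [k1 k2 k3].
have s2 := actS_starI s1.
have [b [b1 b2 hb]] := pregerm_ex s2; exists a, b; split=> //.
  apply/(germ_of_eq (phiP b0) (phiP b)); apply/esym/phi_eq/hb.
  by apply: H_val; rewrite ?k1 ?k2 ?k3 /Hsrc /Hrng /Hdeg ?gE.
by rewrite b2 e1 (act_eta s1).
Qed.

(** In other words, the preimage of $\mathcal Z(s)$ is $\Theta(s,D_{s^*s})$. *)
Lemma Zset_phi (s : S) a : Zset s (phi (germ_of a)) <->
  exists b, [/\ germ_of b = germ_of a, (sval b).1 = s & sval (sval b).2 = sval (sval a).2].
Proof.
have [x [n [y [s1 e1 gE]]]] := phiP a; have [vx vy] := actS_valid s1.
rewrite (ZsetP _ vx vy gE); split.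
  move=> s2; have [b [b1 b2 hb]] := pregerm_ex s2; exists b; split=> //; last by rewrite b2 e1.
  by apply/(germ_of_eq (phiP b) (phiP a)); apply/phi_eq/hb.
move=> [b [eb b1 b2]]; have [x' [n' [y' [s2 e2 gE']]]] := phiP b.
have [vx' vy'] := actS_valid s2; rewrite b1 in s2.
by move: gE'; rewrite eb gE => -[/(toinf_inj vx vx') -> -> /(toinf_inj vy vy') ->].
Qed.

Lemma phi_cont : continuous phi.
Proof.
move=> g W /H_nbhs[s [sg sW]]; rewrite nbhs_filterE /fmap /=.
pose U := [set x : TF | sval x (star s * s)%g].
have oU : open U := open_D (star_mul_idem s).
have [a gE] := germ_repr g; subst g.
apply: (@filterS _ _ _ (Theta s U)).
  move=> _ [b [-> b1 _]]; apply: sW; apply/Zset_phi; by exists b.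
apply: open_nbhs_nbhs; split; first exact: Theta_open.
have [b [eb b1 b2]] := (proj1 (Zset_phi _ _) sg); exists b; split=> //.
by rewrite /U /= -b1; exact: (proj2_sig b).
Qed.

Lemma Theta_local (s : S) (U : set TF) g : open U -> Theta s U g ->
  exists t : S, Zset t (phi g) /\ forall g', Zset t (phi g') -> Theta s U g'.
Proof.
move=> oU [a [gE a1 Ua]]; subst g; have [x [n [y [s1 e1 gE]]]] := phiP a.
have [vx vy] := actS_valid s1; rewrite a1 in s1.
(* The sets containing every tight filter through [fseg A y L], for all large [L]. This filter
   converges to the source of the germ, so [U] belongs to it and [s] can be cut down to one such
   segment. *)
pose F : set_system TF := [set W | exists N : nat, forall L, (forall j, (N <= L j)%N) ->
  forall t : TF, sval t (fseg A y L) -> W t].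
have FF : Filter F.
  split=> [|P Q [c1 h1] [c2 h2]|P Q PQ [c h]]; first by exists 0%N.
    exists (maxn c1 c2) => L hL t ht; split; [apply: (h1 L) => //|apply: (h2 L) => //] => j;
      by have := hL j; rewrite geq_max => /andP[].
  by exists c => L hL t ht; apply/PQ/(h L).
have cv : F --> (sval a).2.
  apply: tight_cvg => e ie; rewrite e1; have [de|nd] := pselect (dom e y).
    have [c hc] := dom_fseg_le ie de; exists c => L hL t ht; split=> // _.
    have [[_ _ _ _ up] _] := proj2_sig t.
    by apply: (up _ _ ht ie); apply: hc.
  have [c hc] := ndom_fseg ie vy nd; exists c => L hL t ht; split; last by case.
  have [[_ _ t0 tM _] _] := proj2_sig t => te.
  by case: t0; rewrite -(hc L hL); apply: tM.
have [c hc] := cv U (open_nbhs_nbhs (conj oU Ua)).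
exists (s * fseg A y (fun=> c))%g; split.
  apply/Zset_restrict; split; first by apply/(ZsetP _ vx vy gE).
  by exists y => //; split; [rewrite /Hsrc gE|exact: dom_fseg].
move=> g' /Zset_restrict[gz [y' vy' [ge d]]].
have [b gb] := germ_repr g'; subst g'.
have [b' [eb b1 b2]] := (proj1 (Zset_phi _ _) gz); exists b'; split=> //.
apply: (hc (fun=> c)) => //; rewrite b2.
have [x'' [n'' [y'' [s2 e2 gE2]]]] := phiP b; have [_ vy''] := actS_valid s2.
move: ge; rewrite /Hsrc gE2 => /(toinf_inj vy'' vy') yy; subst y''.
by rewrite e2; split=> //; apply: rg_idem.
Qed.

Lemma phi_open (U : set G) : open U -> open (phi @` U).
Proof.
move=> oU; rewrite openE => _ [g Ug <-].
have := open_nbhs_nbhs (conj oU Ug); rewrite nbhsE => -[B [[D' sD' <-] [C D'C Cg]] BU].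
have [F sF FE] := sD' C D'C; rewrite -FE in Cg.
have [j jF|t [t1 t2]] := @Zset_seq _ A _ phi g (finmap.enum_fset F).
  have /set_mem[s [V [oV _ jE]]] := sF j jF; subst j.
  by apply: Theta_local => //; exact: (Cg (Theta s V) jF).
apply: filterS (Zset_nbhs t1) => h hz.
have [g' gh] : exists g', phi g' = h.
  by have [psi _ psiK] := phi_bij; exists (psi h).
exists g' => //; apply: BU; exists C => //; suff: C g' by [].
have gz : Zset t (phi g') by rewrite gh.
by rewrite -FE => j jF; apply: (t2 _ gz j); exact: jF.
Qed.

Lemma phi_iso : is_groupoid_isomorphism (phi : tight_groupoid S -> H_groupoid A).
Proof.
split; [exact: phi_bij|exact: phi_cont|exact: phi_open|exact: phi_mul|exact: phi_inv].
Qed.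

Lemma phi_canonical : is_canonical phi.
Proof.
move=> a; split; first by apply/Zset_phi; exists a.
have [x [n [y [s1 e1 gE]]]] := phiP a; have [_ vy] := actS_valid s1.
by rewrite /Hsrc gE infpath_filter_eta.
Qed.

End Phi.

(** The triple chosen for a germ has to serve all its representatives, which is what [germ_of_eq]
    provides. *)
Lemma germ_phi_exists : exists phi : G -> H, forall a, germ_triple a (phi (germ_of a)).
Proof.
have /choice[phi phiP] : forall g, exists h, forall a, g = germ_of a -> germ_triple a h.
  move=> g; have [a ->] := germ_repr g; have [h ha] := germ_triple_total a.
  exists h => b ab; have [h' hb] := germ_triple_total b.
  by rewrite (proj1 (germ_of_eq ha hb) ab).
by exists phi => a; apply: phiP.
Qed.

End Isomorphism.

Theorem theorem5p3 (E : sep_graph) (A : adaptable E) :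
  [/\ is_topological_groupoid (tight_groupoid (SEC A)),
      is_topological_groupoid (H_groupoid A) &
      exists phi : tight_groupoid (SEC A) -> H_groupoid A,
        is_groupoid_isomorphism phi /\ is_canonical phi].
Proof.
have [phi phiP] := germ_phi_exists A; have iso := phi_iso phiP.
have tH := H_topological_groupoid A.
split=> //; first exact: topological_groupoid_transfer iso tH.
by exists phi; split=> //; apply: phi_canonical.
Qed.
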